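(* Let $d>1$, $\alpha=(d-1)/2$, and let the wave speed $c(\cdot)\in C^2$ satisfy $0<c_0\le c(\cdot)\le c_1$ and $|c'(\cdot)|\le c_1$ for some positive constants $c_0,c_1$. Assume that $c'(u_0)>0$ for some constant $u_0$. Let $r_0>0$ and let $\phi(z)$ be a smooth function satisfying $$\phi\in C^1_c((-1,1)),\qquad \phi'(0)\le -2\max\left\{\frac{32\,c_1^2\,2^{\alpha}}{r_0\,c_0\,c'(u_0)},\ \frac{1}{c_0\,r_0^{\alpha}}\right\}.$$ Suppose that $u(t,r)\in C^1$ is a smooth solution of $$u_{tt}-c(u)\big(c(u)u_r\big)_r-\frac{(d-1)c^2(u)u_r}{r}=0$$ in $0\le t<T$, $r>0$, with initial data $$u(0,r)=u_0+\varepsilon\,\phi\left(\frac{r-r_0}{\varepsilon}\right),\qquad u_t(0,r)=\big(-c(u(0,r))+\varepsilon\big)\,u_r(0,r),$$ where $\varepsilon>0$ is a constant. Then there exists a small positive constant $\varepsilon_0$ such that $$T<\frac{r_0-\varepsilon}{c_1}\qquad\text{for any } \varepsilon<\varepsilon_0.$$ The number $\varepsilon_0$ is given by $$\sqrt{\varepsilon_0}=\min\left\{\frac{r_0\,c'(u_0)}{64\,M\,c_1^2\,(2r_0)^{\alpha}},\ \frac{1}{2M},\ \sqrt{\varepsilon'},\ \sqrt{\frac{r_0}{2}},\ \sqrt{c_0}\right\},\qquad M=\frac{K c_1 r_0^{\alpha}\sqrt{r_0}}{4c_0^2}+\frac{\alpha\sqrt{Kc_1}\,r_0^{\alpha}}{\sqrt{r_0c_0}},$$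 where the positive constants $K$ and $\varepsilon'$ are as described in the context.
   Context: The equation is the reduction of the multidimensional variational wave equation $u_{tt}-c(u)\nabla\cdot(c(u)\nabla u)=0$ to spherically symmetric functions $u=u(t,r)$, $r=|\mathbf{x}|$, $\mathbf{x}=(x_1,\dots,x_d)$. Subscripts $t,r$ denote partial derivatives, $c'$ is the derivative of $c$, and $c^2(u)=(c(u))^2$. $C^1_c((-1,1))$ denotes continuously differentiable functions with compact support in $(-1,1)$ (extended by zero). The constant $K>0$ is a constant, independent of $\varepsilon$, bounding the initial energy: for $0<\varepsilon<\min\{c_0,r_0/2\}$, $$\int_{r_0-\varepsilon}^{r_0+\varepsilon}\big[\varepsilon^2+(-2c(u(0,r))+\varepsilon)^2\big]\,r^{2\alpha}\left(\phi'\left(\frac{r-r_0}{\varepsilon}\right)\right)^2dr\le K r_0^{2\alpha}\varepsilon .$$ The left side equals $\int_0^\infty (R^2+S^2)(0,r)\,dr$ with $R=r^\alpha(u_t+c(u)u_r)$ and $S=r^\alpha(u_t-c(u)u_r)$. The constant $\varepsilon'>0$ is chosen small enough that, for $\varepsilon<\varepsilon'$ (with also $\varepsilon<\min\{c_0,r_0/2\}$), $c'(u(t,\hat r(t)))\ge \frac12 c'(u(0,r_0))\ge\frac14 c'(u_0)>0$ for times $t<(r_0-\varepsilon)/c_1$ at which the smooth solution exists, along the characteristic curve $\hat r$ defined by $\hat r'(t)=c(u(t,\hat r(t)))$, $\hat r(0)=r_0$. *)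

(* Defs.v *)
From Stdlib Require Import Reals Lra.
From Coquelicot Require Import Coquelicot.
Open Scope R_scope.

Definition Cn (n : nat) (f : R -> R) : Prop :=
  forall x : R,
    (forall k : nat, (k <= n)%nat -> ex_derive_n f k x)
    /\ continuous (Derive_n f n) x.

Definition C1c_unit (phi : R -> R) : Prop :=
  Cn 1 phi /\
  exists a b : R, -1 < a /\ b < 1 /\ forall z : R, z < a \/ b < z -> phi z = 0.

Definition alpha (d : nat) : R := (INR d - 1) / 2.

Definition dom (T : R) (p : R * R) : Prop := 0 <= fst p < T /\ 0 < snd p.

(* [ut] and [ur] are the partial derivatives of [u].  Values outside [dom T] are
   irrelevant.  Differentiability in [t] is only asked for [0 < t]; since [u] and
   [ut] are continuous on [dom T], the mean value theorem makes [ut 0 r] the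
   right derivative of [u] in [t] at [t = 0]. *)
Record C1_dom (T : R) (u ut ur : R -> R -> R) : Prop := {
  C1_cont : continuous_on (dom T) (fun p : R * R => u (fst p) (snd p));
  C1_cont_t : continuous_on (dom T) (fun p : R * R => ut (fst p) (snd p));
  C1_cont_r : continuous_on (dom T) (fun p : R * R => ur (fst p) (snd p));
  C1_derive_t : forall t r : R, 0 < t < T -> 0 < r ->
    is_derive (fun s : R => u s r) t (ut t r);
  C1_derive_r : forall t r : R, 0 <= t < T -> 0 < r ->
    is_derive (fun x : R => u t x) r (ur t r)
}.

(* A C^1 function on R^2 vanishing outside the box (t1,t2) x (r1,r2). *)
Record test_function (t1 t2 r1 r2 : R) (psi psit psir : R -> R -> R) : Prop := {
  test_cont : forall t r : R, continuity_2d_pt psi t r;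
  test_cont_t : forall t r : R, continuity_2d_pt psit t r;
  test_cont_r : forall t r : R, continuity_2d_pt psir t r;
  test_derive_t : forall t r : R, is_derive (fun s : R => psi s r) t (psit t r);
  test_derive_r : forall t r : R, is_derive (fun x : R => psi t x) r (psir t r);
  test_supp : forall t r : R, ~ (t1 < t < t2 /\ r1 < r < r2) -> psi t r = 0
}.

(* A C^1 function [u] need not have the second derivatives occurring in
     u_tt - c(u) (c(u) u_r)_r - (d-1) c(u)^2 u_r / r = 0,
   so the equation on (0,T) x (0,oo) is understood against test functions in
   C^1_c((0,T) x (0,oo)), after integrating the two second order terms by parts.
   Lemma [classical_solution] below shows that the functions for which the
   displayed equation holds pointwise are included. *)
Definition solution (d : nat) (c : R -> R) (T : R) (u ut ur : R -> R -> R) : Prop :=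
  C1_dom T u ut ur /\
  forall (t1 t2 r1 r2 : R) (psi psit psir : R -> R -> R),
    0 < t1 < t2 -> t2 < T -> 0 < r1 < r2 ->
    test_function t1 t2 r1 r2 psi psit psir ->
    RInt (fun t : R => RInt (fun r : R =>
        ut t r * psit t r
        - (c (u t r) * ur t r) * Derive (fun x : R => c (u t x) * psi t x) r
        + (INR d - 1) * (c (u t r)) ^ 2 * ur t r / r * psi t r)
      r1 r2) t1 t2 = 0.

Definition u_init (phi : R -> R) (u0 r0 eps : R) (r : R) : R :=
  u0 + eps * phi ((r - r0) / eps).

Definition initial_data (c phi : R -> R) (u0 r0 eps : R)
    (u ut ur : R -> R -> R) : Prop :=
  forall r : R, 0 < r ->
    u 0 r = u_init phi u0 r0 eps r /\
    ut 0 r = (- c (u 0 r) + eps) * ur 0 r.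

Definition energy_bound (d : nat) (c phi : R -> R) (c0 u0 r0 K : R) : Prop :=
  forall eps : R, 0 < eps -> eps < Rmin c0 (r0 / 2) ->
    RInt (fun r : R =>
        (eps ^ 2 + (- 2 * c (u_init phi u0 r0 eps r) + eps) ^ 2)
        * Rpower r (2 * alpha d) * (Derive phi ((r - r0) / eps)) ^ 2)
      (r0 - eps) (r0 + eps)
    <= K * Rpower r0 (2 * alpha d) * eps.

Definition characteristic (c : R -> R) (r0 T : R) (u : R -> R -> R)
    (rhat : R -> R) : Prop :=
  rhat 0 = r0 /\
  continuous_on (fun t : R => 0 <= t < T) rhat /\
  forall t : R, 0 < t < T -> is_derive rhat t (c (u t (rhat t))).

Definition small_data_threshold (d : nat) (c phi : R -> R) (c0 c1 u0 r0 eps' : R) : Prop :=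
  forall (eps T : R) (u ut ur : R -> R -> R) (rhat : R -> R),
    0 < eps -> eps < eps' -> eps < Rmin c0 (r0 / 2) ->
    solution d c T u ut ur ->
    initial_data c phi u0 r0 eps u ut ur ->
    characteristic c r0 T u rhat ->
    forall t : R, 0 <= t < T -> t < (r0 - eps) / c1 ->
      Derive c (u t (rhat t)) >= 1 / 2 * Derive c (u 0 r0) /\
      1 / 2 * Derive c (u 0 r0) >= 1 / 4 * Derive c u0.

Definition M_const (d : nat) (c0 c1 r0 K : R) : R :=
  K * c1 * Rpower r0 (alpha d) * sqrt r0 / (4 * c0 ^ 2)
  + alpha d * sqrt (K * c1) * Rpower r0 (alpha d) / sqrt (r0 * c0).

Definition sqrt_eps0 (d : nat) (c : R -> R) (c0 c1 u0 r0 K eps' : R) : R :=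
  let M := M_const d c0 c1 r0 K in
  Rmin (r0 * Derive c u0 / (64 * M * c1 ^ 2 * Rpower (2 * r0) (alpha d)))
    (Rmin (1 / (2 * M))
      (Rmin (sqrt eps')
        (Rmin (sqrt (r0 / 2)) (sqrt c0)))).

Lemma C1_dom_interior (T : R) (f : R -> R -> R) (t r : R) :
  continuous_on (dom T) (fun p : R * R => f (fst p) (snd p)) ->
  0 < t < T -> 0 < r -> continuity_2d_pt f t r.
Proof.
intros H Ht Hr.
apply continuity_2d_pt_filterlim; intros P HP.
assert (HD : locally (t, r) (dom T)).
{ set (m := Rmin t (Rmin (T - t) r)).
  assert (Hm : 0 < m) by (unfold m; repeat apply Rmin_case; lra).
  exists (mkposreal m Hm); intros [s x] [Hs Hx]; simpl in Hs, Hx.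
  apply Rabs_def2 in Hs; apply Rabs_def2 in Hx.
  unfold minus, plus, opp in Hs, Hx; simpl in Hs, Hx.
  assert (m <= t /\ m <= T - t /\ m <= r).
  { unfold m; generalize (Rmin_l t (Rmin (T - t) r)) (Rmin_r t (Rmin (T - t) r))
      (Rmin_l (T - t) r) (Rmin_r (T - t) r); lra. }
  unfold dom; simpl; lra. }
assert (HE := H (t, r) (conj (conj (Rlt_le _ _ (proj1 Ht)) (proj2 Ht)) Hr) P HP).
unfold filtermap, within in *.
apply (filter_imp _ _ (fun p (Hp : _ /\ _) => proj2 Hp (proj1 Hp))
  (filter_and _ _ HD HE)).
Qed.

Lemma continuity_2d_pt_slice (f : R -> R -> R) (t r : R) :
  continuity_2d_pt f t r -> continuous (fun x : R => f t x) r.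
Proof.
intros H; apply continuity_2d_pt_filterlim in H.
apply (continuous_comp_2 (fun _ : R => t) (fun x : R => x) f);
  [ apply continuous_const | apply continuous_id | exact H ].
Qed.

Lemma RInt_param_continuous (f : R -> R -> R) (t a b : R) :
  a < b ->
  (exists eta : posreal, forall s x : R, Rabs (s - t) < eta -> a <= x <= b ->
    continuity_2d_pt f s x) ->
  continuous (fun s : R => RInt (fun x : R => f s x) a b) t.
Proof.
intros Hab [eta Hf].
assert (Hex : forall s, Rabs (s - t) < eta -> ex_RInt (fun x => f s x) a b).
{ intros s Hs; apply (ex_RInt_continuous (V := R_CompleteNormedModule)); intros x Hx.
  rewrite Rmin_left, Rmax_right in Hx by lra.
  apply continuity_2d_pt_slice, Hf; trivial. }
assert (Htt : Rabs (t - t) < eta)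
  by (rewrite Rminus_diag, Rabs_R0; apply cond_pos).
apply filterlim_locally; intros e.
assert (He : 0 < e / (2 * (b - a))).
{ apply Rdiv_lt_0_compat; [ apply cond_pos | lra ]. }
destruct (uniform_continuity_2d_1d' f a b t
  (fun x Hx => Hf t x Htt Hx) (mkposreal _ He)) as [dl Hdl].
assert (Hmin : 0 < Rmin eta dl) by (apply Rmin_case; apply cond_pos).
exists (mkposreal _ Hmin); intros s Hs.
change (Rabs (s - t) < Rmin eta dl) in Hs.
assert (Hs1 := Rlt_le_trans _ _ _ Hs (Rmin_l _ _)).
assert (Hs2 := Rlt_le_trans _ _ _ Hs (Rmin_r _ _)).
change (Rabs (RInt (fun x => f s x) a b - RInt (fun x => f t x) a b) < e).
replace (RInt (fun x => f s x) a b - RInt (fun x => f t x) a b)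
  with (RInt (fun x => f s x - f t x) a b).
2:{ apply (RInt_minus (V := R_CompleteNormedModule)); apply Hex; trivial. }
apply Rle_lt_trans with ((b - a) * (e / (2 * (b - a)))).
- apply abs_RInt_le_const; [ lra | | ].
  + apply (ex_RInt_minus (V := R_NormedModule)); apply Hex; trivial.
  + intros x Hx; left; apply Rabs_def2 in Hs2.
    assert (Hd := cond_pos dl).
    apply (Hdl x t x s); try lra.
    rewrite Rminus_diag, Rabs_R0; apply cond_pos.
- assert (Hp := cond_pos e).
  replace ((b - a) * (e / (2 * (b - a)))) with (e / 2) by (field; lra); lra.
Qed.

Lemma classical_solution (d : nat) (c : R -> R) (T : R)
    (u ut ur utt curr : R -> R -> R) :
  Cn 1 c -> C1_dom T u ut ur ->
  (forall t r : R, 0 < t < T -> 0 < r ->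
    continuity_2d_pt utt t r /\
    is_derive (fun s : R => ut s r) t (utt t r) /\
    continuity_2d_pt curr t r /\
    is_derive (fun x : R => c (u t x) * ur t x) r (curr t r) /\
    utt t r - c (u t r) * curr t r
      - (INR d - 1) * (c (u t r)) ^ 2 * ur t r / r = 0) ->
  solution d c T u ut ur.
Proof.
intros Hc Hu Heq; split; [ exact Hu | ].
intros t1 t2 r1 r2 psi psit psir Ht HtT Hr Hpsi.
assert (Hab := test_supp _ _ _ _ _ _ _ Hpsi).
assert (Dc : forall z, is_derive c z (Derive c z))
  by (intros z; apply Derive_correct, (proj1 (Hc z) 1%nat); auto).
set (P := fun s x => utt s x * psi s x + ut s x * psit s x).
set (Q := fun s x => curr s x * (c (u s x) * psi s x)
  + c (u s x) * ur s x * (Derive c (u s x) * ur s x * psi s x + c (u s x) * psir s x)).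
assert (Int : forall s x, 0 < s < T -> 0 < x ->
  continuity_2d_pt P s x /\ continuity_2d_pt Q s x
  /\ is_derive (fun s => ut s x * psi s x) s (P s x)
  /\ is_derive (fun x => (c (u s x) * ur s x) * (c (u s x) * psi s x)) x (Q s x)
  /\ ut s x * psit s x
     - (c (u s x) * ur s x) * Derive (fun x => c (u s x) * psi s x) x
     + (INR d - 1) * (c (u s x)) ^ 2 * ur s x / x * psi s x = P s x - Q s x).
{ intros s x Hs Hx.
  destruct (Heq s x Hs Hx) as [H1 [H2 [H3 [H4 H5]]]].
  assert (K0 := test_cont _ _ _ _ _ _ _ Hpsi s x).
  assert (K1 := test_cont_t _ _ _ _ _ _ _ Hpsi s x).
  assert (K2 := test_cont_r _ _ _ _ _ _ _ Hpsi s x).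
  assert (K3 := C1_dom_interior _ _ s x (C1_cont _ _ _ _ Hu) Hs Hx).
  assert (K4 := C1_dom_interior _ _ s x (C1_cont_t _ _ _ _ Hu) Hs Hx).
  assert (K5 := C1_dom_interior _ _ s x (C1_cont_r _ _ _ _ Hu) Hs Hx).
  assert (K6 : continuity_2d_pt (fun s x => c (u s x)) s x).
  { apply (continuity_1d_2d_pt_comp c); trivial.
    apply continuity_pt_filterlim, (ex_derive_continuous c); eexists; apply Dc. }
  assert (K7 : continuity_2d_pt (fun s x => Derive c (u s x)) s x).
  { apply (continuity_1d_2d_pt_comp (Derive c)); trivial.
    apply continuity_pt_filterlim, (proj2 (Hc (u s x))). }
  assert (D1 : is_derive (fun x => c (u s x) * psi s x) x
    (Derive c (u s x) * ur s x * psi s x + c (u s x) * psir s x)).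
  { apply (is_derive_ext (fun x => mult (c (u s x)) (psi s x))); [ reflexivity | ].
    assert (E := is_derive_mult (fun x => c (u s x)) (psi s) x
      (ur s x * Derive c (u s x)) (psir s x)
      (is_derive_comp c (u s) x _ _ (Dc _) (C1_derive_r _ _ _ _ Hu s x
        (conj (Rlt_le _ _ (proj1 Hs)) (proj2 Hs)) Hx))
      (test_derive_r _ _ _ _ _ _ _ Hpsi s x) Rmult_comm).
    unfold plus, mult in E; simpl in E.
    replace (Derive c (u s x) * ur s x) with (ur s x * Derive c (u s x)) by ring.
    exact E. }
  split; [ | split; [ | split; [ | split ] ] ].
  - unfold P; apply continuity_2d_pt_plus; apply continuity_2d_pt_mult; trivial.
  - unfold Q; apply continuity_2d_pt_plus; repeat first
      [ assumption | apply continuity_2d_pt_mult | apply continuity_2d_pt_plus ].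
  - exact (is_derive_mult (fun s => ut s x) (fun s => psi s x) s _ _ H2
      (test_derive_t _ _ _ _ _ _ _ Hpsi s x) Rmult_comm).
  - exact (is_derive_mult (fun x => c (u s x) * ur s x)
      (fun x => c (u s x) * psi s x) x _ _ H4 D1 Rmult_comm).
  - assert (E1 : Derive (fun y : R => c (u s y) * psi s y) x =
      Derive c (u s x) * ur s x * psi s x + c (u s x) * psir s x)
      by exact (is_derive_unique _ _ _ D1).
    rewrite E1; unfold P, Q.
    apply (f_equal (fun y => y * psi s x)) in H5; ring_simplify in H5; lra. }
assert (Hin : forall s, t1 <= s <= t2 -> RInt (fun r => ut s r * psit s r
     - (c (u s r) * ur s r) * Derive (fun x => c (u s x) * psi s x) r
     + (INR d - 1) * (c (u s r)) ^ 2 * ur s r / r * psi s r) r1 r2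
   = RInt (P s) r1 r2).
{ intros s Hs.
  assert (IQ : is_RInt (Q s) r1 r2 0).
  { replace 0 with (minus ((c (u s r2) * ur s r2) * (c (u s r2) * psi s r2))
                          ((c (u s r1) * ur s r1) * (c (u s r1) * psi s r1))).
    - apply (is_RInt_derive (V := R_CompleteNormedModule)
        (fun x => (c (u s x) * ur s x) * (c (u s x) * psi s x)));
        intros x Hx; rewrite Rmin_left, Rmax_right in Hx by lra.
      + apply Int; lra.
      + apply continuity_2d_pt_slice, Int; lra.
    - rewrite (Hab s r1), (Hab s r2) by lra.
      unfold minus, plus, opp; simpl; ring. }
  rewrite (RInt_ext _ (fun x => minus (P s x) (Q s x))).
  2:{ intros x Hx; rewrite Rmin_left, Rmax_right in Hx by lra; apply Int; lra. }
  assert (EP : ex_RInt (P s) r1 r2).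
  { apply (ex_RInt_continuous (V := R_CompleteNormedModule)); intros x Hx.
    rewrite Rmin_left, Rmax_right in Hx by lra.
    apply continuity_2d_pt_slice, Int; lra. }
  rewrite (RInt_minus (V := R_CompleteNormedModule)); trivial; [ | eexists; exact IQ ].
  rewrite (is_RInt_unique _ _ _ _ IQ); unfold minus, plus, opp; simpl; ring. }
rewrite (RInt_ext _ (fun s => RInt (P s) r1 r2)).
2:{ intros s Hs; rewrite Rmin_left, Rmax_right in Hs by lra; apply Hin; lra. }
apply is_RInt_unique.
assert (Hz : forall s, (s = t1 \/ s = t2) -> RInt (fun x => ut s x * psi s x) r1 r2 = 0).
{ intros s Hs; rewrite (RInt_ext _ (fun _ => 0)).
  - rewrite RInt_const; unfold scal; simpl; unfold mult; simpl; ring.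
  - intros x Hx; rewrite (Hab s x); [ apply Rmult_0_r | destruct Hs; lra ]. }
replace 0 with (minus (RInt (fun x => ut t2 x * psi t2 x) r1 r2)
                      (RInt (fun x => ut t1 x * psi t1 x) r1 r2)).
2:{ rewrite !Hz by auto; unfold minus, plus, opp; simpl; ring. }
assert (Hnear : forall s, t1 <= s <= t2 ->
  exists eta : posreal, forall v, Rabs (v - s) < eta -> 0 < v < T).
{ intros s Hs.
  assert (Hm : 0 < Rmin s (T - s)) by (apply Rmin_case; lra).
  exists (mkposreal _ Hm); simpl; intros v Hv; apply Rabs_def2 in Hv.
  generalize (Rmin_l s (T - s)) (Rmin_r s (T - s)); lra. }
apply (is_RInt_derive (V := R_CompleteNormedModule)
  (fun s => RInt (fun x => ut s x * psi s x) r1 r2));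
  intros s Hs; rewrite Rmin_left, Rmax_right in Hs by lra;
  destruct (Hnear s Hs) as [eta Heta].
- replace (RInt (P s) r1 r2)
    with (RInt (fun x => Derive (fun v => ut v x * psi v x) s) r1 r2).
  2:{ apply RInt_ext; intros x Hx; rewrite Rmin_left, Rmax_right in Hx by lra.
      apply is_derive_unique, Int; lra. }
  apply is_derive_RInt_param.
  + exists eta; intros v Hv x Hx; rewrite Rmin_left, Rmax_right in Hx by lra.
    exists (P v x); apply Int; [ exact (Heta v Hv) | lra ].
  + intros x Hx; rewrite Rmin_left, Rmax_right in Hx by lra.
    apply continuity_2d_pt_ext_loc with P; [ | apply Int; lra ].
    assert (Hm : 0 < Rmin eta x) by (apply Rmin_case; [ apply cond_pos | lra ]).
    exists (mkposreal _ Hm); simpl; intros v y Hv Hy.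
    symmetry; apply is_derive_unique, Int.
    * apply Heta; generalize (Rmin_l eta x); lra.
    * apply Rabs_def2 in Hy; generalize (Rmin_r eta x); lra.
  + exists eta; intros v Hv.
    apply (ex_RInt_continuous (V := R_CompleteNormedModule)); intros x Hx.
    rewrite Rmin_left, Rmax_right in Hx by lra.
    apply (continuity_2d_pt_slice (fun v x => ut v x * psi v x)), continuity_2d_pt_mult.
    * apply (C1_dom_interior T); [ apply (C1_cont_t _ _ _ _ Hu) | exact (Heta v Hv) | lra ].
    * apply (test_cont _ _ _ _ _ _ _ Hpsi).
- apply RInt_param_continuous; [ lra | ].
  exists eta; intros v x Hv Hx; apply Int; [ exact (Heta v Hv) | lra ].
Qed.

(* Main.v *)
Require Import Defs.
From Stdlib Require Import Reals Lra Lia Classical.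
From Coquelicot Require Import Coquelicot.
Open Scope R_scope.

(** The solution is tested along the outgoing characteristic [rhat] issued from [(0, r0)].  With
    [v = c u_r], [R = r^alpha (u_t + v)] and [S = r^alpha (u_t - v)], the equation gives along [rhat]
    [S' = c' / (4 c r^alpha) (S^2 - R^2) + alpha c R / r],
    while conservation of [r^(2 alpha) (u_t^2 + v^2)] to the right of [rhat] bounds the integral of
    [c R^2] along [rhat] by half the initial energy, which is [O(eps)].  So the terms in [R] cost [S]
    at most [M sqrt eps <= 1/2], and as [S(0) >= 2] is large, the Riccati equation
    [S' >= k S^2] blows up before the time [r0 / (2 c1) < (r0 - eps) / c1].

    As [u] is only a C^1 weak solution, both facts are derived from the weak form: the energy identity
    by testing with a C^1 weight times a time difference quotient of [u], the equation for [S] by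
    testing with a bump function concentrating on [rhat]. *)

(** * Iterated integrals of continuous functions *)

(** The region to the right of [rhat] is unbounded, so the energy is also cut off by an outer front
    moving inwards at the maximal speed [c1]: energy can only leave through it, so its contribution
    has a sign and is dropped. Through [rhat], which moves at the local speed, the loss is the
    perfect square [c (u_t + v)^2 / 2]; this is why [R] alone is controlled there. The multiplier
    [w u_t] is not C^1; symmetric time quotients replace it because their summation by parts is
    exact for merely continuous functions. Identities tested in time become relations between two
    given times, down to [t = 0], by [weak_decrease] and a constant extension to negative times. The
    square integral of [R] serves twice: it bounds the cost to [S], and, as [u] changes along [rhat]
    at the rate [R / r^alpha], it keeps [c'(u)] near [c'(u0)], which is how a threshold [eps'] is
    found. The curve has to be constructed: [c(u)] is only locally Lipschitz in [r], so the speed is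
    truncated to a compact box before Picard iteration. *)

Definition strip (lo hi : R) (F : R -> R -> R) : Prop :=
  forall t r : R, lo < t < hi -> 0 < r -> continuity_2d_pt F t r.

Lemma locally_2d_box (P : R -> R -> Prop) (a b x y t r : R) :
  a < t < b -> x < r < y ->
  (forall s z, a < s < b -> x < z < y -> P s z) -> locally_2d P t r.
Proof.
intros Ht Hr H.
assert (Hm : 0 < Rmin (Rmin (t - a) (b - t)) (Rmin (r - x) (y - r)))
  by (repeat apply Rmin_case; lra).
exists (mkposreal _ Hm); simpl; intros s z Hs Hz.
apply Rabs_def2 in Hs; apply Rabs_def2 in Hz.
generalize (Rmin_l (Rmin (t - a) (b - t)) (Rmin (r - x) (y - r)))
  (Rmin_r (Rmin (t - a) (b - t)) (Rmin (r - x) (y - r)))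
  (Rmin_l (t - a) (b - t)) (Rmin_r (t - a) (b - t))
  (Rmin_l (r - x) (y - r)) (Rmin_r (r - x) (y - r)); intros.
apply H; lra.
Qed.

Lemma locally_open_interval (P : R -> Prop) (a b t : R) :
  a < t < b -> (forall s, a < s < b -> P s) -> locally t P.
Proof.
intros Ht H.
assert (Hm : 0 < Rmin (t - a) (b - t)) by (apply Rmin_case; lra).
exists (mkposreal _ Hm); simpl; intros s Hs.
change (Rabs (s - t) < Rmin (t - a) (b - t)) in Hs; apply Rabs_def2 in Hs.
generalize (Rmin_l (t - a) (b - t)) (Rmin_r (t - a) (b - t)); intros; apply H; lra.
Qed.

Lemma continuity_2d_pt_fst (f : R -> R) (t r : R) :
  continuous f t -> continuity_2d_pt (fun t _ => f t) t r.
Proof.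
intros H; apply (continuity_1d_2d_pt_comp f (fun t _ => t)).
- apply continuity_pt_filterlim, H.
- apply continuity_2d_pt_id1.
Qed.

Lemma continuity_2d_pt_snd (f : R -> R) (t r : R) :
  continuous f r -> continuity_2d_pt (fun _ r => f r) t r.
Proof.
intros H; apply (continuity_1d_2d_pt_comp f (fun _ r => r)).
- apply continuity_pt_filterlim, H.
- apply continuity_2d_pt_id2.
Qed.

Lemma continuity_2d_pt_comp1 (f : R -> R) (g : R -> R -> R) (t r : R) :
  continuous f (g t r) -> continuity_2d_pt g t r ->
  continuity_2d_pt (fun t r => f (g t r)) t r.
Proof.
intros H Hg; apply (continuity_1d_2d_pt_comp f g); trivial.
apply continuity_pt_filterlim, H.
Qed.

Lemma continuity_2d_pt_div (f g : R -> R -> R) (t r : R) :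
  continuity_2d_pt f t r -> continuity_2d_pt g t r -> g t r <> 0 ->
  continuity_2d_pt (fun t r => f t r / g t r) t r.
Proof.
intros; unfold Rdiv; apply continuity_2d_pt_mult; trivial.
apply continuity_2d_pt_inv; trivial.
Qed.

Lemma continuity_2d_pt_comp2 (F f g : R -> R -> R) (t r : R) :
  continuity_2d_pt F (f t r) (g t r) -> continuity_2d_pt f t r ->
  continuity_2d_pt g t r -> continuity_2d_pt (fun t r => F (f t r) (g t r)) t r.
Proof.
intros HF Hf Hg e.
destruct (HF e) as [d1 H1]; destruct (Hf d1) as [d2 H2]; destruct (Hg d1) as [d3 H3].
assert (Hm : 0 < Rmin d2 d3) by (apply Rmin_case; apply cond_pos).
exists (mkposreal _ Hm); simpl; intros s z Hs Hz; apply H1;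
  [ apply H2 | apply H3 ]; eapply Rlt_le_trans; eauto; [apply Rmin_l | apply Rmin_l | apply Rmin_r | apply Rmin_r].
Qed.

Lemma continuous_slice2 (F : R -> R -> R) (f g : R -> R) (t : R) :
  continuity_2d_pt F (f t) (g t) -> continuous f t -> continuous g t ->
  continuous (fun t => F (f t) (g t)) t.
Proof.
intros H Hf Hg; apply (continuous_comp_2 f g F); trivial.
now apply continuity_2d_pt_filterlim.
Qed.

Lemma continuous_pow2 (f : R -> R) (t : R) : continuous f t -> continuous (fun t => f t ^ 2) t.
Proof.
intros H; apply (continuous_ext (fun t => mult (f t) (f t))).
- intros x; unfold mult; simpl; ring.
- now apply (continuous_mult (K := R_AbsRing)).
Qed.

Lemma continuity_2d_pt_pow2 (f : R -> R -> R) (t r : R) :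
  continuity_2d_pt f t r -> continuity_2d_pt (fun t r => f t r ^ 2) t r.
Proof.
intros H; apply (continuity_2d_pt_ext (fun t r => f t r * f t r)); [intros; ring|].
now apply continuity_2d_pt_mult.
Qed.

(* Coquelicot often types real equations in a canonical structure over [R]. *)
Ltac eqR := match goal with |- @eq _ ?a ?b => change (@eq R a b) end.

Ltac c2d := repeat first
  [ assumption
  | match goal with H : strip _ _ _ |- _ => solve [ apply H; lra ] end
  | apply continuity_2d_pt_const
  | apply continuity_2d_pt_id1
  | apply continuity_2d_pt_id2
  | apply continuity_2d_pt_plus
  | apply continuity_2d_pt_minus
  | apply continuity_2d_pt_opp
  | apply continuity_2d_pt_mult
  | apply continuity_2d_pt_pow2
  | apply continuity_2d_pt_inv ].

Lemma strip_sub (lo hi lo' hi' : R) (F : R -> R -> R) :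
  strip lo hi F -> lo <= lo' -> hi' <= hi -> strip lo' hi' F.
Proof. intros H H1 H2 t r Ht Hr; apply H; lra. Qed.

Definition DI (t1 t2 r1 r2 : R) (F : R -> R -> R) : R :=
  RInt (fun t => RInt (fun r => F t r) r1 r2) t1 t2.

Lemma ex_inner (lo hi r1 r2 t : R) (F : R -> R -> R) :
  strip lo hi F -> 0 < r1 -> r1 <= r2 -> lo < t < hi -> ex_RInt (fun r => F t r) r1 r2.
Proof.
intros H H1 H2 Ht; apply (ex_RInt_continuous (V := R_CompleteNormedModule)); intros x Hx.
rewrite Rmin_left, Rmax_right in Hx by lra.
apply continuity_2d_pt_slice, H; lra.
Qed.

Lemma inner_continuous (lo hi r1 r2 t : R) (F : R -> R -> R) :
  strip lo hi F -> 0 < r1 < r2 -> lo < t < hi ->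
  continuous (fun s => RInt (fun r => F s r) r1 r2) t.
Proof.
intros H H1 Ht; apply RInt_param_continuous; [ lra | ].
assert (Hm : 0 < Rmin (t - lo) (hi - t)) by (apply Rmin_case; lra).
exists (mkposreal _ Hm); simpl; intros s x Hs Hx; apply Rabs_def2 in Hs.
apply H; [ | lra ].
generalize (Rmin_l (t - lo) (hi - t)) (Rmin_r (t - lo) (hi - t)); lra.
Qed.

Lemma ex_RInt_cont (f : R -> R) (a b : R) :
  a <= b -> (forall x, a <= x <= b -> continuous f x) -> ex_RInt f a b.
Proof.
intros Hab H; apply (ex_RInt_continuous (V := R_CompleteNormedModule)); intros x Hx.
rewrite Rmin_left, Rmax_right in Hx by lra; auto.
Qed.

Lemma RInt_ext_le (f g : R -> R) (a b : R) :
  a <= b -> (forall x, a < x < b -> f x = g x) -> RInt f a b = RInt g a b.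
Proof.
intros Hab H; apply RInt_ext; intros x Hx.
rewrite Rmin_left, Rmax_right in Hx by lra; auto.
Qed.

Lemma RInt_minus_R (f g : R -> R) (a b : R) :
  ex_RInt f a b -> ex_RInt g a b ->
  RInt (fun x => f x - g x) a b = RInt f a b - RInt g a b.
Proof. intros; apply (RInt_minus (V := R_CompleteNormedModule)); trivial. Qed.

Lemma RInt_plus_R (f g : R -> R) (a b : R) :
  ex_RInt f a b -> ex_RInt g a b ->
  RInt (fun x => f x + g x) a b = RInt f a b + RInt g a b.
Proof. intros; apply (RInt_plus (V := R_CompleteNormedModule)); trivial. Qed.

Lemma RInt_scal_R (f : R -> R) (k a b : R) :
  ex_RInt f a b -> RInt (fun x => k * f x) a b = k * RInt f a b.
Proof. intros; apply (RInt_scal (V := R_CompleteNormedModule)); trivial. Qed.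

Lemma RInt_const_R (k a b : R) : RInt (fun _ => k) a b = (b - a) * k.
Proof. exact (RInt_const (V := R_CompleteNormedModule) a b k). Qed.

Lemma RInt_zero (f : R -> R) (a b : R) :
  a <= b -> (forall x, a < x < b -> f x = 0) -> RInt f a b = 0.
Proof.
intros Hab H; rewrite (RInt_ext_le f (fun _ => 0)) by trivial.
rewrite RInt_const_R; unfold Rminus; apply Rmult_0_r.
Qed.

Lemma RInt_FTC (F f : R -> R) (a b : R) :
  a <= b -> (forall x, a <= x <= b -> is_derive F x (f x)) ->
  (forall x, a <= x <= b -> continuous f x) -> RInt f a b = F b - F a.
Proof.
intros Hab H1 H2; apply is_RInt_unique.
apply (is_RInt_derive (V := R_CompleteNormedModule) F f);
  intros x Hx; rewrite Rmin_left, Rmax_right in Hx by lra; auto.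
Qed.

Lemma DI_ext (t1 t2 r1 r2 : R) (F G : R -> R -> R) : t1 <= t2 -> r1 <= r2 ->
  (forall t r, t1 < t < t2 -> r1 < r < r2 -> F t r = G t r) ->
  DI t1 t2 r1 r2 F = DI t1 t2 r1 r2 G.
Proof.
intros Ht Hr H; apply RInt_ext_le; trivial; intros t H1.
apply RInt_ext_le; auto.
Qed.

Section DoubleIntegral.
Context (lo hi t1 t2 r1 r2 : R) (Ht : lo < t1 < t2) (Ht2 : t2 < hi) (Hr : 0 < r1 < r2).

Lemma ex_outer (F : R -> R -> R) :
  strip lo hi F -> ex_RInt (fun t => RInt (fun r => F t r) r1 r2) t1 t2.
Proof.
intros H; apply ex_RInt_cont; [ lra | ]; intros x Hx.
apply (inner_continuous lo hi); trivial; lra.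
Qed.

Lemma DI_plus (F G : R -> R -> R) : strip lo hi F -> strip lo hi G ->
  DI t1 t2 r1 r2 (fun t r => F t r + G t r) = DI t1 t2 r1 r2 F + DI t1 t2 r1 r2 G.
Proof.
intros HF HG; unfold DI; rewrite <- RInt_plus_R by (apply ex_outer; trivial).
apply RInt_ext_le; [ lra | ]; intros t H1.
apply RInt_plus_R; apply (ex_inner lo hi); trivial; lra.
Qed.

Lemma DI_minus (F G : R -> R -> R) : strip lo hi F -> strip lo hi G ->
  DI t1 t2 r1 r2 (fun t r => F t r - G t r) = DI t1 t2 r1 r2 F - DI t1 t2 r1 r2 G.
Proof.
intros HF HG; unfold DI; rewrite <- RInt_minus_R by (apply ex_outer; trivial).
apply RInt_ext_le; [ lra | ]; intros t H1.
apply RInt_minus_R; apply (ex_inner lo hi); trivial; lra.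
Qed.

Lemma DI_scal (k : R) (F : R -> R -> R) : strip lo hi F ->
  DI t1 t2 r1 r2 (fun t r => k * F t r) = k * DI t1 t2 r1 r2 F.
Proof.
intros HF; unfold DI; rewrite <- RInt_scal_R by (apply ex_outer; trivial).
apply RInt_ext_le; [ lra | ]; intros t H1.
apply RInt_scal_R; apply (ex_inner lo hi); trivial; lra.
Qed.

Lemma DI_bound (F : R -> R -> R) (e : R) : strip lo hi F ->
  (forall t r, t1 <= t <= t2 -> r1 <= r <= r2 -> Rabs (F t r) <= e) ->
  Rabs (DI t1 t2 r1 r2 F) <= (t2 - t1) * ((r2 - r1) * e).
Proof.
intros HF H; apply abs_RInt_le_const; [ lra | apply ex_outer; trivial | ].
intros t H1; apply abs_RInt_le_const; [ lra | | auto ].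
apply (ex_inner lo hi); trivial; lra.
Qed.

(** A translation by [h] only exchanges the end slabs [[t1, t1 + h]] and [[t2, t2 + h]], and [F]
    vanishes on both because its time window keeps the distance [h] from [t1] and [t2]. This is what
    moves difference quotients from one factor to another. *)
Lemma DI_shift (F : R -> R -> R) (a1 a2 h : R) : strip lo hi F ->
  0 < h -> t1 + h <= a1 -> a2 + h <= t2 -> t2 + h < hi -> a1 <= a2 ->
  (forall t r, 0 < r -> t <= a1 \/ a2 <= t -> F t r = 0) ->
  DI t1 t2 r1 r2 (fun t r => F (t + h) r) = DI t1 t2 r1 r2 F.
Proof.
intros HF Hh H1 H2 H3 Ha HZ; unfold DI.
set (G := fun t => RInt (fun r => F t r) r1 r2).
assert (ZG : forall t, t <= a1 \/ a2 <= t -> G t = 0).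
{ intros t H; apply RInt_zero; [ lra | ]; intros; apply HZ; trivial; lra. }
assert (CG : forall t, lo < t < hi -> continuous G t)
  by (intros; apply (inner_continuous lo hi); trivial).
assert (EG : forall a b, lo < a -> b < hi -> a <= b -> ex_RInt G a b)
  by (intros; apply ex_RInt_cont; trivial; intros; apply CG; lra).
change (RInt (fun t => G (t + h)) t1 t2 = RInt G t1 t2).
assert (E := RInt_comp_lin G 1 h t1 t2).
rewrite !Rmult_1_l in E.
rewrite (RInt_ext_le (fun t => G (t + h)) (fun y => scal 1 (G (1 * y + h)))); [ | lra | ].
2:{ intros x Hx; rewrite (Rmult_1_l x); rewrite Rmult_1_l; reflexivity. }
rewrite E by (apply EG; lra).
rewrite <- (RInt_Chasles G (t1 + h) t2 (t2 + h)) by (apply EG; lra).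
rewrite <- (RInt_Chasles G t1 (t1 + h) t2) by (apply EG; lra).
unfold plus; simpl.
rewrite (RInt_zero G t1 (t1 + h)), (RInt_zero G t2 (t2 + h)); try lra;
  intros; apply ZG; lra.
Qed.

End DoubleIntegral.

(** Uniform continuity with tolerance 1 gives a step [dl]. Every point of the box is reached from
    the corner [(a, x)] by finitely many moves of length [dl / 2] in both coordinates at once,
    truncated at [a] and [x] by [Rmax], and each move costs at most 1. *)
Lemma box_bounded (f : R -> R -> R) (a b x y : R) :
  a <= b -> x <= y ->
  (forall t r, a <= t <= b -> x <= r <= y -> continuity_2d_pt f t r) ->
  exists B : R, 0 < B /\ forall t r, a <= t <= b -> x <= r <= y -> Rabs (f t r) <= B.
Proof.
intros Hab Hxy H.
destruct (uniform_continuity_2d f a b x y H (mkposreal 1 Rlt_0_1)) as [dl Hdl]; simpl in Hdl.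
assert (Hd := cond_pos dl).
assert (Hn : forall n : nat, forall t r, a <= t <= b -> x <= r <= y ->
  t <= a + INR n * (dl / 2) -> r <= x + INR n * (dl / 2) ->
  Rabs (f t r) <= Rabs (f a x) + INR n).
{ induction n as [ | n IH ]; intros t r Ht Hr; rewrite ?S_INR; simpl; intros H1 H2.
  - replace t with a by lra; replace r with x by lra; lra.
  - assert (IH' := IH (Rmax a (t - dl / 2)) (Rmax x (r - dl / 2))).
    assert (Hc := Hdl (Rmax a (t - dl / 2)) (Rmax x (r - dl / 2)) t r).
    assert (P1 : a <= Rmax a (t - dl/2) <= b) by (unfold Rmax; destruct Rle_dec; lra).
    assert (P2 : x <= Rmax x (r - dl/2) <= y) by (unfold Rmax; destruct Rle_dec; lra).
    assert (N := pos_INR n).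
    assert (Rabs (f t r - f (Rmax a (t - dl / 2)) (Rmax x (r - dl / 2))) < 1).
    { apply Hc; trivial.
      - apply Rabs_def1; unfold Rmax; destruct Rle_dec; lra.
      - apply Rabs_def1; unfold Rmax; destruct Rle_dec; lra. }
    assert (0 <= INR n * (dl / 2)) by (apply Rmult_le_pos; lra).
    assert (Rabs (f (Rmax a (t - dl / 2)) (Rmax x (r - dl / 2))) <= Rabs (f a x) + INR n).
    { apply IH'; trivial; unfold Rmax; destruct Rle_dec; lra. }
    generalize (Rabs_triang (f t r - f (Rmax a (t - dl / 2)) (Rmax x (r - dl / 2)))
      (f (Rmax a (t - dl / 2)) (Rmax x (r - dl / 2)))).
    replace (f t r - f (Rmax a (t - dl / 2)) (Rmax x (r - dl / 2)) +
      f (Rmax a (t - dl / 2)) (Rmax x (r - dl / 2))) with (f t r) by ring; lra. }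
destruct (nfloor_ex ((Rmax (b - a) (y - x)) / (dl / 2))) as [N [HN1 HN2]].
{ apply Rdiv_le_0_compat; [ | lra ]; apply Rle_trans with (b - a); [ lra | apply Rmax_l ]. }
assert (HM : Rmax (b - a) (y - x) <= INR (S N) * (dl / 2)).
{ rewrite S_INR; apply Rlt_le in HN2.
  apply (Rmult_le_compat_r (dl / 2)) in HN2; [ | lra ].
  unfold Rdiv at 1 in HN2; rewrite Rmult_assoc, Rinv_l in HN2; lra. }
generalize (Rmax_l (b - a) (y - x)) (Rmax_r (b - a) (y - x)); intros M1 M2.
exists (Rabs (f a x) + INR (S N)); split.
- generalize (Rabs_pos (f a x)) (pos_INR N); rewrite S_INR; lra.
- intros t r Ht Hr; apply Hn; lra.
Qed.

(** * C^1 functions and uniform limits *)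

Definition C1_at (f ft fr : R -> R -> R) (t r : R) : Prop :=
  (continuity_2d_pt f t r /\ continuity_2d_pt ft t r /\ continuity_2d_pt fr t r)
  /\ is_derive (fun s => f s r) t (ft t r) /\ is_derive (fun x => f t x) r (fr t r).

Lemma is_derive_mult_R (f g : R -> R) (x df dg : R) :
  is_derive f x df -> is_derive g x dg ->
  is_derive (fun x => f x * g x) x (df * g x + f x * dg).
Proof. intros Hf Hg; exact (is_derive_mult f g x df dg Hf Hg Rmult_comm). Qed.

Lemma is_derive_comp_R (f g : R -> R) (x df dg : R) :
  is_derive f (g x) df -> is_derive g x dg ->
  is_derive (fun x => f (g x)) x (df * dg).
Proof.
intros Hf Hg; rewrite Rmult_comm; exact (is_derive_comp f g x df dg Hf Hg).
Qed.

Lemma C1_at_mult (f ft fr g gt gr : R -> R -> R) (t r : R) :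
  C1_at f ft fr t r -> C1_at g gt gr t r ->
  C1_at (fun t r => f t r * g t r) (fun t r => ft t r * g t r + f t r * gt t r)
    (fun t r => fr t r * g t r + f t r * gr t r) t r.
Proof.
intros [[F1 [F2 F3]] [F4 F5]] [[G1 [G2 G3]] [G4 G5]].
split; [ repeat split; c2d | split ].
- exact (is_derive_mult_R (fun s => f s r) (fun s => g s r) t _ _ F4 G4).
- exact (is_derive_mult_R (fun s => f t s) (fun s => g t s) r _ _ F5 G5).
Qed.

Lemma C1_at_comp (k k' : R -> R) (f ft fr : R -> R -> R) (t r : R) :
  (forall z, is_derive k z (k' z)) -> (forall z, continuous k' z) ->
  C1_at f ft fr t r ->
  C1_at (fun t r => k (f t r)) (fun t r => k' (f t r) * ft t r)
    (fun t r => k' (f t r) * fr t r) t r.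
Proof.
intros Hk Hk' [[F1 [F2 F3]] [F4 F5]].
assert (K1 : continuity_2d_pt (fun t r => k (f t r)) t r).
{ apply continuity_2d_pt_comp1; trivial.
  apply (ex_derive_continuous k); eexists; apply Hk. }
assert (K2 : continuity_2d_pt (fun t r => k' (f t r)) t r)
  by (apply continuity_2d_pt_comp1; trivial).
split; [ repeat split; c2d | split ].
- exact (is_derive_comp_R k (fun s => f s r) t _ _ (Hk _) F4).
- exact (is_derive_comp_R k (fun s => f t s) r _ _ (Hk _) F5).
Qed.

Lemma C1_at_ext (f ft fr ft' fr' : R -> R -> R) (t r : R) :
  C1_at f ft fr t r ->
  (forall t r, ft t r = ft' t r) -> (forall t r, fr t r = fr' t r) ->
  C1_at f ft' fr' t r.
Proof.
intros [[F1 [F2 F3]] [F4 F5]] H1 H2; rewrite H1 in F4; rewrite H2 in F5.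
split; [ repeat split; trivial | split; trivial ].
- exact (continuity_2d_pt_ext _ _ _ _ H1 F2).
- exact (continuity_2d_pt_ext _ _ _ _ H2 F3).
Qed.


Lemma is_derive_ext_interval (f g : R -> R) (a b x l : R) :
  a < x < b -> (forall s, a < s < b -> f s = g s) -> is_derive f x l -> is_derive g x l.
Proof.
intros Hx H; apply is_derive_ext_loc.
exact (locally_open_interval (fun s => f s = g s) a b x Hx H).
Qed.

Lemma C1_at_zero (f ft fr : R -> R -> R) (a b x y t r : R) :
  a < t < b -> x < r < y ->
  (forall t r, a < t < b -> x < r < y -> f t r = 0 /\ ft t r = 0 /\ fr t r = 0) ->
  C1_at f ft fr t r.
Proof.
intros Ht Hr H.
assert (HC : forall g : R -> R -> R, (forall t r, a < t < b -> x < r < y -> 0 = g t r) ->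
  continuity_2d_pt g t r).
{ intros g Hg; apply (continuity_2d_pt_ext_loc (fun _ _ => 0)).
  - apply (locally_2d_box _ a b x y); trivial.
  - apply continuity_2d_pt_const. }
split; [ repeat split; apply HC; intros s z Hs Hz; symmetry; apply (H s z Hs Hz) | ].
destruct (H t r Ht Hr) as [_ [H1 H2]]; rewrite H1, H2.
split.
- apply (is_derive_ext_interval (fun _ => 0) _ a b); trivial.
  + intros s Hs; symmetry; apply (H s r Hs Hr).
  + apply (is_derive_const (K := R_AbsRing) (V := R_NormedModule)).
- apply (is_derive_ext_interval (fun _ => 0) _ x y); trivial.
  + intros z Hz; symmetry; apply (H t z Ht Hz).
  + apply (is_derive_const (K := R_AbsRing) (V := R_NormedModule)).
Qed.

(** The plane is covered by the open box and four open half-planes on which everything vanishes; the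
    strict gaps make them overlap. A test function must be C^1 on the whole plane, while weights
    containing [Rpower r _] are controlled only for [r > 0]. *)
Lemma C1_at_box_extend (t1 t2 r1 r2 a1 a2 b1 b2 : R) (psi psit psir : R -> R -> R) :
  t1 < a1 -> a2 < t2 -> r1 < b1 -> b2 < r2 ->
  (forall t r, t1 < t < t2 -> r1 < r < r2 -> C1_at psi psit psir t r) ->
  (forall t r, ~ (a1 <= t <= a2 /\ b1 <= r <= b2) ->
    psi t r = 0 /\ psit t r = 0 /\ psir t r = 0) ->
  forall t r, C1_at psi psit psir t r.
Proof.
intros Ha1 Ha2 Hb1 Hb2 HC HZ t r.
destruct (Rle_or_lt t t1).
{ apply (C1_at_zero _ _ _ (t - 1) a1 (r - 1) (r + 1)); try lra.
  intros; apply HZ; lra. }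
destruct (Rle_or_lt t2 t).
{ apply (C1_at_zero _ _ _ a2 (t + 1) (r - 1) (r + 1)); try lra.
  intros; apply HZ; lra. }
destruct (Rle_or_lt r r1).
{ apply (C1_at_zero _ _ _ (t - 1) (t + 1) (r - 1) b1); try lra.
  intros; apply HZ; lra. }
destruct (Rle_or_lt r2 r).
{ apply (C1_at_zero _ _ _ (t - 1) (t + 1) b2 (r + 1)); try lra.
  intros; apply HZ; lra. }
apply HC; lra.
Qed.

Lemma test_intro (t1 t2 r1 r2 a1 a2 b1 b2 : R) (psi psit psir : R -> R -> R) :
  t1 < a1 -> a2 < t2 -> r1 < b1 -> b2 < r2 ->
  (forall t r, t1 < t < t2 -> r1 < r < r2 -> C1_at psi psit psir t r) ->
  (forall t r, ~ (a1 <= t <= a2 /\ b1 <= r <= b2) ->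
    psi t r = 0 /\ psit t r = 0 /\ psir t r = 0) ->
  test_function t1 t2 r1 r2 psi psit psir.
Proof.
intros Ha1 Ha2 Hb1 Hb2 HC HZ.
assert (H := C1_at_box_extend t1 t2 r1 r2 a1 a2 b1 b2 psi psit psir Ha1 Ha2 Hb1 Hb2 HC HZ).
split; intros t r; try apply (H t r).
intros Hn; apply HZ; lra.
Qed.

(** * Uniform convergence of shifts and difference quotients as the time step tends to 0 *)

Section UniformLimits.
Context (lo hi t1 t2 r1 r2 : R) (Ht : lo < t1 < t2) (Ht2 : t2 < hi) (Hr : 0 < r1 < r2).

Definition unif (F : R -> R -> R -> R) (f : R -> R -> R) : Prop :=
  forall e : R, 0 < e -> exists dl : R, 0 < dl /\
    forall h t r, 0 < h < dl -> t1 <= t <= t2 -> r1 <= r <= r2 ->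
      Rabs (F h t r - f t r) <= e.

Lemma strip_bounded (f : R -> R -> R) : strip lo hi f ->
  exists B, 0 < B /\ forall t r, t1 <= t <= t2 -> r1 <= r <= r2 -> Rabs (f t r) <= B.
Proof. intros H; apply box_bounded; try lra; intros; apply H; lra. Qed.

Lemma strip_near (f : R -> R -> R) (e : R) : strip lo hi f -> 0 < e ->
  exists dl, 0 < dl /\ lo < t1 - dl /\ t2 + dl < hi /\
    forall t s r, t1 <= t <= t2 -> r1 <= r <= r2 -> Rabs (s - t) <= dl ->
      Rabs (f s r - f t r) <= e.
Proof.
intros H He.
set (m := Rmin (t1 - lo) (hi - t2)).
assert (Hm : 0 < m) by (unfold m; apply Rmin_case; lra).
assert (m <= t1 - lo) by apply Rmin_l.
assert (m <= hi - t2) by apply Rmin_r.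
destruct (uniform_continuity_2d f (t1 - m / 2) (t2 + m / 2) r1 r2) with (eps := mkposreal e He)
  as [dl Hdl]; [ intros; apply H; lra | ]; simpl in Hdl.
assert (Hd := cond_pos dl).
exists (Rmin (m / 2) (dl / 2)).
assert (M1 := Rmin_l (m / 2) (dl / 2)); assert (M2 := Rmin_r (m / 2) (dl / 2)).
split; [ apply Rmin_case; lra | split; [ lra | split; [ lra | ] ] ].
intros t s r Hts Hrs H3; apply Rlt_le, Hdl; try lra.
- apply Rabs_le_between in H3; lra.
- rewrite Rminus_diag, Rabs_R0; lra.
Qed.

Lemma unif_const (f : R -> R -> R) : unif (fun _ => f) f.
Proof.
intros e He; exists 1; split; [ lra | intros ].
rewrite Rminus_diag, Rabs_R0; lra.
Qed.

Lemma unif_plus F f G g : unif F f -> unif G g ->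
  unif (fun h t r => F h t r + G h t r) (fun t r => f t r + g t r).
Proof.
intros HF HG e He.
destruct (HF (e / 2)) as [d1 [D1 H1]]; [ lra | ].
destruct (HG (e / 2)) as [d2 [D2 H2]]; [ lra | ].
exists (Rmin d1 d2); split; [ apply Rmin_case; lra | ]; intros h t r Hh Ht' Hr'.
assert (M1 := Rmin_l d1 d2); assert (M2 := Rmin_r d1 d2).
specialize (H1 h t r); specialize (H2 h t r).
replace (F h t r + G h t r - (f t r + g t r))
  with ((F h t r - f t r) + (G h t r - g t r)) by ring.
eapply Rle_trans; [ apply Rabs_triang | ].
assert (Rabs (F h t r - f t r) <= e / 2) by (apply H1; lra).
assert (Rabs (G h t r - g t r) <= e / 2) by (apply H2; lra).
lra.
Qed.

Lemma unif_mult F f G g : strip lo hi f -> strip lo hi g -> unif F f -> unif G g ->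
  unif (fun h t r => F h t r * G h t r) (fun t r => f t r * g t r).
Proof.
intros Sf Sg HF HG e He.
destruct (strip_bounded f Sf) as [A [HA BA]]; destruct (strip_bounded g Sg) as [B [HB BB]].
assert (Hk : 0 < A + B + 1) by lra.
(* If both factors are off by at most [k <= 1], the product is off by at most
   [k^2 + A k + B k <= k (A + B + 1) <= e]. *)
set (k := Rmin 1 (e / (A + B + 1))).
assert (K : 0 < k) by (apply Rmin_case; [ lra | apply Rdiv_lt_0_compat; lra ]).
assert (K1 : k <= 1) by apply Rmin_l.
assert (K2 : k * (A + B + 1) <= e).
{ assert (k <= e / (A + B + 1)) by apply Rmin_r.
  apply (Rmult_le_compat_r (A + B + 1)) in H; [ | lra ].
  unfold Rdiv in H; rewrite Rmult_assoc, Rinv_l in H; lra. }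
destruct (HF k K) as [d1 [D1 H1]]; destruct (HG k K) as [d2 [D2 H2]].
exists (Rmin d1 d2); split; [ apply Rmin_case; lra | ]; intros h t r Hh Ht' Hr'.
assert (M1 := Rmin_l d1 d2); assert (M2 := Rmin_r d1 d2).
assert (E1 : Rabs (F h t r - f t r) <= k) by (apply H1; lra).
assert (E2 : Rabs (G h t r - g t r) <= k) by (apply H2; lra).
assert (E3 := BA t r Ht' Hr'); assert (E4 := BB t r Ht' Hr').
replace (F h t r * G h t r - f t r * g t r)
  with ((F h t r - f t r) * (G h t r - g t r)
    + (f t r * (G h t r - g t r) + g t r * (F h t r - f t r))) by ring.
eapply Rle_trans; [ apply Rabs_triang | ].
eapply Rle_trans; [ apply Rplus_le_compat_l, Rabs_triang | ].
rewrite !Rabs_mult.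
assert (P1 := Rabs_pos (F h t r - f t r)); assert (P2 := Rabs_pos (G h t r - g t r)).
assert (P3 := Rabs_pos (f t r)); assert (P4 := Rabs_pos (g t r)).
apply Rle_trans with (k * 1 + (A * k + B * k)); [ | lra ].
apply Rplus_le_compat; [ | apply Rplus_le_compat ]; apply Rmult_le_compat; lra.
Qed.

Lemma unif_shift (f : R -> R -> R) (sg : R) : strip lo hi f -> Rabs sg <= 1 ->
  unif (fun h t r => f (t + sg * h) r) f.
Proof.
intros Sf Hs e He.
destruct (strip_near f e Sf He) as [dl [D1 [_ [_ D2]]]].
exists dl; split; [ trivial | ]; intros h t r Hh Ht' Hr'; apply D2; trivial.
replace (t + sg * h - t) with (sg * h) by ring.
rewrite Rabs_mult, (Rabs_pos_eq h) by lra.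
generalize (Rabs_pos sg); intros; apply Rle_trans with (1 * h); [ | lra ].
apply Rmult_le_compat_r; lra.
Qed.

(** By the mean value theorem the quotient is [ft] at a time within [h] of [t]. The offsets [p] and
    [p + 1] cover the forward quotient [(0, 1)] and the backward quotient [(-1, 0)] at once. *)
Lemma unif_quotient (f ft : R -> R -> R) (p q : R) :
  strip lo hi ft ->
  (forall t r, lo < t < hi -> 0 < r -> is_derive (fun s => f s r) t (ft t r)) ->
  -1 <= p -> q = p + 1 -> q <= 1 ->
  unif (fun h t r => (f (t + q * h) r - f (t + p * h) r) / h) ft.
Proof.
intros Sf Df Hp Hq Hq' e He.
destruct (strip_near ft e Sf He) as [dl [D1 [D3 [D4 D2]]]].
exists dl; split; [ trivial | ]; intros h t r Hh Ht' Hr'.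
assert (B1 : - h <= p * h <= 0) by nra.
assert (B2 : 0 <= q * h <= h) by nra.
assert (B3 : q * h = p * h + h) by (rewrite Hq; ring).
destruct (MVT_gen (fun s => f s r) (t + p * h) (t + q * h) (fun s => ft s r))
  as [z [Hz1 Hz2]].
- intros x; rewrite Rmin_left, Rmax_right by lra; intros; apply Df; lra.
- intros x; rewrite Rmin_left, Rmax_right by lra; intros.
  apply continuity_pt_filterlim, (ex_derive_continuous (fun s => f s r)).
  eexists; apply Df; lra.
- rewrite Rmin_left, Rmax_right in Hz1 by lra; rewrite Hz2.
  replace (ft z r * (t + q * h - (t + p * h)) / h) with (ft z r)
    by (rewrite B3; field; lra).
  apply D2; trivial; apply Rabs_le_between; lra.
Qed.

(** Time shifts leave [F h] continuous only on a narrower strip than [f], hence the separate bounds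
    [lo'] and [hi']; the comparison of the integrals takes place on the intersection of the two
    strips. *)
Lemma DI_unif_zero (F : R -> R -> R -> R) (f : R -> R -> R) (lo' hi' h0 : R) :
  strip lo hi f -> unif F f -> lo' < t1 -> t2 < hi' -> 0 < h0 ->
  (forall h, 0 < h < h0 -> strip lo' hi' (F h)) ->
  (forall h, 0 < h < h0 -> DI t1 t2 r1 r2 (F h) = 0) -> DI t1 t2 r1 r2 f = 0.
Proof.
intros Sf HF Hlo Hhi Hh0 SF HZ.
apply cond_eq; intros e He; rewrite Rminus_0_r.
set (k := (t2 - t1) * (r2 - r1)).
assert (Hk : 0 < k) by (apply Rmult_lt_0_compat; lra).
destruct (HF (e / (2 * k))) as [dl [D1 D2]]; [ apply Rdiv_lt_0_compat; lra | ].
set (h := Rmin h0 dl / 2).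
assert (Hm : 0 < Rmin h0 dl) by (apply Rmin_case; lra).
assert (M1 := Rmin_l h0 dl); assert (M2 := Rmin_r h0 dl).
assert (Hh : 0 < h /\ h < h0 /\ h < dl) by (unfold h; lra).
assert (S1 : strip (Rmax lo lo') (Rmin hi hi') (F h)).
{ apply (strip_sub lo' hi'); [ apply SF; lra | apply Rmax_r | apply Rmin_r ]. }
assert (S2 : strip (Rmax lo lo') (Rmin hi hi') f).
{ apply (strip_sub lo hi); [ trivial | apply Rmax_l | apply Rmin_l ]. }
assert (L1 : Rmax lo lo' < t1 < t2) by (split; [ apply Rmax_case | ]; lra).
assert (L2 : t2 < Rmin hi hi') by (apply Rmin_case; lra).
assert (E := DI_minus _ _ t1 t2 r1 r2 L1 L2 Hr _ _ S1 S2).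
rewrite (HZ h) in E by lra.
replace (DI t1 t2 r1 r2 f) with (- DI t1 t2 r1 r2 (fun t r => F h t r - f t r)) by lra.
rewrite Rabs_Ropp.
eapply Rle_lt_trans; [ apply (DI_bound _ _ t1 t2 r1 r2 L1 L2 Hr _ (e / (2 * k))) | ].
- intros t r Ht' Hr'; apply continuity_2d_pt_minus; [ apply S1 | apply S2 ]; trivial.
- intros t r Ht' Hr'; apply D2; lra.
- replace ((t2 - t1) * ((r2 - r1) * (e / (2 * k)))) with (e / 2); [ lra | ].
  unfold k; field; lra.
Qed.

End UniformLimits.

(** * Summation by parts in time *)

Definition shift (sg : R) (f : R -> R -> R) (h t r : R) : R := f (t + sg * h) r.

(** The denominator is [h] whatever [q - p] is, so the symmetric quotient is
    [quot (-1) 1 f h / 2]. *)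
Definition quot (p q : R) (f : R -> R -> R) (h t r : R) : R :=
  (f (t + q * h) r - f (t + p * h) r) / h.

Lemma strip_shift (lo hi sg h : R) (f : R -> R -> R) :
  strip lo hi f -> Rabs sg <= 1 -> 0 < h -> strip (lo + h) (hi - h) (shift sg f h).
Proof.
intros H Hs Hh t r Ht Hr; unfold shift.
assert (B : - h <= sg * h <= h).
{ apply Rabs_le_between; rewrite Rabs_mult, (Rabs_pos_eq h) by lra.
  generalize (Rabs_pos sg); nra. }
apply (continuity_2d_pt_comp2 f (fun t _ => t + sg * h) (fun _ r => r)).
- apply H; lra.
- c2d.
- c2d.
Qed.

Lemma strip_quot (lo hi p q h : R) (f : R -> R -> R) :
  strip lo hi f -> Rabs p <= 1 -> Rabs q <= 1 -> 0 < h ->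
  strip (lo + h) (hi - h) (quot p q f h).
Proof.
intros H Hp Hq Hh t r Ht Hr; unfold quot; apply continuity_2d_pt_div; [ | c2d | lra ].
apply continuity_2d_pt_minus;
  [ exact (strip_shift lo hi q h f H Hq Hh t r Ht Hr)
  | exact (strip_shift lo hi p h f H Hp Hh t r Ht Hr) ].
Qed.

Ltac sgn := solve [ unfold Rabs; destruct Rcase_abs; lra ].

Section Shifts.
Context (T t1 t2 r1 r2 a1 a2 h : R) (w : R -> R -> R).
Context (Hh : 0 < h) (Ht1 : h < t1) (Ht1' : t1 + h <= a1) (Ha : a1 <= a2)
  (Ht2 : a2 + 2 * h <= t2) (Ht2' : t2 + h < T) (Hr : 0 < r1 < r2).
Context (Sw : strip 0 T w)
  (Zw : forall t r, 0 < r -> t <= a1 \/ a2 <= t -> w t r = 0).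

(** Discrete form of [w f f_t = (w f^2 / 2)_t - w_t f^2 / 2], exact for a merely continuous [f]: a
    shift by [h] turns [w(t) f(t) f(t - h)] into [w(t + h) f(t + h) f(t)], so the difference falls
    on [w] alone. A one-sided quotient would leave the squared increment of [f] divided by [2 h],
    which continuity does not control. *)
Lemma DI_symm_quotient (f : R -> R -> R) : strip 0 T f ->
  DI t1 t2 r1 r2 (fun t r => w t r * f t r * (quot (-1) 1 f h t r / 2))
  = DI t1 t2 r1 r2 (fun t r => - / 2 * (quot 0 1 w h t r * (f t r * shift 1 f h t r))).
Proof.
intros Sf.
assert (L1 : 0 + h < t1 < t2) by lra.
assert (L2 : t2 < T - h) by lra.
assert (Sf' : strip (0 + h) (T - h) f) by (apply (strip_sub 0 T); trivial; lra).
assert (Sw' : strip (0 + h) (T - h) w) by (apply (strip_sub 0 T); trivial; lra).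
assert (S1 := strip_shift 0 T 1 h f Sf ltac:(sgn) Hh).
assert (S2 := strip_shift 0 T (-1) h f Sf ltac:(sgn) Hh).
assert (S3 := strip_shift 0 T 1 h w Sw ltac:(sgn) Hh).
set (P := fun t r => w t r * f t r * shift 1 f h t r).
set (M := fun t r => w t r * f t r * shift (-1) f h t r).
set (N := fun t r => shift 1 w h t r * shift 1 f h t r * f t r).
assert (SP : strip (0 + h) (T - h) P) by (intros t r Hx Hy; unfold P; c2d; auto).
assert (SN : strip (0 + h) (T - h) N) by (intros t r Hx Hy; unfold N; c2d; auto).
assert (SM : strip (0 + h) (T - h) M) by (intros t r Hx Hy; unfold M; c2d; auto).
assert (SM' : strip (0 + h) T M).
{ intros t r Hx Hy; unfold M; apply continuity_2d_pt_mult; [ c2d | ].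
  unfold shift; apply (continuity_2d_pt_comp2 f (fun t _ => t + -1 * h) (fun _ r => r)); c2d. }
assert (E : DI t1 t2 r1 r2 M = DI t1 t2 r1 r2 N).
{ rewrite <- (DI_shift (0 + h) T t1 t2 r1 r2 ltac:(lra) ltac:(lra) Hr M a1 a2 h); trivial; try lra.
  - apply DI_ext; try lra; intros t r _ _; unfold M, N, shift; rewrite !Rmult_1_l.
    replace (t + h + -1 * h) with t by ring; ring.
  - intros t r Hr' Ht'; unfold M; rewrite Zw; trivial; ring. }
rewrite (DI_ext t1 t2 r1 r2 _ (fun t r => / (2 * h) * (P t r - M t r)));
  try lra.
2:{ intros t r _ _; unfold P, M, quot, shift; field; lra. }
rewrite (DI_ext t1 t2 r1 r2 (fun t r => - / 2 * _) (fun t r => / (2 * h) * (P t r - N t r)));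
  try lra.
2:{ intros t r _ _; unfold P, N, quot, shift; rewrite Rmult_0_l, Rplus_0_r; field; lra. }
rewrite !(DI_scal (0 + h) (T - h) t1 t2 r1 r2); trivial;
  try (intros t r Hx Hy; c2d; auto).
rewrite !(DI_minus (0 + h) (T - h) t1 t2 r1 r2); trivial.
rewrite E; reflexivity.
Qed.

Lemma DI_quotient (f : R -> R -> R) : strip 0 T f ->
  DI t1 t2 r1 r2 (fun t r => quot 0 1 f h t r * w t r)
  = DI t1 t2 r1 r2 (fun t r => - (f t r * quot (-1) 0 w h t r)).
Proof.
intros Sf.
assert (L1 : 0 + h < t1 < t2) by lra.
assert (L2 : t2 < T - h) by lra.
assert (Sf' : strip (0 + h) (T - h) f) by (apply (strip_sub 0 T); trivial; lra).
assert (Sw' : strip (0 + h) (T - h) w) by (apply (strip_sub 0 T); trivial; lra).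
assert (S1 := strip_shift 0 T 1 h f Sf ltac:(sgn) Hh).
assert (S2 := strip_shift 0 T (-1) h w Sw ltac:(sgn) Hh).
set (P := fun t r => shift 1 f h t r * w t r).
set (M := fun t r => f t r * shift (-1) w h t r).
set (N := fun t r => f t r * w t r).
assert (SP : strip (0 + h) (T - h) P) by (intros t r Hx Hy; unfold P; c2d; auto).
assert (SN : strip (0 + h) (T - h) N) by (intros t r Hx Hy; unfold N; c2d; auto).
assert (SM : strip (0 + h) (T - h) M) by (intros t r Hx Hy; unfold M; c2d; auto).
assert (SM' : strip (0 + h) T M).
{ intros t r Hx Hy; unfold M; apply continuity_2d_pt_mult; [ c2d | ].
  unfold shift; apply (continuity_2d_pt_comp2 w (fun t _ => t + -1 * h) (fun _ r => r)); c2d. }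
assert (E : DI t1 t2 r1 r2 P = DI t1 t2 r1 r2 M).
(* [M] carries [w] delayed by [h], so its time window is [[a1 + h, a2 + h]]; this is the origin of
   the [2 * h] in [Ht2]. *)
{ rewrite <- (DI_shift (0 + h) T t1 t2 r1 r2 ltac:(lra) ltac:(lra) Hr M (a1 + h) (a2 + h) h); trivial; try lra.
  - apply DI_ext; try lra; intros t r _ _; unfold M, P, shift; rewrite !Rmult_1_l.
    replace (t + h + -1 * h) with t by ring; ring.
  - intros t r Hr' Ht'; unfold M, shift; rewrite Zw by lra; ring. }
rewrite (DI_ext t1 t2 r1 r2 _ (fun t r => / h * (P t r - N t r))); try lra.
2:{ intros t r _ _; unfold P, N, quot, shift; rewrite Rmult_0_l, Rplus_0_r; field; lra. }
rewrite (DI_ext t1 t2 r1 r2 (fun t r => - _) (fun t r => / h * (M t r - N t r))); try lra.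
2:{ intros t r _ _; unfold M, N, quot, shift; rewrite Rmult_0_l, Rplus_0_r; field; lra. }
rewrite !(DI_scal (0 + h) (T - h) t1 t2 r1 r2); trivial;
  try (intros t r Hx Hy; c2d; auto).
rewrite !(DI_minus (0 + h) (T - h) t1 t2 r1 r2); trivial.
rewrite E; reflexivity.
Qed.
End Shifts.

(** * Weak identities *)

(** Kept as one unknown because the energy density is [u_t^2 + v^2] and the Riemann invariants are
    [u_t + v] and [u_t - v]. *)
Definition vr (c : R -> R) (u ur : R -> R -> R) (t r : R) : R := c (u t r) * ur t r.

Section Identities.
Context (d : nat) (c : R -> R) (T : R) (u ut ur : R -> R -> R).
Context (Hc : Cn 1 c) (Hs : solution d c T u ut ur).

Lemma Cn1_derive z : is_derive c z (Derive c z).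
Proof using Hc. apply Derive_correct, (proj1 (Hc z) 1%nat); auto. Qed.

Lemma strip_u : strip 0 T u.
Proof using Hs. intros t r Ht Hr; apply (C1_dom_interior T); trivial; apply (C1_cont _ _ _ _ (proj1 Hs)). Qed.

Lemma strip_ut : strip 0 T ut.
Proof using Hs. intros t r Ht Hr; apply (C1_dom_interior T); trivial; apply (C1_cont_t _ _ _ _ (proj1 Hs)). Qed.

Lemma strip_ur : strip 0 T ur.
Proof using Hs. intros t r Ht Hr; apply (C1_dom_interior T); trivial; apply (C1_cont_r _ _ _ _ (proj1 Hs)). Qed.

Lemma C1_u t r : 0 < t < T -> 0 < r -> C1_at u ut ur t r.
Proof using Hs.
intros Ht Hr; split; [ repeat split | split ].
- apply strip_u; trivial.
- apply strip_ut; trivial.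
- apply strip_ur; trivial.
- apply (C1_derive_t _ _ _ _ (proj1 Hs)); trivial.
- apply (C1_derive_r _ _ _ _ (proj1 Hs)); trivial; lra.
Qed.

Lemma C1_cu t r : 0 < t < T -> 0 < r ->
  C1_at (fun t r => c (u t r)) (fun t r => Derive c (u t r) * ut t r)
    (fun t r => Derive c (u t r) * ur t r) t r.
Proof using Hc Hs.
intros Ht Hr; apply C1_at_comp; [ apply Cn1_derive | | apply C1_u; trivial ].
intros z; apply (proj2 (Hc z)).
Qed.

Lemma strip_cu : strip 0 T (fun t r => c (u t r)).
Proof using Hc Hs. intros t r Ht Hr; apply (C1_cu t r Ht Hr). Qed.

Lemma strip_c'u : strip 0 T (fun t r => Derive c (u t r)).
Proof using Hc Hs.
intros t r Ht Hr; apply continuity_2d_pt_comp1; [ apply (proj2 (Hc _)) | apply strip_u; trivial ].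
Qed.

Lemma strip_vr : strip 0 T (vr c u ur).
Proof using Hc Hs.
intros t r Ht Hr; apply continuity_2d_pt_mult; [ apply strip_cu | apply strip_ur ]; trivial.
Qed.

Lemma weak_form (t1 t2 r1 r2 a1 a2 b1 b2 : R) (psi psit psir : R -> R -> R) :
  0 < t1 < a1 -> a1 <= a2 < t2 -> t2 < T -> 0 < r1 < b1 -> b1 <= b2 < r2 ->
  (forall t r, t1 < t < t2 -> r1 < r < r2 -> C1_at psi psit psir t r) ->
  (forall t r, ~ (a1 <= t <= a2 /\ b1 <= r <= b2) ->
    psi t r = 0 /\ psit t r = 0 /\ psir t r = 0) ->
  DI t1 t2 r1 r2 (fun t r => ut t r * psit t r
    - vr c u ur t r * (Derive c (u t r) * ur t r * psi t r + c (u t r) * psir t r)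
    + 2 * alpha d * (c (u t r) * vr c u ur t r * (psi t r / r))) = 0.
Proof using Hc Hs.
intros Ht1 Ht2 HT Hr1 Hr2 HC HZ.
rewrite <- (proj2 Hs t1 t2 r1 r2 psi psit psir); try lra.
2:{ apply (test_intro t1 t2 r1 r2 a1 a2 b1 b2); trivial; lra. }
apply DI_ext; try lra; intros t r Ht Hr.
assert (E : Derive (fun x => c (u t x) * psi t x) r
  = Derive c (u t r) * ur t r * psi t r + c (u t r) * psir t r).
{ apply is_derive_unique, (C1_at_mult _ _ _ _ _ _ t r (C1_cu t r ltac:(lra) ltac:(lra)) (HC t r Ht Hr)). }
rewrite E; unfold vr, alpha; field; lra.
Qed.

Context (t1 t2 r1 r2 a1 a2 b1 b2 : R) (w wt wr : R -> R -> R).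
Context (Ht1 : 0 < t1 < a1) (Ht2 : a1 <= a2 < t2) (HT : t2 < T)
  (Hr1 : 0 < r1 < b1) (Hr2 : b1 <= b2 < r2).
Context (Hw : forall t r, 0 < t < T -> 0 < r -> C1_at w wt wr t r).
Context (Zw : forall t r, ~ (a1 <= t <= a2 /\ b1 <= r <= b2) ->
    w t r = 0 /\ wt t r = 0 /\ wr t r = 0).

(** The margins are those of the enlarged window [[a1 - h, a2 + h]]: the shift lemmas want the
    weight to vanish at the ends of its window too, whereas [Zw] gives this only strictly outside
    [[a1, a2]]. *)
Lemma small_step : exists h0, 0 < h0 /\ forall h, 0 < h < h0 ->
  h < t1 /\ t1 + h < a1 - h /\ a2 + h + 2 * h < t2 /\ t2 + h < T.
Proof using Ht1 Ht2 HT.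
exists (Rmin (Rmin t1 ((a1 - t1) / 2)) (Rmin ((t2 - a2) / 3) (T - t2))).
split; [ repeat apply Rmin_case; lra | ]; intros h [Hh Hh'].
assert (M1 := Rmin_l (Rmin t1 ((a1 - t1) / 2)) (Rmin ((t2 - a2) / 3) (T - t2))).
assert (M2 := Rmin_r (Rmin t1 ((a1 - t1) / 2)) (Rmin ((t2 - a2) / 3) (T - t2))).
assert (M3 := Rmin_l t1 ((a1 - t1) / 2)); assert (M4 := Rmin_r t1 ((a1 - t1) / 2)).
assert (M5 := Rmin_l ((t2 - a2) / 3) (T - t2)); assert (M6 := Rmin_r ((t2 - a2) / 3) (T - t2)).
lra.
Qed.

Lemma strip_w : strip 0 T w.
Proof using Hw. intros t r Ht Hr; apply (Hw t r Ht Hr). Qed.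
Lemma strip_wt : strip 0 T wt.
Proof using Hw. intros t r Ht Hr; apply (Hw t r Ht Hr). Qed.
Lemma strip_wr : strip 0 T wr.
Proof using Hw. intros t r Ht Hr; apply (Hw t r Ht Hr). Qed.

Lemma strip_inv : strip 0 T (fun _ r => / r).
Proof using. intros t r Ht Hr; apply continuity_2d_pt_inv; [ c2d | lra ]. Qed.

Lemma C1_Dh h t r : 0 < h -> h < t < T - h -> 0 < r ->
  C1_at (fun t r => quot (-1) 1 u h t r / 2) (fun t r => quot (-1) 1 ut h t r / 2)
    (fun t r => quot (-1) 1 ur h t r / 2) t r.
Proof using Hs.
intros Hh Ht Hr.
assert (S : forall f, strip 0 T f -> continuity_2d_pt (fun t r => quot (-1) 1 f h t r / 2) t r).
{ intros f Sf; apply continuity_2d_pt_div; [ | c2d | lra ].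
  apply (strip_quot 0 T (-1) 1 h f Sf ltac:(sgn) ltac:(sgn) Hh); trivial; lra. }
split; [ repeat split; apply S; [ apply strip_u | apply strip_ut | apply strip_ur ] | ].
assert (B1 : 0 < t + 1 * h < T) by lra.
assert (B2 : 0 < t + -1 * h < T) by lra.
assert (D1 := proj2 (C1_u _ r B1 Hr)); assert (D2 := proj2 (C1_u _ r B2 Hr)).
unfold quot; split.
- assert (E : forall sg, is_derive (fun s => s + sg * h) t 1)
    by (intros; auto_derive; trivial; ring).
  assert (E1 := is_derive_comp_R (fun s => u s r) (fun s => s + 1 * h) t _ _ (proj1 D1) (E 1)).
  assert (E2 := is_derive_comp_R (fun s => u s r) (fun s => s + -1 * h) t _ _ (proj1 D2) (E (-1))).
  assert (E3 := is_derive_minus _ _ t _ _ E1 E2).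
  assert (E4 := is_derive_scal _ t (/ (2 * h)) _ E3).
  replace ((ut (t + 1 * h) r - ut (t + -1 * h) r) / h / 2) with
    (/ (2 * h) * (ut (t + 1 * h) r * 1 - ut (t + -1 * h) r * 1)) by (field; lra).
  apply (is_derive_ext (fun x : R => / (2 * h) * (u (x + 1 * h) r - u (x + -1 * h) r))).
  { intros x; eqR; field; lra. }
  exact E4.
- assert (E3 := is_derive_minus _ _ r _ _ (proj2 D1) (proj2 D2)).
  assert (E4 := is_derive_scal _ r (/ (2 * h)) _ E3).
  replace ((ur (t + 1 * h) r - ur (t + -1 * h) r) / h / 2) with
    (/ (2 * h) * (ur (t + 1 * h) r - ur (t + -1 * h) r)) by (field; lra).
  apply (is_derive_ext (fun x : R => / (2 * h) * (u (t + 1 * h) x - u (t + -1 * h) x))).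
  { intros x; eqR; field; lra. }
  exact E4.
Qed.

Lemma unif_symm (f ft : R -> R -> R) : strip 0 T f -> strip 0 T ft ->
  (forall t r, 0 < t < T -> 0 < r -> is_derive (fun s => f s r) t (ft t r)) ->
  unif t1 t2 r1 r2 (fun h t r => / 2 * (quot 0 1 f h t r + quot (-1) 0 f h t r)) ft.
Proof using Ht1 Ht2 HT Hr1 Hr2.
intros Sf Sft Df.
assert (U1 := unif_quotient 0 T t1 t2 r1 r2 ltac:(lra) HT ltac:(lra) f ft 0 1 Sft Df
  ltac:(lra) ltac:(lra) ltac:(lra)).
assert (U2 := unif_quotient 0 T t1 t2 r1 r2 ltac:(lra) HT ltac:(lra) f ft (-1) 0 Sft Df
  ltac:(lra) ltac:(lra) ltac:(lra)).
assert (U := unif_mult 0 T t1 t2 r1 r2 ltac:(lra) HT ltac:(lra) (fun _ _ _ => / 2) (fun _ _ => / 2)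
  _ _ ltac:(intros t r _ _; apply continuity_2d_pt_const)
  (fun t r Ht Hr => continuity_2d_pt_plus _ _ t r (Sft t r Ht Hr) (Sft t r Ht Hr))
  (unif_const t1 t2 r1 r2 (fun _ _ => / 2))
  (unif_plus t1 t2 r1 r2 _ _ _ _ U1 U2)).
intros e He; destruct (U e He) as [dl [D1 D2]]; exists dl; split; trivial.
intros h t r Hh Ht Hr; specialize (D2 h t r Hh Ht Hr).
replace (ft t r) with (/ 2 * (ft t r + ft t r)) by field; exact D2.
Qed.

Lemma unif_eq F (f g : R -> R -> R) :
  unif t1 t2 r1 r2 F f -> (forall t r, t1 <= t <= t2 -> r1 <= r <= r2 -> f t r = g t r) ->
  unif t1 t2 r1 r2 F g.
Proof using.
intros H E e He; destruct (H e He) as [dl [D1 D2]]; exists dl; split; trivial.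
intros h t r Hh Ht Hr; rewrite <- E; auto.
Qed.

(** Weak equality of the mixed derivatives of [u]. With [u_t] replaced by a forward quotient and
    [g_t] by a backward one, the identity is exact for each small [h]: after summation by parts in
    time the integrand is the [r]-derivative of [quot 0 1 u h * g], and [g] vanishes at [r1] and
    [r2]. Then [h] tends to 0. *)
Lemma sym_identity (g gt gr : R -> R -> R) :
  (forall t r, 0 < t < T -> 0 < r -> C1_at g gt gr t r) ->
  (forall t r, 0 < r -> ~ (a1 <= t <= a2 /\ b1 <= r <= b2) -> g t r = 0) ->
  DI t1 t2 r1 r2 (fun t r => ut t r * gr t r - ur t r * gt t r) = 0.
Proof using Hs Ht1 Ht2 HT Hr1 Hr2.
intros Hg Zg.
assert (Sg : strip 0 T g) by (intros t r Ht Hr; apply (Hg t r Ht Hr)).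
assert (Sgt : strip 0 T gt) by (intros t r Ht Hr; apply (Hg t r Ht Hr)).
assert (Sgr : strip 0 T gr) by (intros t r Ht Hr; apply (Hg t r Ht Hr)).
assert (Su := strip_u); assert (Sut := strip_ut); assert (Sur := strip_ur).
destruct small_step as [h0 [Hh0 Hst]].
assert (L1 : 0 < t1 < t2) by lra; assert (Lr : 0 < r1 < r2) by lra.
apply (DI_unif_zero 0 T t1 t2 r1 r2 L1 HT Lr
  (fun h t r => quot 0 1 u h t r * gr t r + - (1) * (ur t r * quot (-1) 0 g h t r))
  _ (t1 / 2) ((t2 + T) / 2) (Rmin h0 (Rmin (t1 / 2) ((T - t2) / 2)))); try lra.
- intros t r Ht Hr; c2d; auto.
- apply (unif_eq _ (fun t r => ut t r * gr t r + - (1) * (ur t r * gt t r))); [ | intros; ring ].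
  apply unif_plus; [ | apply (unif_mult 0 T); try lra ].
  + apply (unif_mult 0 T); trivial; [ | apply unif_const ].
    apply (unif_quotient 0 T); try lra; trivial.
    intros; apply C1_u; trivial.
  + intros t r _ _; apply continuity_2d_pt_const.
  + intros t r Ht Hr; c2d; auto.
  + apply unif_const.
  + apply (unif_mult 0 T); trivial; [ apply unif_const | ].
    apply (unif_quotient 0 T); try lra; trivial.
    intros; apply Hg; trivial.
- repeat apply Rmin_case; lra.
- intros h [Hh Hh'] t r Ht Hr.
  generalize (Rmin_l h0 (Rmin (t1 / 2) ((T - t2) / 2))) (Rmin_r h0 (Rmin (t1 / 2) ((T - t2) / 2)))
    (Rmin_l (t1 / 2) ((T - t2) / 2)) (Rmin_r (t1 / 2) ((T - t2) / 2)); intros.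
  assert (Ht' : 0 + h < t < T - h) by lra.
  assert (K1 := strip_quot 0 T 0 1 h u Su ltac:(sgn) ltac:(sgn) Hh t r Ht' Hr).
  assert (K2 := strip_quot 0 T (-1) 0 h g Sg ltac:(sgn) ltac:(sgn) Hh t r Ht' Hr).
  assert (0 < t < T) by lra.
  c2d; auto.
- intros h [Hh Hh'].
  assert (Hm := Rlt_le_trans _ _ _ Hh' (Rmin_l _ _)).
  destruct (Hst h (conj Hh Hm)) as [M1 [M2 [M3 M4]]].
  assert (L2 : 0 + h < t1 < t2) by lra; assert (L3 : t2 < T - h) by lra.
  assert (K1 := strip_quot 0 T 0 1 h u Su ltac:(sgn) ltac:(sgn) Hh).
  assert (K2 := strip_quot 0 T (-1) 0 h g Sg ltac:(sgn) ltac:(sgn) Hh).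
  assert (K3 := strip_quot 0 T 0 1 h ur Sur ltac:(sgn) ltac:(sgn) Hh).
  assert (Sh : forall f, strip 0 T f -> strip (0 + h) (T - h) f)
    by (intros f Sf; apply (strip_sub 0 T); trivial; lra).
  assert (Sg' := Sh _ Sg); assert (Sgr' := Sh _ Sgr); assert (Sur' := Sh _ Sur).
  assert (P1 : strip (0 + h) (T - h) (fun t r => quot 0 1 u h t r * gr t r))
    by (intros t r Ht Hr; c2d; auto).
  assert (P2 : strip (0 + h) (T - h) (fun t r => quot 0 1 ur h t r * g t r))
    by (intros t r Ht Hr; c2d; auto).
  assert (P3 : strip (0 + h) (T - h) (fun t r => ur t r * quot (-1) 0 g h t r))
    by (intros t r Ht Hr; c2d; auto).
  rewrite (DI_plus (0 + h) (T - h)); trivial.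
  2:{ intros t r Ht Hr; c2d; auto. }
  rewrite (DI_scal (0 + h) (T - h)); trivial.
  assert (E1 : DI t1 t2 r1 r2 (fun t r => quot 0 1 ur h t r * g t r)
    = DI t1 t2 r1 r2 (fun t r => -1 * (ur t r * quot (-1) 0 g h t r))).
  { rewrite (DI_quotient T t1 t2 r1 r2 (a1 - h) (a2 + h) h g); trivial; try lra.
    - apply DI_ext; try lra; intros; ring.
    - intros t r Hr Ht; apply Zg; trivial; lra. }
  rewrite (DI_scal (0 + h) (T - h)) in E1 by trivial.
  assert (E2 : DI t1 t2 r1 r2 (fun t r => quot 0 1 u h t r * gr t r)
    + DI t1 t2 r1 r2 (fun t r => quot 0 1 ur h t r * g t r) = 0); [ | lra ].
  rewrite <- (DI_plus (0 + h) (T - h)) by trivial.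
  apply RInt_zero; [ lra | ]; intros t Ht.
  rewrite (RInt_FTC (fun r => quot 0 1 u h t r * g t r)).
  + rewrite (Zg t r1), (Zg t r2) by lra.
    unfold Rminus; rewrite !Rmult_0_r; apply Rplus_opp_r.
  + lra.
  + intros r Hr.
    assert (G := proj2 (proj2 (Hg t r ltac:(lra) ltac:(lra)))).
    assert (G1 := proj2 (proj2 (C1_u (t + 1 * h) r ltac:(lra) ltac:(lra)))).
    assert (G0 := proj2 (proj2 (C1_u (t + 0 * h) r ltac:(lra) ltac:(lra)))).
    rewrite Rplus_comm.
    apply (is_derive_mult_R (quot 0 1 u h t) (g t) r (quot 0 1 ur h t r) (gr t r)); trivial.
    assert (G2 := is_derive_minus _ _ r _ _ G1 G0).
    assert (G3 := is_derive_scal _ r (/ h) _ G2).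
    replace (quot 0 1 ur h t r) with (/ h * (ur (t + 1 * h) r - ur (t + 0 * h) r))
      by (unfold quot; field; lra).
    apply (is_derive_ext (fun x => / h * (u (t + 1 * h) x - u (t + 0 * h) x)));
      [ intros x; eqR; unfold quot; field; lra | exact G3 ].
  + intros r Hr; apply (continuity_2d_pt_slice (fun t r => quot 0 1 u h t r * gr t r + quot 0 1 ur h t r * g t r)).
    assert (0 < r) by lra; assert (0 + h < t < T - h) by lra; c2d; auto.
Qed.


(* Weak form of [(d/dt + c d/dr) (u_t - c u_r) = 2 alpha c^2 u_r / r - c' u_t u_r]. *)
Lemma transport_identity :
  DI t1 t2 r1 r2 (fun t r =>
    (ut t r - vr c u ur t r)
      * (wt t r + (Derive c (u t r) * ur t r * w t r + c (u t r) * wr t r))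
    - (Derive c (u t r) * ut t r * ur t r
       - 2 * alpha d * (c (u t r) * vr c u ur t r) / r) * w t r) = 0.
Proof using Hc Hs Ht1 Ht2 HT Hr1 Hr2 Hw Zw.
assert (Su := strip_u); assert (Sut := strip_ut); assert (Sur := strip_ur).
assert (Scu := strip_cu); assert (Sc'u := strip_c'u); assert (Sv := strip_vr).
assert (Sw := strip_w); assert (Swt := strip_wt); assert (Swr := strip_wr).
assert (E1 := weak_form t1 t2 r1 r2 a1 a2 b1 b2 w wt wr Ht1 Ht2 HT Hr1 Hr2
  (fun t r Ht Hr => Hw t r ltac:(lra) ltac:(lra)) Zw).
(* Taking [g = c(u) w] produces [u_t (c' u_r w + c w_r)], which joins the term
   [- v (c' u_r w + c w_r)] of the tested equation to form the common factor [u_t - v]; its other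
   part [- u_r c w_t] turns [u_t w_t] into [(u_t - v) w_t]. *)
assert (E2 := sym_identity _ _ _ (fun t r Ht Hr => C1_at_mult _ _ _ _ _ _ t r (C1_cu t r Ht Hr) (Hw t r Ht Hr))
  ltac:(intros t r _ H; cbv beta; rewrite (proj1 (Zw t r H)); ring)).
cbv beta in E1, E2.
rewrite <- (Rplus_0_l 0).
rewrite <- E1 at 1; rewrite <- E2.
rewrite <- (DI_plus 0 T); try lra.
- apply DI_ext; try lra; intros t r Ht Hr; unfold vr; field; lra.
- intros t r Ht Hr; assert (r <> 0) by lra; c2d.
- intros t r Ht Hr; c2d.
Qed.

(* The equation is tested with [w] times the symmetric difference quotient of [u] in time,
   the only C^1 substitute for the multiplier [w u_t]. *)
Lemma energy_identity :
  DI t1 t2 r1 r2 (fun t r =>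
    / 2 * (wt t r * (ut t r ^ 2 + vr c u ur t r ^ 2))
    - c (u t r) * vr c u ur t r * ut t r * (wr t r - 2 * alpha d * (w t r / r))) = 0.
Proof using Hc Hs Ht1 Ht2 HT Hr1 Hr2 Hw Zw.
assert (Su := strip_u); assert (Sut := strip_ut); assert (Sur := strip_ur).
assert (Scu := strip_cu); assert (Sc'u := strip_c'u); assert (Sv := strip_vr).
assert (Sw := strip_w); assert (Swt := strip_wt); assert (Swr := strip_wr).
assert (Si := strip_inv).
set (v := vr c u ur) in *.
set (al := alpha d).
assert (L1 : 0 < t1 < t2) by lra; assert (Lr : 0 < r1 < r2) by lra.
destruct small_step as [h0 [Hh0 Hst]].
set (cu := fun t r => c (u t r)) in *.
set (c'u := fun t r => Derive c (u t r)) in *.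
set (D := fun h t r => / 2 * (quot 0 1 u h t r + quot (-1) 0 u h t r)).
(* The commutator in the discrete product rule: the symmetric quotient of [v = c u_r] is [c] times
   that of [u_r] plus [e]. It trades the quotient of [u_r], which may have no limit, for that of
   [v], to which [DI_symm_quotient] applies. Its own limit [c' u_t u_r] cancels the term in [c' u_r]
   coming from the weak form. *)
set (e := fun h t r => / 2 * (quot 0 1 cu h t r * shift 1 ur h t r
  + quot (-1) 0 cu h t r * shift (-1) ur h t r)).
set (A := fun h t r => (wt t r * ut t r - v t r * (c'u t r * ur t r * w t r + cu t r * wr t r)
    + 2 * al * (cu t r * v t r * (w t r * / r))) * D h t r + w t r * v t r * e h t r).
set (B := fun (f : R -> R -> R) h t r => quot 0 1 w h t r * (f t r * shift 1 f h t r)).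
(* The equation tested with [w] times the symmetric quotient of [u], once the two terms with
   quotients of [u_t] and [v] have been rewritten as quotients of [w]; every quotient left is one of
   [u], [c(u)] or [w] and converges. *)
set (F := fun h t r => A h t r + (- / 2 * B ut h t r + / 2 * B v h t r)).
assert (UD : unif t1 t2 r1 r2 D ut).
{ apply unif_symm; trivial; intros; apply C1_u; trivial. }
assert (Ue : unif t1 t2 r1 r2 e (fun t r => c'u t r * ut t r * ur t r)).
{ apply (unif_eq _ (fun t r => / 2 * (c'u t r * ut t r * ur t r + c'u t r * ut t r * ur t r)));
    [ | intros; field ].
  apply (unif_mult 0 T); trivial; try (intros t r Ht Hr; c2d); [ apply unif_const | ].
  apply unif_plus; apply (unif_mult 0 T); trivial; try (intros t r Ht Hr; c2d);
    first [ apply (unif_shift 0 T); trivial; sgn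
          | apply (unif_quotient 0 T _ _ _ _ L1 HT Lr cu (fun t r => c'u t r * ut t r)); try lra;
            [ intros t r Ht Hr; c2d | intros; apply C1_cu; trivial ] ]. }
assert (UB : forall f, strip 0 T f ->
  unif t1 t2 r1 r2 (B f) (fun t r => wt t r * (f t r * f t r))).
{ intros f Sf; apply (unif_mult 0 T); trivial; try (intros t r Ht Hr; c2d).
  - apply (unif_quotient 0 T _ _ _ _ L1 HT Lr); try lra; trivial.
    intros; apply Hw; trivial.
  - apply (unif_mult 0 T); trivial; [ apply unif_const | ].
    apply (unif_shift 0 T); trivial; sgn. }
assert (SB : forall h, 0 < h -> forall f k, strip 0 T f ->
  strip (0 + h) (T - h) (fun t r => k * B f h t r)).
{ intros h Hh f k Sf t r Ht Hr; unfold B.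
  assert (K1 := strip_quot 0 T 0 1 h w Sw ltac:(sgn) ltac:(sgn) Hh).
  assert (K2 := strip_shift 0 T 1 h f Sf ltac:(sgn) Hh).
  c2d. }
assert (SA : forall h, 0 < h -> strip (0 + h) (T - h) (A h)).
{ intros h Hh t r Ht Hr; unfold A, D, e.
  assert (K1 := strip_quot 0 T 0 1 h u Su ltac:(sgn) ltac:(sgn) Hh).
  assert (K2 := strip_quot 0 T (-1) 0 h u Su ltac:(sgn) ltac:(sgn) Hh).
  assert (K3 := strip_quot 0 T 0 1 h cu Scu ltac:(sgn) ltac:(sgn) Hh).
  assert (K4 := strip_quot 0 T (-1) 0 h cu Scu ltac:(sgn) ltac:(sgn) Hh).
  assert (K5 := strip_shift 0 T 1 h ur Sur ltac:(sgn) Hh).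
  assert (K6 := strip_shift 0 T (-1) h ur Sur ltac:(sgn) Hh).
  c2d. }
apply (DI_unif_zero 0 T t1 t2 r1 r2 L1 HT Lr F _ (t1 / 2) ((t2 + T) / 2)
  (Rmin h0 (Rmin (t1 / 2) ((T - t2) / 2)))); try lra.
- intros t r Ht Hr; assert (r <> 0) by lra; c2d.
- apply (unif_eq _ (fun t r =>
    ((wt t r * ut t r - v t r * (c'u t r * ur t r * w t r + cu t r * wr t r)
      + 2 * al * (cu t r * v t r * (w t r * / r))) * ut t r
      + w t r * v t r * (c'u t r * ut t r * ur t r))
    + (- / 2 * (wt t r * (ut t r * ut t r)) + / 2 * (wt t r * (v t r * v t r))))).
  2:{ intros t r Ht Hr; unfold v, vr, cu, c'u, al; field; lra. }
  repeat first [ apply unif_plus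
    | apply (unif_mult 0 T); trivial; [ intros t r Ht Hr; c2d | intros t r Ht Hr; c2d | apply unif_const | ]
    | apply UB; assumption | exact Ue ].
  1,2: apply (unif_mult 0 T); trivial; try apply unif_const; intros t r Ht Hr; c2d.
- repeat apply Rmin_case; lra.
- intros h [Hh Hh'].
  generalize (Rmin_l h0 (Rmin (t1 / 2) ((T - t2) / 2))) (Rmin_r h0 (Rmin (t1 / 2) ((T - t2) / 2)))
    (Rmin_l (t1 / 2) ((T - t2) / 2)) (Rmin_r (t1 / 2) ((T - t2) / 2)); intros.
  apply (strip_sub (0 + h) (T - h)); [ | lra | lra ].
  exact (fun t r Ht Hr => continuity_2d_pt_plus _ _ t r (SA h Hh t r Ht Hr)
    (continuity_2d_pt_plus _ _ t r (SB h Hh ut (- / 2) Sut t r Ht Hr) (SB h Hh v (/ 2) Sv t r Ht Hr))).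
- intros h [Hh Hh'].
  assert (Hm := Rlt_le_trans _ _ _ Hh' (Rmin_l _ _)).
  destruct (Hst h (conj Hh Hm)) as [M1 [M2 [M3 M4]]].
  assert (L2 : 0 + h < t1 < t2) by lra; assert (L3 : t2 < T - h) by lra.
  assert (Zw' : forall t r, 0 < r -> t <= a1 - h \/ a2 + h <= t -> w t r = 0)
    by (intros t r Hr Ht; apply (Zw t r); lra).
  assert (E1 := weak_form t1 t2 r1 r2 a1 a2 b1 b2 _ _ _ Ht1 Ht2 HT Hr1 Hr2
    (fun t r Ht Hr => C1_at_mult _ _ _ _ _ _ t r (Hw t r ltac:(lra) ltac:(lra))
      (C1_Dh h t r Hh ltac:(lra) ltac:(lra)))
    ltac:(intros t r H; destruct (Zw t r H) as [Z1 [Z2 Z3]]; cbv beta;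
      rewrite Z1, Z2, Z3; repeat split; ring)).
  cbv beta in E1; fold v in E1.
  assert (E2 : forall f, strip 0 T f ->
    DI t1 t2 r1 r2 (fun t r => w t r * f t r * (quot (-1) 1 f h t r / 2))
      = - / 2 * DI t1 t2 r1 r2 (B f h)).
  { intros f Sf; rewrite <- (DI_scal (0 + h) (T - h)); trivial;
      [ | intros t r Ht Hr; apply (continuity_2d_pt_ext (fun t r => 1 * B f h t r));
          [ intros; ring | apply (SB h Hh f 1 Sf t r Ht Hr) ] ].
    apply (DI_symm_quotient T t1 t2 r1 r2 (a1 - h) (a2 + h)); trivial; lra. }
  assert (SB' : forall f, strip 0 T f -> strip (0 + h) (T - h) (B f h)).
  { intros f Sf t r Ht Hr; apply (continuity_2d_pt_ext (fun t r => 1 * B f h t r));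
          [ intros; ring | apply (SB h Hh f 1 Sf t r Ht Hr) ]. }
  assert (Q : forall f, strip 0 T f ->
    strip (0 + h) (T - h) (fun t r => w t r * f t r * (quot (-1) 1 f h t r / 2))).
  { intros f Sf t r Ht Hr.
    assert (K1 := strip_quot 0 T (-1) 1 h f Sf ltac:(sgn) ltac:(sgn) Hh).
    assert (2 <> 0) by lra; c2d. }
  unfold F; rewrite (DI_plus (0 + h) (T - h)); auto;
    [ | exact (fun t r Ht Hr => continuity_2d_pt_plus _ _ t r (SB h Hh ut (- / 2) Sut t r Ht Hr) (SB h Hh v (/ 2) Sv t r Ht Hr)) ].
  rewrite (DI_plus (0 + h) (T - h)); auto.
  rewrite !(DI_scal (0 + h) (T - h)); auto.
  assert (E3 := E2 ut Sut); assert (E4 := E2 v Sv).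
  replace (/ 2 * DI t1 t2 r1 r2 (B v h))
    with (- DI t1 t2 r1 r2 (fun t r => w t r * v t r * (quot (-1) 1 v h t r / 2))) by lra.
  rewrite <- E3.
  rewrite <- E1.
  transitivity (DI t1 t2 r1 r2 (A h)
    + DI t1 t2 r1 r2 (fun t r => w t r * ut t r * (quot (-1) 1 ut h t r / 2)
      - w t r * v t r * (quot (-1) 1 v h t r / 2))).
  { rewrite (DI_minus (0 + h) (T - h)); auto. }
  rewrite <- (DI_plus (0 + h) (T - h)); auto;
    [ | exact (fun t r Ht Hr => continuity_2d_pt_minus _ _ t r (Q ut Sut t r Ht Hr) (Q v Sv t r Ht Hr)) ].
  apply DI_ext; try lra; intros t r Ht Hr.
  unfold A, D, e, quot, shift, v, vr, cu, c'u, al.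
  replace (t + 0 * h) with t by ring.
  field; lra.
Qed.

End Identities.

(** * Bump functions *)

Lemma FTC_derive (f : R -> R) (lo hi a z : R) :
  (forall x, lo < x < hi -> continuous f x) -> lo < a < hi -> lo < z < hi ->
  is_derive (fun y => RInt f a y) z (f z).
Proof.
intros Hf Ha Hz; apply (is_derive_RInt f (fun y => RInt f a y) a z); [ | auto ].
apply (locally_open_interval _ lo hi z Hz); intros y Hy.
apply (RInt_correct (V := R_CompleteNormedModule)).
apply (ex_RInt_continuous (V := R_CompleteNormedModule)); intros x Hx; apply Hf.
revert Hx; unfold Rmin, Rmax; destruct Rle_dec; lra.
Qed.

Lemma FTC_derive_R (f : R -> R) (a z : R) :
  (forall x, continuous f x) -> is_derive (fun y => RInt f a y) z (f z).
Proof.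
intros Hf; apply (FTC_derive f (Rmin a z - 1) (Rmax a z + 1)); auto;
  unfold Rmin, Rmax; destruct Rle_dec; lra.
Qed.

Lemma continuous_Rmax0 (x : R) : continuous (Rmax 0) x.
Proof.
apply filterlim_locally; intros e; exists e; intros y Hy.
change (Rabs (y - x) < e) in Hy; change (Rabs (Rmax 0 y - Rmax 0 x) < e).
apply Rabs_def2 in Hy; apply Rabs_def1; unfold Rmax; repeat destruct Rle_dec; lra.
Qed.

(* [Rmax 0 y ^ 2], written as an integral so that its C^1 regularity is immediate. *)
Definition pos_sq (y : R) : R := RInt (fun s => 2 * Rmax 0 s) 0 y.

Lemma pos_sq_derive (y : R) : is_derive pos_sq y (2 * Rmax 0 y).
Proof.
apply (FTC_derive_R (fun s => 2 * Rmax 0 s)); intros x.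
apply (continuous_scal_r (K := R_AbsRing) 2 (Rmax 0)), continuous_Rmax0.
Qed.

Lemma pos_sq_neg (y : R) : y <= 0 -> pos_sq y = 0.
Proof.
intros Hy; unfold pos_sq; rewrite (RInt_ext _ (fun _ => 0)).
- rewrite RInt_const_R; apply Rmult_0_r.
- intros x; rewrite Rmin_right, Rmax_left by lra; intros Hx.
  rewrite Rmax_left by lra; apply Rmult_0_r.
Qed.

Lemma pos_sq_pos (y : R) : 0 <= y -> pos_sq y = y ^ 2.
Proof.
intros Hy; unfold pos_sq; rewrite (RInt_FTC (fun s => s ^ 2)); trivial.
- unfold Rminus; rewrite pow_ne_zero by lia; apply (eq_trans (f_equal _ Ropp_0)), Rplus_0_r.
- intros x Hx; rewrite Rmax_right by lra; auto_derive; trivial; ring.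
- intros x _; apply (continuous_scal_r (K := R_AbsRing) 2 (Rmax 0)), continuous_Rmax0.
Qed.

Lemma pos_sq_nonneg (y : R) : 0 <= pos_sq y.
Proof.
destruct (Rle_or_lt 0 y).
- rewrite pos_sq_pos by trivial; apply pow2_ge_0.
- rewrite pos_sq_neg; lra.
Qed.

Lemma derive_continuous (f : R -> R) (x l : R) : is_derive f x l -> continuous f x.
Proof. intros H; apply (ex_derive_continuous f); eexists; exact H. Qed.

(** This is [(1 - z^2)^2] on [[-1, 1]] and 0 elsewhere: a double zero at the ends suffices for C^1,
    the regularity asked of test functions. *)
Definition bump_raw (z : R) : R := pos_sq (1 - z ^ 2).
Definition bump_mass : R := RInt bump_raw (-1) 1.
Definition bump (z : R) : R := bump_raw z / bump_mass.
Definition bump' (z : R) : R := - 4 * z * Rmax 0 (1 - z ^ 2) / bump_mass.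
Definition step (z : R) : R := RInt bump (-1) z.

Lemma bump_raw_derive (z : R) : is_derive bump_raw z (- 4 * z * Rmax 0 (1 - z ^ 2)).
Proof.
replace (- 4 * z * Rmax 0 (1 - z ^ 2)) with ((2 * Rmax 0 (1 - z ^ 2)) * (- 2 * z)) by ring.
apply (is_derive_comp_R pos_sq (fun z => 1 - z ^ 2)); [ apply pos_sq_derive | ].
auto_derive; trivial; ring.
Qed.

Lemma bump_mass_pos : 0 < bump_mass.
Proof.
apply RInt_gt_0; [ lra | | ].
- intros x Hx; unfold bump_raw; rewrite pos_sq_pos by nra; apply pow_lt; nra.
- intros x Hx; apply (derive_continuous _ _ _ (bump_raw_derive x)).
Qed.

Lemma bump_derive (z : R) : is_derive bump z (bump' z).
Proof.
assert (H := is_derive_scal bump_raw z (/ bump_mass) _ (bump_raw_derive z)).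
unfold bump'; unfold Rdiv; rewrite Rmult_comm.
apply (is_derive_ext (fun x => / bump_mass * bump_raw x)); [ | exact H ].
intros x; eqR; unfold bump; unfold Rdiv; ring.
Qed.

Lemma bump_continuous (z : R) : continuous bump z.
Proof. apply (derive_continuous _ _ _ (bump_derive z)). Qed.

Lemma bump'_continuous (z : R) : continuous bump' z.
Proof.
unfold bump', Rdiv.
apply (continuous_mult (K := R_AbsRing) (fun z => - 4 * z * Rmax 0 (1 - z ^ 2)) (fun _ => / bump_mass));
  [ | apply continuous_const ].
apply (continuous_mult (K := R_AbsRing) (fun z => - 4 * z) (fun z => Rmax 0 (1 - z ^ 2))).
- apply (derive_continuous _ _ (- 4)); auto_derive; trivial; ring.
- apply (continuous_comp (fun z => 1 - z ^ 2) (Rmax 0)); [ | apply continuous_Rmax0 ].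
  apply (derive_continuous _ _ (- 2 * z)); auto_derive; trivial; ring.
Qed.

Lemma bump_nonneg (z : R) : 0 <= bump z.
Proof.
apply Rdiv_le_0_compat; [ apply pos_sq_nonneg | apply bump_mass_pos ].
Qed.

Lemma bump_outside (z : R) : z <= -1 \/ 1 <= z -> bump z = 0 /\ bump' z = 0.
Proof.
intros H; assert (1 - z ^ 2 <= 0) by nra.
unfold bump, bump', bump_raw; rewrite pos_sq_neg, Rmax_left by lra.
unfold Rdiv; split; ring.
Qed.

Lemma bump'_sign (z : R) : z * bump' z <= 0.
Proof.
unfold bump'; assert (H := Rmax_l 0 (1 - z ^ 2)).
replace (z * (- 4 * z * Rmax 0 (1 - z ^ 2) / bump_mass))
  with (- (4 * z ^ 2 * Rmax 0 (1 - z ^ 2) * / bump_mass)) by (unfold Rdiv; ring).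
assert (P := Rlt_le _ _ (Rinv_0_lt_compat _ bump_mass_pos)).
assert (0 <= 4 * z ^ 2) by nra.
assert (0 <= 4 * z ^ 2 * Rmax 0 (1 - z ^ 2) * / bump_mass).
{ apply Rmult_le_pos; [ apply Rmult_le_pos; trivial | trivial ]. }
lra.
Qed.

Lemma step_derive (z : R) : is_derive step z (bump z).
Proof. apply FTC_derive_R, bump_continuous. Qed.

Lemma ex_RInt_bump (a b : R) : ex_RInt bump a b.
Proof.
apply (ex_RInt_continuous (V := R_CompleteNormedModule)); intros; apply bump_continuous.
Qed.

Lemma step_left (z : R) : z <= -1 -> step z = 0.
Proof.
intros H; unfold step; rewrite (RInt_ext _ (fun _ => 0)).
- rewrite RInt_const_R; apply Rmult_0_r.
- intros x; rewrite Rmin_right, Rmax_left by lra; intros Hx; apply bump_outside; lra.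
Qed.

Lemma step_right (z : R) : 1 <= z -> step z = 1.
Proof.
intros H; unfold step.
rewrite <- (RInt_Chasles bump (-1) 1 z) by apply ex_RInt_bump.
rewrite (RInt_zero bump 1 z); [ | lra | intros; apply bump_outside; lra ].
unfold plus; simpl; rewrite Rplus_0_r.
rewrite (RInt_ext_le _ (fun x => / bump_mass * bump_raw x)); [ | lra | ].
2:{ intros; unfold bump, Rdiv; apply Rmult_comm. }
rewrite RInt_scal_R.
- apply Rinv_l, Rgt_not_eq, bump_mass_pos.
- apply ex_RInt_cont; [ lra | ]; intros; apply (derive_continuous _ _ _ (bump_raw_derive x)).
Qed.

Lemma step_mono (x y : R) : x <= y -> step x <= step y.
Proof.
intros H; unfold step.
rewrite <- (RInt_Chasles bump (-1) x y) by apply ex_RInt_bump.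
assert (0 <= RInt bump x y); [ | unfold plus; simpl; lra ].
apply RInt_ge_0; trivial; [ apply ex_RInt_bump | intros; apply bump_nonneg ].
Qed.

Lemma step_bounds (z : R) : 0 <= step z <= 1.
Proof.
rewrite <- (step_left (Rmin z (-1))) by apply Rmin_r.
rewrite <- (step_right (Rmax z 1)) by apply Rmax_r.
split; apply step_mono; [ apply Rmin_l | apply Rmax_l ].
Qed.

Lemma step_scaled_derive (dl a t : R) : 0 < dl ->
  is_derive (fun t => step ((t - a) / dl)) t (bump ((t - a) / dl) / dl).
Proof.
intros Hd; apply (is_derive_comp_R step (fun t => (t - a) / dl) t _ (/ dl) (step_derive _)).
auto_derive; trivial; field; lra.
Qed.


Lemma bump_scaled_derive (dl a t : R) : 0 < dl ->
  is_derive (fun t => bump ((t - a) / dl) / dl) t (bump' ((t - a) / dl) / dl ^ 2).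
Proof.
intros Hd.
assert (E := is_derive_comp_R bump (fun t => (t - a) / dl) t _ (/ dl) (bump_derive _)
  ltac:(auto_derive; trivial; field; lra)).
assert (E' := is_derive_scal _ t (/ dl) _ E).
replace (bump' ((t - a) / dl) / dl ^ 2) with (/ dl * (bump' ((t - a) / dl) * / dl)) by (field; lra).
apply (is_derive_ext (fun t => / dl * bump ((t - a) / dl))); [ | exact E' ].
intros x; eqR; unfold Rdiv; ring.
Qed.

Lemma bump_scaled_continuous (dl a t : R) : 0 < dl ->
  continuous (fun t => bump ((t - a) / dl) / dl) t.
Proof. intros Hd; exact (derive_continuous _ _ _ (bump_scaled_derive dl a t Hd)). Qed.

Lemma bump_scaled_nonneg (dl a t : R) : 0 < dl -> 0 <= bump ((t - a) / dl) / dl.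
Proof. intros Hd; apply Rdiv_le_0_compat; [ apply bump_nonneg | trivial ]. Qed.

Lemma scaled_outside (dl a t : R) : 0 < dl -> t <= a - dl \/ a + dl <= t ->
  (t - a) / dl <= -1 \/ 1 <= (t - a) / dl.
Proof.
intros Hd H.
assert (E : (t - a) / dl * dl = t - a) by (field; lra).
destruct H as [H | H]; [ left | right ].
- apply Rmult_le_reg_r with dl; lra.
- apply Rmult_le_reg_r with dl; lra.
Qed.

Lemma step_scaled_left (dl a t : R) : 0 < dl -> t <= a - dl -> step ((t - a) / dl) = 0.
Proof.
intros Hd H; apply step_left.
assert (E : (t - a) / dl * dl = t - a) by (field; lra).
apply Rmult_le_reg_r with dl; lra.
Qed.

Lemma step_scaled_right (dl a t : R) : 0 < dl -> a + dl <= t -> step ((t - a) / dl) = 1.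
Proof.
intros Hd H; apply step_right.
assert (E : (t - a) / dl * dl = t - a) by (field; lra).
apply Rmult_le_reg_r with dl; lra.
Qed.

Lemma RInt_bump_scaled (dl a x y : R) : 0 < dl -> x <= a - dl -> a + dl <= y ->
  RInt (fun t => bump ((t - a) / dl) / dl) x y = 1.
Proof.
intros Hd Hx Hy; rewrite (RInt_FTC (fun t => step ((t - a) / dl))).
- rewrite (step_scaled_left dl a x), (step_scaled_right dl a y) by trivial; apply Rminus_0_r.
- lra.
- intros; apply step_scaled_derive; trivial.
- intros; apply bump_scaled_continuous; trivial.
Qed.

Lemma continuous_near (f : R -> R) (x e : R) : continuous f x -> 0 < e ->
  exists dl, 0 < dl /\ forall y, Rabs (y - x) < dl -> Rabs (f y - f x) < e.
Proof.
intros H He.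
apply filterlim_locally with (eps := mkposreal e He) in H.
destruct H as [dl Hdl]; exists dl; split; [ apply cond_pos | exact Hdl ].
Qed.

Lemma continuous_minus_R (f g : R -> R) (x : R) : continuous f x -> continuous g x ->
  continuous (fun x => f x - g x) x.
Proof. apply (continuous_minus (K := R_AbsRing) (V := R_NormedModule)). Qed.

Lemma continuous_plus_R (f g : R -> R) (x : R) : continuous f x -> continuous g x ->
  continuous (fun x => f x + g x) x.
Proof. apply (continuous_plus (K := R_AbsRing) (V := R_NormedModule)). Qed.

Lemma continuous_mult_R (f g : R -> R) (x : R) : continuous f x -> continuous g x ->
  continuous (fun x => f x * g x) x.
Proof. apply (continuous_mult (K := R_AbsRing)). Qed.

(* [P' <= - Q] in the sense of distributions implies the integrated inequality. *)
Lemma weak_decrease (lo hi : R) (P Q : R -> R) :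
  (forall t, lo < t < hi -> continuous P t) -> (forall t, lo < t < hi -> continuous Q t) ->
  (forall (chi chi' : R -> R) (t1 t2 a1 a2 : R),
    lo < t1 < a1 -> a1 <= a2 < t2 -> t2 < hi ->
    (forall t, is_derive chi t (chi' t)) -> (forall t, continuous chi' t) ->
    (forall t, 0 <= chi t) ->
    (forall t, ~ (a1 <= t <= a2) -> chi t = 0 /\ chi' t = 0) ->
    RInt (fun t => chi t * Q t) t1 t2 <= RInt (fun t => chi' t * P t) t1 t2) ->
  forall a b, lo < a < b -> b < hi -> P b + RInt Q a b <= P a.
Proof.
intros CP CQ H a b Hab Hb.
apply Rnot_lt_le; intros Hlt.
set (G := fun t => RInt Q a t).
assert (DG : forall t, lo < t < hi -> is_derive G t (Q t))
  by (intros; apply (FTC_derive Q lo hi); trivial; lra).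
assert (CG : forall t, lo < t < hi -> continuous G t)
  by (intros t Ht; exact (derive_continuous _ _ _ (DG t Ht))).
set (F := fun t => P t + G t).
assert (CF : forall t, lo < t < hi -> continuous F t)
  by (intros; apply continuous_plus_R; auto).
assert (Fa : F a = P a).
{ unfold F, G; rewrite RInt_point; apply Rplus_0_r. }
change (P a < F b) in Hlt; rewrite <- Fa in Hlt.
(* With [m] halfway and [e] a quarter of the gap, continuity gives [F < m - e] near [a] and
   [F > m + e] near [b]. *)
set (m := (F a + F b) / 2); set (e := (F b - F a) / 4).
assert (He : 0 < e) by (unfold e; lra).
destruct (continuous_near F a e (CF a ltac:(lra)) He) as [da [Da1 Da2]].
destruct (continuous_near F b e (CF b ltac:(lra)) He) as [db [Db1 Db2]].
set (dl := Rmin (Rmin da db) (Rmin (Rmin (a - lo) (hi - b)) (b - a)) / 3).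
assert (Hdl : 0 < dl /\ dl < da /\ dl < db /\ 2 * dl < a - lo /\ 2 * dl < hi - b /\ 2 * dl < b - a).
{ assert (0 < Rmin (Rmin da db) (Rmin (Rmin (a - lo) (hi - b)) (b - a)))
    by (repeat apply Rmin_case; lra).
  generalize (Rmin_l (Rmin da db) (Rmin (Rmin (a - lo) (hi - b)) (b - a)))
   (Rmin_r (Rmin da db) (Rmin (Rmin (a - lo) (hi - b)) (b - a)))
   (Rmin_l da db) (Rmin_r da db) (Rmin_l (Rmin (a - lo) (hi - b)) (b - a))
   (Rmin_r (Rmin (a - lo) (hi - b)) (b - a)) (Rmin_l (a - lo) (hi - b)) (Rmin_r (a - lo) (hi - b)).
  unfold dl; lra. }
destruct Hdl as [D0 [D1 [D2 [D3 [D4 D5]]]]].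
set (ba := fun t => bump ((t - a) / dl) / dl); set (bb := fun t => bump ((t - b) / dl) / dl).
(* [chi] rises near [a] and falls near [b]. Integrating by parts, the hypothesis says that [chi' F]
   has nonnegative integral, and [m] may be subtracted from [F] since [chi'] has integral 0. But
   [chi' (F - m) <= - e (ba + bb)], whose right side has integral [- 2 e]. *)
set (chi := fun t => step ((t - a) / dl) - step ((t - b) / dl)).
set (chi' := fun t => ba t - bb t).
assert (Cba : forall t, continuous ba t) by (intros; apply bump_scaled_continuous; trivial).
assert (Cbb : forall t, continuous bb t) by (intros; apply bump_scaled_continuous; trivial).
assert (Dchi : forall t, is_derive chi t (chi' t)).
{ intros t; exact (is_derive_minus _ _ t _ _ (step_scaled_derive dl a t D0) (step_scaled_derive dl b t D0)). }
assert (Cchi' : forall t, continuous chi' t)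
  by (intros t; apply continuous_minus_R; auto).
assert (Cchi : forall t, continuous chi t)
  by (intros t; exact (derive_continuous _ _ _ (Dchi t))).
assert (Zchi : forall t, ~ (a - dl <= t <= b + dl) -> chi t = 0 /\ chi' t = 0).
{ intros t Ht; unfold chi, chi', ba, bb.
  rewrite (proj1 (bump_outside _ (scaled_outside dl a t D0 ltac:(lra)))),
    (proj1 (bump_outside _ (scaled_outside dl b t D0 ltac:(lra)))).
  split; [ | unfold Rdiv; ring ].
  destruct (Rlt_or_le t (a - dl)).
  - rewrite (step_scaled_left dl a), (step_scaled_left dl b) by lra; ring.
  - rewrite (step_scaled_right dl a), (step_scaled_right dl b) by lra; ring. }
set (t1 := a - 2 * dl); set (t2 := b + 2 * dl).
assert (H1 := H chi chi' t1 t2 (a - dl) (b + dl) ltac:(unfold t1; lra) ltac:(unfold t2; lra)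
  ltac:(unfold t2; lra) Dchi Cchi').
assert (H2 : RInt (fun t => chi t * Q t) t1 t2 <= RInt (fun t => chi' t * P t) t1 t2).
{ apply H1; trivial; intros t; unfold chi.
  assert (step ((t - b) / dl) <= step ((t - a) / dl)); [ | lra ].
  apply step_mono, Rmult_le_compat_r; [ apply Rlt_le, Rinv_0_lt_compat | ]; lra. }
assert (Lt : t1 <= t2) by (unfold t1, t2; lra).
assert (In : forall t, t1 <= t <= t2 -> lo < t < hi) by (unfold t1, t2; intros; lra).
assert (I1 : RInt (fun t => chi' t * G t + chi t * Q t) t1 t2 = 0).
{ rewrite (RInt_FTC (fun t => chi t * G t)); trivial.
  - rewrite (proj1 (Zchi t1 ltac:(unfold t1; lra))), (proj1 (Zchi t2 ltac:(unfold t2; lra))).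
    apply (eq_trans (f_equal2 Rminus (Rmult_0_l _) (Rmult_0_l _))), Rminus_0_r.
  - intros x Hx; apply (is_derive_mult_R chi G); auto.
  - intros x Hx; apply continuous_plus_R; apply continuous_mult_R; auto. }
assert (I2 : RInt chi' t1 t2 = 0).
{ rewrite (RInt_FTC chi); trivial; auto.
  rewrite (proj1 (Zchi t1 ltac:(unfold t1; lra))), (proj1 (Zchi t2 ltac:(unfold t2; lra))).
  apply Rminus_0_r. }
assert (E1 : ex_RInt (fun t => chi' t * G t) t1 t2)
  by (apply ex_RInt_cont; trivial; intros; apply continuous_mult_R; auto).
assert (E2 : ex_RInt (fun t => chi t * Q t) t1 t2)
  by (apply ex_RInt_cont; trivial; intros; apply continuous_mult_R; auto).
assert (E3 : ex_RInt (fun t => chi' t * P t) t1 t2)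
  by (apply ex_RInt_cont; trivial; intros; apply continuous_mult_R; auto).
assert (E4 : ex_RInt chi' t1 t2)
  by (apply ex_RInt_cont; trivial; intros; auto).
assert (E5 : ex_RInt (fun t => m * chi' t) t1 t2)
  by (apply (ex_RInt_scal (V := R_NormedModule)); trivial).
rewrite RInt_plus_R in I1 by trivial.
assert (I3 : RInt (fun t => chi' t * P t + chi' t * G t - m * chi' t) t1 t2 >= 0).
{ rewrite RInt_minus_R, RInt_plus_R, RInt_scal_R, I2; trivial; [ lra | ].
  apply (ex_RInt_plus (V := R_NormedModule)); trivial. }
assert (I4 : RInt (fun t => chi' t * P t + chi' t * G t - m * chi' t) t1 t2
  <= RInt (fun t => - e * (ba t + bb t)) t1 t2).
{ apply RInt_le; trivial.
  - apply (ex_RInt_minus (V := R_NormedModule)); trivial.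
    apply (ex_RInt_plus (V := R_NormedModule)); trivial.
  - apply ex_RInt_cont; trivial; intros x Hx.
    apply (continuous_scal_r (K := R_AbsRing) (- e) (fun x => ba x + bb x)), continuous_plus_R; auto.
  - intros t Ht.
    replace (chi' t * P t + chi' t * G t - m * chi' t) with (chi' t * (F t - m))
      by (unfold F; ring).
    assert (Na : 0 <= ba t) by (apply bump_scaled_nonneg; trivial).
    assert (Nb : 0 <= bb t) by (apply bump_scaled_nonneg; trivial).
    assert (Za : ~ (a - dl < t < a + dl) -> ba t = 0).
    { intros Hn; unfold ba; rewrite (proj1 (bump_outside _ (scaled_outside dl a t D0 ltac:(lra)))).
      apply Rmult_0_l. }
    assert (Zb : ~ (b - dl < t < b + dl) -> bb t = 0).
    { intros Hn; unfold bb; rewrite (proj1 (bump_outside _ (scaled_outside dl b t D0 ltac:(lra)))).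
      apply Rmult_0_l. }
    unfold chi'.
    destruct (Rlt_le_dec (Rabs (t - a)) dl) as [Ha | Ha].
    + assert (K := Da2 t ltac:(lra)); apply Rabs_def2 in K; apply Rabs_def2 in Ha.
      rewrite Zb by lra; unfold m, e in *; nra.
    + assert (Za' : ba t = 0).
      { apply Za; intros Hn; apply (Rle_not_lt _ _ Ha); apply Rabs_def1; lra. }
      rewrite Za'; destruct (Rlt_le_dec (Rabs (t - b)) dl) as [Hb' | Hb'].
      * assert (K := Db2 t ltac:(lra)); apply Rabs_def2 in K.
        unfold m, e in *; nra.
      * assert (Zb' : bb t = 0).
        { apply Zb; intros Hn; apply (Rle_not_lt _ _ Hb'); apply Rabs_def1; lra. }
        rewrite Zb'; lra. }
rewrite RInt_scal_R, RInt_plus_R in I4.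
- unfold ba, bb in I4.
  rewrite !RInt_bump_scaled in I4 by (unfold t1, t2; lra); lra.
- apply ex_RInt_cont; trivial; auto.
- apply ex_RInt_cont; trivial; auto.
- apply ex_RInt_cont; trivial; intros; apply continuous_plus_R; auto.
Qed.

(** * Characteristic curves *)

(** Test functions live in [t > 0], so the inequality first holds from times [a > 0]; continuity of
    [P] and of the primitive of [Q] across 0 carries it to [a = 0]. *)
Lemma weak_decrease_at_0 (hi : R) (P Q : R -> R) :
  (forall t, -1 < t < hi -> continuous P t) -> (forall t, -1 < t < hi -> continuous Q t) ->
  (forall (chi chi' : R -> R) (t1 t2 a1 a2 : R),
    0 < t1 < a1 -> a1 <= a2 < t2 -> t2 < hi ->
    (forall t, is_derive chi t (chi' t)) -> (forall t, continuous chi' t) ->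
    (forall t, 0 <= chi t) ->
    (forall t, ~ (a1 <= t <= a2) -> chi t = 0 /\ chi' t = 0) ->
    RInt (fun t => chi t * Q t) t1 t2 <= RInt (fun t => chi' t * P t) t1 t2) ->
  forall b, 0 < b < hi -> P b + RInt Q 0 b <= P 0.
Proof.
intros CP CQ H b Hb.
assert (HW := weak_decrease 0 hi P Q (fun t Ht => CP t ltac:(lra)) (fun t Ht => CQ t ltac:(lra)) H).
assert (EQ : forall x y, -1 < x -> x <= y -> y < hi -> ex_RInt Q x y)
  by (intros; apply ex_RInt_cont; trivial; intros; apply CQ; lra).
set (F := fun a => P a + RInt Q 0 a).
assert (CF : continuous F 0).
{ apply continuous_plus_R; [ apply CP; lra | ].
  apply (derive_continuous _ _ (Q 0)), (FTC_derive Q (-1) hi); trivial; lra. }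
apply Rnot_lt_le; intros Hlt.
assert (F0 : F 0 = P 0) by (unfold F; rewrite RInt_point; apply Rplus_0_r).
destruct (continuous_near F 0 (F b - F 0) CF ltac:(unfold F at 1; lra)) as [dl [D1 D2]].
set (a := Rmin dl b / 2).
assert (Ha : 0 < a /\ a < b /\ a < dl).
{ assert (0 < Rmin dl b) by (apply Rmin_case; lra).
  generalize (Rmin_l dl b) (Rmin_r dl b); unfold a; lra. }
assert (K := D2 a ltac:(rewrite Rminus_0_r, Rabs_pos_eq; lra)); apply Rabs_def2 in K.
assert (K' := HW a b ltac:(lra) ltac:(lra)).
assert (K2 := RInt_Chasles Q 0 a b (EQ 0 a ltac:(lra) ltac:(lra) ltac:(lra)) (EQ a b ltac:(lra) ltac:(lra) ltac:(lra))).
unfold plus in K2; simpl in K2.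
unfold F in K; lra.
Qed.

(* Extended constantly to [t < 0], the solution and its derivatives are continuous near [t = 0],
   so the initial time needs no one-sided limits. *)
Definition clamp (F : R -> R -> R) (t r : R) : R := F (Rmax 0 t) r.

Lemma continuous_on_clamp (T : R) (F : R -> R -> R) : 0 < T ->
  continuous_on (dom T) (fun p : R * R => F (fst p) (snd p)) -> strip (-1) T (clamp F).
Proof.
intros HT H t r Ht Hr.
assert (HD : dom T (Rmax 0 t, r)).
{ unfold dom; simpl; split; [ split; [ apply Rmax_l | apply Rmax_case; lra ] | trivial ]. }
intros e.
assert (He := H _ HD (ball (F (Rmax 0 t) r) e) (locally_ball _ _)).
destruct He as [dl Hdl].
destruct (continuous_near (Rmax 0) t dl (continuous_Rmax0 t) (cond_pos dl)) as [d1 [Hd1 Hd2]].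
assert (Hm : 0 < Rmin (Rmin d1 dl) (Rmin (T - t) r))
  by (repeat apply Rmin_case; try lra; apply cond_pos).
exists (mkposreal _ Hm); simpl; intros s x Hs Hx.
generalize (Rmin_l (Rmin d1 dl) (Rmin (T - t) r)) (Rmin_r (Rmin d1 dl) (Rmin (T - t) r))
  (Rmin_l d1 dl) (Rmin_r d1 dl) (Rmin_l (T - t) r) (Rmin_r (T - t) r); intros.
assert (Hs' := Hs); assert (Hx' := Hx); apply Rabs_def2 in Hs'; apply Rabs_def2 in Hx'.
apply (Hdl (Rmax 0 s, x)).
- split; [ apply (Hd2 s); lra | change (Rabs (x - r) < dl); lra ].
- unfold dom; simpl; split; [ split; [ apply Rmax_l | apply Rmax_case; lra ] | lra ].
Qed.

Lemma continuous_on_clamp1 (T : R) (f : R -> R) (t : R) : 0 < T ->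
  continuous_on (fun t => 0 <= t < T) f -> t < T -> continuous (fun t => f (Rmax 0 t)) t.
Proof.
intros HT H Ht.
assert (HD : 0 <= Rmax 0 t < T) by (split; [ apply Rmax_l | apply Rmax_case; lra ]).
apply filterlim_locally; intros e.
destruct (H _ HD (ball (f (Rmax 0 t)) e) (locally_ball _ _)) as [dl Hdl].
destruct (continuous_near (Rmax 0) t dl (continuous_Rmax0 t) (cond_pos dl)) as [d1 [Hd1 Hd2]].
assert (Hm : 0 < Rmin d1 (T - t)) by (apply Rmin_case; lra).
exists (mkposreal _ Hm); intros s Hs; change (Rabs (s - t) < Rmin d1 (T - t)) in Hs.
generalize (Rmin_l d1 (T - t)) (Rmin_r d1 (T - t)); intros.
assert (Hs' := Hs); apply Rabs_def2 in Hs'.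
apply Hdl; [ apply (Hd2 s); lra | ].
split; [ apply Rmax_l | apply Rmax_case; lra ].
Qed.

Lemma clamp_pos (F : R -> R -> R) (t r : R) : 0 <= t -> clamp F t r = F t r.
Proof. intros H; unfold clamp; rewrite Rmax_right; trivial. Qed.

Lemma tube_near (lo hi a b x y m e : R) (F : R -> R -> R) (g : R -> R) :
  strip lo hi F -> lo < a -> a <= b -> b < hi -> 0 < x -> 0 < m -> 0 < e ->
  (forall t, a <= t <= b -> x + m <= g t <= y - m) ->
  exists dl, 0 < dl /\ dl <= m /\ forall t r, a <= t <= b -> Rabs (r - g t) <= dl ->
    Rabs (F t r - F t (g t)) <= e.
Proof.
intros HF Ha Hab Hb Hx Hm He Hg.
destruct (uniform_continuity_2d F a b x y) with (eps := mkposreal e He) as [dl Hdl].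
{ intros t r Ht Hr; apply HF; lra. }
simpl in Hdl; assert (Hd := cond_pos dl).
exists (Rmin m (dl / 2)); split; [ apply Rmin_case; lra | split; [ apply Rmin_l | ] ].
intros t r Ht Hr; assert (Hg' := Hg t Ht).
generalize (Rmin_l m (dl / 2)) (Rmin_r m (dl / 2)); intros.
assert (Hr' := Hr); apply Rabs_le_between in Hr'.
apply Rlt_le, Hdl; try lra.
rewrite Rminus_diag, Rabs_R0; lra.
Qed.

Lemma continuous_subst (F : R -> R -> R) (g : R -> R) (lo hi t : R) :
  strip lo hi F -> lo < t < hi -> 0 < g t -> continuous g t ->
  continuous (fun t => F t (g t)) t.
Proof.
intros HF Ht Hg Cg; apply (continuous_slice2 F (fun t => t) g); trivial; [ | apply continuous_id ].
apply HF; trivial.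
Qed.

Lemma DI_nonneg (lo hi t1 t2 r1 r2 : R) (F : R -> R -> R) :
  lo < t1 < t2 -> t2 < hi -> 0 < r1 < r2 -> strip lo hi F ->
  (forall t r, t1 < t < t2 -> r1 < r < r2 -> 0 <= F t r) -> 0 <= DI t1 t2 r1 r2 F.
Proof.
intros H1 H2 H3 HF H; apply RInt_ge_0; [ lra | | ].
- apply (ex_outer lo hi); trivial.
- intros t Ht; apply RInt_ge_0; [ lra | | auto ].
  apply (ex_inner lo hi); trivial; lra.
Qed.

Lemma DI_factor (lo hi t1 t2 r1 r2 : R) (k : R -> R) (F : R -> R -> R) :
  lo < t1 < t2 -> t2 < hi -> 0 < r1 < r2 -> strip lo hi F ->
  RInt (fun t => k t * RInt (fun r => F t r) r1 r2) t1 t2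
  = DI t1 t2 r1 r2 (fun t r => k t * F t r).
Proof.
intros H1 H2 H3 HF; apply RInt_ext_le; [ lra | ]; intros t Ht; symmetry.
apply RInt_scal_R, (ex_inner lo hi); trivial; lra.
Qed.

Section Curve.
Context (c : R -> R) (c0 c1 r0 T : R) (u : R -> R -> R) (rhat : R -> R).
Context (Hc0 : 0 < c0) (Hcb : forall x : R, c0 <= c x <= c1) (Hr0 : 0 < r0)
  (HT : 0 < T) (Hchar : characteristic c r0 T u rhat).

Definition curve (t : R) : R := rhat (Rmax 0 t).

Lemma curve_pos t : 0 <= t -> curve t = rhat t.
Proof. intros H; unfold curve; rewrite Rmax_right; trivial. Qed.

Lemma curve_continuous t : t < T -> continuous curve t.
Proof using HT Hchar. intros Ht; apply (continuous_on_clamp1 T); trivial; apply Hchar. Qed.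

Lemma curve_derive t : 0 < t < T -> is_derive curve t (c (u t (curve t))).
Proof using Hchar.
intros Ht; rewrite curve_pos by lra.
apply (is_derive_ext_interval rhat _ 0 T); trivial.
- intros s Hs; symmetry; apply curve_pos; lra.
- apply Hchar; trivial.
Qed.

Lemma curve_bounds t : t < T -> r0 <= curve t <= r0 + c1 * Rmax 0 t.
Proof using Hc0 Hcb Hr0 HT Hchar.
intros Ht; destruct (Rle_or_lt t 0) as [H | H].
- unfold curve; rewrite Rmax_left by trivial; rewrite (proj1 Hchar); lra.
- rewrite Rmax_right by lra.
  assert (E0 : curve 0 = r0) by (rewrite curve_pos by lra; apply (proj1 Hchar)).
  destruct (MVT_gen curve 0 t (fun s => c (u s (curve s)))) as [z [Hz1 Hz2]].
  + rewrite Rmin_left, Rmax_right by lra; intros; apply curve_derive; lra.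
  + rewrite Rmin_left, Rmax_right by lra; intros.
    apply continuity_pt_filterlim, curve_continuous; lra.
  + rewrite E0 in Hz2; generalize (Hcb (u z (curve z))); nra.
Qed.

End Curve.

(** * The equation for S along a characteristic *)

Lemma C1_at_fst (f f' : R -> R) (t r : R) :
  is_derive f t (f' t) -> continuous f' t ->
  C1_at (fun t _ => f t) (fun t _ => f' t) (fun _ _ => 0) t r.
Proof.
intros H H'; split; [ repeat split | split; trivial ].
- apply continuity_2d_pt_fst; exact (derive_continuous _ _ _ H).
- apply continuity_2d_pt_fst; trivial.
- apply continuity_2d_pt_const.
- apply (is_derive_const (K := R_AbsRing) (V := R_NormedModule)).
Qed.

Lemma C1_at_snd (f f' : R -> R) (t r : R) :
  is_derive f r (f' r) -> continuous f' r ->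
  C1_at (fun _ r => f r) (fun _ _ => 0) (fun _ r => f' r) t r.
Proof.
intros H H'; split; [ repeat split | split; trivial ].
- apply continuity_2d_pt_snd; exact (derive_continuous _ _ _ H).
- apply continuity_2d_pt_const.
- apply continuity_2d_pt_snd; trivial.
- apply (is_derive_const (K := R_AbsRing) (V := R_NormedModule)).
Qed.

Lemma C1_at_sub (f ft fr g gt gr : R -> R -> R) (t r : R) :
  C1_at f ft fr t r -> C1_at g gt gr t r ->
  C1_at (fun t r => f t r - g t r) (fun t r => ft t r - gt t r)
    (fun t r => fr t r - gr t r) t r.
Proof.
intros [[F1 [F2 F3]] [F4 F5]] [[G1 [G2 G3]] [G4 G5]].
split; [ repeat split; c2d | split ].
- exact (is_derive_minus _ _ t _ _ F4 G4).
- exact (is_derive_minus _ _ r _ _ F5 G5).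
Qed.

Lemma RInt_abs_le (f g : R -> R) (a b : R) : a <= b -> ex_RInt f a b -> ex_RInt g a b ->
  (forall x, a < x < b -> Rabs (f x) <= g x) -> Rabs (RInt f a b) <= RInt g a b.
Proof.
intros Hab Ef Eg H; apply Rabs_le_between; split.
- assert (E := RInt_opp (V := R_CompleteNormedModule) g a b Eg).
  change (RInt (fun x => - g x) a b = - RInt g a b) in E; rewrite <- E.
  apply RInt_le; trivial; [ apply (ex_RInt_opp (V := R_NormedModule)); trivial | ].
  intros x Hx; generalize (proj1 (Rabs_le_between _ _) (H x Hx)); lra.
- apply RInt_le; trivial.
  intros x Hx; generalize (proj1 (Rabs_le_between _ _) (H x Hx)); lra.
Qed.

(** * Mollifying kernels of width [dl] and their moments *)

Definition kern (dl y : R) : R := bump (y / dl) / dl.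
Definition kern' (dl y : R) : R := bump' (y / dl) / dl ^ 2.

Section Kernel.
Context (dl : R) (Hdl : 0 < dl).

Lemma kern_derive y : is_derive (kern dl) y (kern' dl y).
Proof using Hdl.
assert (H := bump_scaled_derive dl 0 y Hdl); rewrite Rminus_0_r in H.
apply (is_derive_ext (fun t => bump ((t - 0) / dl) / dl)); [ | exact H ].
intros t; unfold kern; rewrite Rminus_0_r; reflexivity.
Qed.

Lemma kern_continuous y : continuous (kern dl) y.
Proof using Hdl. exact (derive_continuous _ _ _ (kern_derive y)). Qed.

Lemma kern'_continuous y : continuous (kern' dl) y.
Proof using.
apply (continuous_mult_R (fun y => bump' (y / dl)) (fun _ => / dl ^ 2)); [ | apply continuous_const ].
apply (continuous_comp (fun y => y / dl) bump'); [ | apply bump'_continuous ].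
apply (continuous_mult_R (fun y => y) (fun _ => / dl)); [ apply continuous_id | apply continuous_const ].
Qed.

Lemma kern_nonneg y : 0 <= kern dl y.
Proof using Hdl. apply Rdiv_le_0_compat; [ apply bump_nonneg | trivial ]. Qed.

Lemma kern_outside y : ~ (- dl < y < dl) -> kern dl y = 0 /\ kern' dl y = 0.
Proof using Hdl.
intros H; assert (S := scaled_outside dl 0 y Hdl ltac:(lra)); rewrite Rminus_0_r in S.
destruct (bump_outside _ S) as [B1 B2]; unfold kern, kern'; rewrite B1, B2.
unfold Rdiv; split; ring.
Qed.

Lemma kern'_sign y : y * kern' dl y <= 0.
Proof using Hdl.
unfold kern'.
replace (y * (bump' (y / dl) / dl ^ 2)) with ((y / dl * bump' (y / dl)) * / dl) by (field; lra).
assert (H := bump'_sign (y / dl)); assert (P := Rinv_0_lt_compat _ Hdl); nra.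
Qed.

Lemma RInt_kern a x y : x <= a - dl -> a + dl <= y ->
  RInt (fun r => kern dl (r - a)) x y = 1.
Proof using Hdl. intros Hx Hy; exact (RInt_bump_scaled dl a x y Hdl Hx Hy). Qed.

Lemma kern_shift_derive a r : is_derive (fun r => kern dl (r - a)) r (kern' dl (r - a)).
Proof using Hdl.
rewrite <- (Rmult_1_r (kern' dl (r - a))).
apply (is_derive_comp_R (kern dl) (fun r => r - a)); [ apply kern_derive | ].
auto_derive; trivial; ring.
Qed.

Lemma kern_shift_continuous a r : continuous (fun r => kern dl (r - a)) r.
Proof using Hdl. exact (derive_continuous _ _ _ (kern_shift_derive a r)). Qed.

Lemma kern'_shift_continuous a r : continuous (fun r => kern' dl (r - a)) r.
Proof using.
apply (continuous_comp (fun r => r - a) (kern' dl)); [ | apply kern'_continuous ].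
apply (derive_continuous _ _ 1); auto_derive; trivial; ring.
Qed.

(* [r kern' <= 0], so the absolute moment of [kern'] is obtained by parts. *)
Lemma RInt_kern_moment a x y : x <= a - dl -> a + dl <= y ->
  RInt (fun r => kern dl (r - a) - (r - a) * kern' dl (r - a)) x y = 2.
Proof using Hdl.
intros Hx Hy; assert (Hxy : x <= y) by lra.
assert (C : forall r, continuous (fun r => kern dl (r - a) + (r - a) * kern' dl (r - a)) r).
{ intros r; apply continuous_plus_R; [ apply kern_shift_continuous | ].
  apply continuous_mult_R; [ | apply kern'_shift_continuous ].
  apply (derive_continuous _ _ 1); auto_derive; trivial; ring. }
assert (E : RInt (fun r => kern dl (r - a) + (r - a) * kern' dl (r - a)) x y = 0).
{ rewrite (RInt_FTC (fun r => (r - a) * kern dl (r - a))); trivial.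
  - rewrite (proj1 (kern_outside (x - a) ltac:(lra))), (proj1 (kern_outside (y - a) ltac:(lra))).
    apply (eq_trans (f_equal2 Rminus (Rmult_0_r _) (Rmult_0_r _))), Rminus_0_r.
  - intros r _.
    replace (kern dl (r - a) + (r - a) * kern' dl (r - a))
      with (1 * kern dl (r - a) + (r - a) * kern' dl (r - a)) by ring.
    apply (is_derive_mult_R (fun r => r - a) (fun r => kern dl (r - a)));
      [ auto_derive; trivial; ring | apply kern_shift_derive ]. }
rewrite (RInt_ext_le _ (fun r => 2 * kern dl (r - a) - (kern dl (r - a) + (r - a) * kern' dl (r - a))));
  trivial; [ | intros; ring ].
rewrite RInt_minus_R, E, RInt_scal_R, RInt_kern; trivial; try lra;
  apply ex_RInt_cont; trivial; intros; auto.
- apply kern_shift_continuous.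
- apply (continuous_scal_r (K := R_AbsRing) 2 (fun r => kern dl (r - a))), kern_shift_continuous.
Qed.

(** Unit mass turns the difference into an average of [f - k], and nonnegativity bounds that average
    by its values on the support of the kernel. *)
Lemma kern_average (f : R -> R) (a x y k e : R) : x <= a - dl -> a + dl <= y ->
  (forall r, x <= r <= y -> continuous f r) ->
  (forall r, Rabs (r - a) <= dl -> Rabs (f r - k) <= e) ->
  Rabs (RInt (fun r => f r * kern dl (r - a)) x y - k) <= e.
Proof using Hdl.
intros Hx Hy Hf He; assert (Hxy : x <= y) by lra.
assert (CK : forall r, continuous (fun r => kern dl (r - a)) r)
  by (intros; apply kern_shift_continuous).
assert (E1 : ex_RInt (fun r => kern dl (r - a)) x y) by (apply ex_RInt_cont; auto).
replace (RInt (fun r => f r * kern dl (r - a)) x y - k)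
  with (RInt (fun r => (f r - k) * kern dl (r - a)) x y).
2:{ rewrite (RInt_ext_le _ (fun r => f r * kern dl (r - a) - k * kern dl (r - a)));
      [ | trivial | intros; ring ].
    rewrite RInt_minus_R, RInt_scal_R, RInt_kern; trivial; [ eqR; ring | | ].
    - apply ex_RInt_cont; trivial; intros; apply continuous_mult_R; auto.
    - apply (ex_RInt_scal (V := R_NormedModule)); trivial. }
rewrite <- (Rmult_1_r e), <- (RInt_kern a x y Hx Hy), <- RInt_scal_R by trivial.
apply RInt_abs_le; trivial.
- apply ex_RInt_cont; trivial; intros; apply continuous_mult_R; auto.
  apply continuous_minus_R; auto; apply continuous_const.
- apply (ex_RInt_scal (V := R_NormedModule)); trivial.
- intros r Hr; rewrite Rabs_mult, (Rabs_pos_eq (kern _ _)) by apply kern_nonneg.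
  destruct (Rle_or_lt (Rabs (r - a)) dl) as [H | H].
  + apply Rmult_le_compat_r; [ apply kern_nonneg | auto ].
  + rewrite (proj1 (kern_outside (r - a) ltac:(intros Hn; apply (Rlt_not_le _ _ H);
      apply Rabs_le_between; lra))); lra.
Qed.

End Kernel.

(** * From the weak transport identity to an integral equation on the curve *)

Section Transport.
Context (d : nat) (c : R -> R) (c0 c1 r0 T : R) (u ut ur : R -> R -> R) (rhat : R -> R).
Context (Hc : Cn 1 c) (Hc0 : 0 < c0) (Hcb : forall x : R, c0 <= c x <= c1) (Hr0 : 0 < r0)
  (HT : 0 < T) (Hs : solution d c T u ut ur) (Hchar : characteristic c r0 T u rhat).

Definition char_s (t r : R) : R := clamp ut t r - vr c (clamp u) (clamp ur) t r.

(** The negative of the right-hand side of the transport equation for [u_t - c u_r], so that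
    [char_s] plus the time integral of [char_src] is constant along the curve. *)
Definition char_src (t r : R) : R :=
  Derive c (clamp u t r) * clamp ut t r * clamp ur t r
  - 2 * alpha d * (c (clamp u t r) * vr c (clamp u) (clamp ur) t r) / r.

Lemma strip_clamp_u : strip (-1) T (clamp u).
Proof using Hs HT. apply continuous_on_clamp; trivial; apply (C1_cont _ _ _ _ (proj1 Hs)). Qed.
Lemma strip_clamp_ut : strip (-1) T (clamp ut).
Proof using Hs HT. apply continuous_on_clamp; trivial; apply (C1_cont_t _ _ _ _ (proj1 Hs)). Qed.
Lemma strip_clamp_ur : strip (-1) T (clamp ur).
Proof using Hs HT. apply continuous_on_clamp; trivial; apply (C1_cont_r _ _ _ _ (proj1 Hs)). Qed.

Lemma strip_clamp_cu : strip (-1) T (fun t r => c (clamp u t r)).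
Proof using Hc Hs HT.
intros t r Ht Hr; apply continuity_2d_pt_comp1; [ | apply strip_clamp_u; trivial ].
exact (derive_continuous _ _ _ (Cn1_derive c Hc _)).
Qed.

Lemma strip_clamp_c'u : strip (-1) T (fun t r => Derive c (clamp u t r)).
Proof using Hc Hs HT.
intros t r Ht Hr; apply continuity_2d_pt_comp1; [ | apply strip_clamp_u; trivial ].
apply (proj2 (Hc _)).
Qed.

Lemma strip_clamp_vr : strip (-1) T (vr c (clamp u) (clamp ur)).
Proof using Hc Hs HT.
intros t r Ht Hr; apply continuity_2d_pt_mult; [ apply strip_clamp_cu | apply strip_clamp_ur ]; trivial.
Qed.

Lemma strip_char_s : strip (-1) T char_s.
Proof using Hc Hs HT.
intros t r Ht Hr; apply continuity_2d_pt_minus; [ apply strip_clamp_ut | apply strip_clamp_vr ]; trivial.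
Qed.

Lemma strip_char_src : strip (-1) T char_src.
Proof using Hc Hs HT.
assert (S1 := strip_clamp_ut); assert (S2 := strip_clamp_ur); assert (S3 := strip_clamp_cu).
assert (S4 := strip_clamp_c'u); assert (S5 := strip_clamp_vr).
intros t r Ht Hr; unfold char_src; assert (r <> 0) by lra; c2d.
Qed.

Lemma speed_continuous t : -1 < t < T -> continuous (fun t => c (clamp u t (curve rhat t))) t.
Proof using Hc Hc0 Hcb Hr0 HT Hs Hchar.
intros Ht; apply (continuous_subst (fun t r => c (clamp u t r)) _ (-1) T); trivial.
- apply strip_clamp_cu.
- generalize (curve_bounds c c0 c1 r0 T u rhat Hc0 Hcb Hr0 HT Hchar t ltac:(lra)); lra.
- apply (curve_continuous c r0 T u); trivial; lra.
Qed.

Lemma C1_kern (dl t r : R) : 0 < dl -> 0 < t < T ->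
  C1_at (fun t r => kern dl (r - curve rhat t))
    (fun t r => kern' dl (r - curve rhat t) * - c (clamp u t (curve rhat t)))
    (fun t r => kern' dl (r - curve rhat t)) t r.
Proof using Hc Hc0 Hcb Hr0 HT Hs Hchar.
intros Hdl Ht.
assert (A := C1_at_snd (fun r => r) (fun _ => 1) t r ltac:(auto_derive; trivial) (continuous_const _ _)).
assert (B := C1_at_fst (curve rhat) (fun t => c (clamp u t (curve rhat t))) t r).
cbv beta in B; rewrite clamp_pos in B by lra.
assert (C := C1_at_sub _ _ _ _ _ _ t r A (B (curve_derive c r0 T u rhat Hchar t Ht) (speed_continuous t ltac:(lra)))).
refine (C1_at_ext _ _ _ _ _ t r
  (C1_at_comp (kern dl) (kern' dl) _ _ _ t r (kern_derive dl Hdl) (kern'_continuous dl) C) _ _);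
  intros; ring.
Qed.

Lemma clamp_speed_derive (t r k : R) : t < T -> 0 < r ->
  is_derive (fun r => c (clamp u t r) - k) r (Derive c (clamp u t r) * clamp ur t r).
Proof using Hc Hs HT.
intros Ht Hr.
assert (D := C1_derive_r _ _ _ _ (proj1 Hs) (Rmax 0 t) r
  (conj (Rmax_l _ _) (Rmax_lub_lt _ _ _ HT Ht)) Hr).
assert (E := is_derive_comp_R c (clamp u t) r _ _ (Cn1_derive c Hc _) D).
assert (E' := is_derive_minus _ _ r _ _ E (is_derive_const (K := R_AbsRing) (V := R_NormedModule) k r)).
rewrite <- (Rminus_0_r (Derive c (clamp u t r) * clamp ur t r)); exact E'.
Qed.

Section Regularized.
Context (dl r1 r2 hi : R) (Hdl : 0 < dl) (Hr1 : 0 < r1) (Hr1' : r1 < r0 - dl) (Hhi : 0 < hi <= T)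
  (Hr2 : forall t, t < hi -> curve rhat t < r2 - 2 * dl).

(* The [r]-derivative of [(c - c(rhat)) kern], hence of integral 0: [char_s] may be replaced by
   its increment [char_s - char_s(rhat)] when integrated against it. *)
Definition reg_flux (t r : R) : R :=
  (c (clamp u t r) - c (clamp u t (curve rhat t))) * kern' dl (r - curve rhat t)
  + Derive c (clamp u t r) * clamp ur t r * kern dl (r - curve rhat t).

Definition reg_p (t r : R) : R := char_s t r * kern dl (r - curve rhat t).

(** With the weight [chi(t) kern (r - curve t)] the transport identity says that [chi' reg_p] and
    [chi reg_q] have equal integrals. The motion of the kernel contributes [- c(rhat) kern'], which
    reduces the coefficient of [kern'] to a difference of speeds. *)
Definition reg_q (t r : R) : R :=
  char_src t r * kern dl (r - curve rhat t) - char_s t r * reg_flux t r.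

Lemma strip_kern : strip (-1) hi (fun t r => kern dl (r - curve rhat t)).
Proof using Hdl Hhi HT Hchar.
intros t r Ht Hr; apply continuity_2d_pt_comp1; [ apply kern_continuous; trivial | ].
apply continuity_2d_pt_minus; [ c2d | apply continuity_2d_pt_fst ].
apply (curve_continuous c r0 T u); trivial; lra.
Qed.

Lemma strip_kern' : strip (-1) hi (fun t r => kern' dl (r - curve rhat t)).
Proof using Hdl Hhi HT Hchar.
intros t r Ht Hr; apply continuity_2d_pt_comp1; [ apply kern'_continuous; trivial | ].
apply continuity_2d_pt_minus; [ c2d | apply continuity_2d_pt_fst ].
apply (curve_continuous c r0 T u); trivial; lra.
Qed.

Lemma strip_reg_flux : strip (-1) hi reg_flux.
Proof using All.
assert (S1 := strip_kern); assert (S2 := strip_kern').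
assert (S3 := strip_sub _ _ (-1) hi _ strip_clamp_c'u (Rle_refl _) (proj2 Hhi)).
assert (S4 := strip_sub _ _ (-1) hi _ strip_clamp_ur (Rle_refl _) (proj2 Hhi)).
assert (S5 := strip_sub _ _ (-1) hi _ strip_clamp_cu (Rle_refl _) (proj2 Hhi)).
intros t r Ht Hr; unfold reg_flux.
assert (continuity_2d_pt (fun t _ => c (clamp u t (curve rhat t))) t r)
  by (apply (continuity_2d_pt_fst (fun t => c (clamp u t (curve rhat t)))), speed_continuous; lra).
c2d.
Qed.

Lemma strip_reg_p : strip (-1) hi reg_p.
Proof using All.
assert (S1 := strip_kern).
assert (S3 := strip_sub _ _ (-1) hi _ strip_char_s (Rle_refl _) (proj2 Hhi)).
intros t r Ht Hr; unfold reg_p; c2d.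
Qed.

Lemma strip_reg_q : strip (-1) hi reg_q.
Proof using All.
assert (S1 := strip_kern); assert (S2 := strip_reg_flux).
assert (S3 := strip_sub _ _ (-1) hi _ strip_char_s (Rle_refl _) (proj2 Hhi)).
assert (S4 := strip_sub _ _ (-1) hi _ strip_char_src (Rle_refl _) (proj2 Hhi)).
intros t r Ht Hr; unfold reg_q; c2d.
Qed.

Lemma reg_r1_r2 : r0 + 2 * dl < r2.
Proof using All.
assert (H := Hr2 0 ltac:(lra)); rewrite curve_pos, (proj1 Hchar) in H by lra; lra.
Qed.

Lemma reg_weak (chi chi' : R -> R) (t1 t2 a1 a2 : R) :
  0 < t1 < a1 -> a1 <= a2 < t2 -> t2 < hi ->
  (forall t, is_derive chi t (chi' t)) -> (forall t, continuous chi' t) ->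
  (forall t, ~ (a1 <= t <= a2) -> chi t = 0 /\ chi' t = 0) ->
  RInt (fun t => chi t * RInt (fun r => reg_q t r) r1 r2) t1 t2
  = RInt (fun t => chi' t * RInt (fun r => reg_p t r) r1 r2) t1 t2.
Proof using All.
intros Ht1 Ht2 Ht2h Dchi Cchi' Zchi.
assert (Hr := reg_r1_r2).
assert (Sp := strip_reg_p); assert (Sq := strip_reg_q).
rewrite !(DI_factor (-1) hi); trivial; try lra.
assert (Hb2 := Hr2 a2 ltac:(lra)).
assert (E := transport_identity d c T u ut ur Hc Hs t1 t2 r1 r2 a1 a2 (r0 - dl) (r2 - dl) _ _ _
  Ht1 Ht2 ltac:(lra) ltac:(lra) ltac:(lra)
  (fun t r Ht Hr => C1_at_mult _ _ _ _ _ _ t r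
    (C1_at_fst chi chi' t r (Dchi t) (Cchi' t)) (C1_kern dl t r Hdl Ht))).
cbv beta in E.
apply Rminus_diag_uniq_sym.
rewrite <- (DI_minus (-1) hi); try lra.
- rewrite <- E.
  + apply DI_ext; try lra; intros t r Ht Hr'.
    unfold reg_p, reg_q, reg_flux, char_s, char_src, vr; rewrite !clamp_pos by lra.
    field; lra.
  + intros t r Hn.
    destruct (classic (a1 <= t <= a2)) as [Ha | Ha].
    * assert (Hb := curve_bounds c c0 c1 r0 T u rhat Hc0 Hcb Hr0 HT Hchar t ltac:(lra)).
      assert (Hb' := Hr2 t ltac:(lra)).
      destruct (kern_outside dl Hdl (r - curve rhat t)) as [K1 K2]; [ lra | ].
      rewrite K1, K2; repeat split; ring.
    * destruct (Zchi t Ha) as [Z1 Z2]; rewrite Z1, Z2; repeat split; ring.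
- intros t r Ht Hr'; apply continuity_2d_pt_mult; [ | apply Sp; trivial ].
  apply continuity_2d_pt_fst; trivial.
- intros t r Ht Hr'; apply continuity_2d_pt_mult; [ | apply Sq; trivial ].
  apply continuity_2d_pt_fst, (derive_continuous _ _ _ (Dchi t)).
Qed.

(** The tested relation is an equality, so the one-sided lemma applies both to the pair of integrals
    and to its opposite. *)
Lemma reg_transport b : 0 < b < hi ->
  RInt (fun r => reg_p b r) r1 r2 + RInt (fun t => RInt (fun r => reg_q t r) r1 r2) 0 b
  = RInt (fun r => reg_p 0 r) r1 r2.
Proof using All.
intros Hb.
assert (Hr := reg_r1_r2).
assert (CP : forall t, -1 < t < hi -> continuous (fun t => RInt (fun r => reg_p t r) r1 r2) t).
{ intros t Ht; apply (inner_continuous (-1) hi); trivial; [ apply strip_reg_p | lra ]. }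
assert (CQ : forall t, -1 < t < hi -> continuous (fun t => RInt (fun r => reg_q t r) r1 r2) t).
{ intros t Ht; apply (inner_continuous (-1) hi); trivial; [ apply strip_reg_q | lra ]. }
apply Rle_antisym.
- apply (weak_decrease_at_0 hi (fun t => RInt (fun r => reg_p t r) r1 r2)
    (fun t => RInt (fun r => reg_q t r) r1 r2)); trivial.
  intros; right; apply (reg_weak chi chi' t1 t2 a1 a2); trivial.
- assert (H := weak_decrease_at_0 hi (fun t => - RInt (fun r => reg_p t r) r1 r2)
    (fun t => - RInt (fun r => reg_q t r) r1 r2)
    (fun t Ht => continuous_opp (V := R_NormedModule) _ _ (CP t Ht))
    (fun t Ht => continuous_opp (V := R_NormedModule) _ _ (CQ t Ht))).
  assert (EQ : ex_RInt (fun t => RInt (fun r => reg_q t r) r1 r2) 0 b)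
    by (apply ex_RInt_cont; [ lra | intros; apply CQ; lra ]).
  assert (ON : forall (f : R -> R) x y, ex_RInt f x y -> RInt (fun t => - f t) x y = - RInt f x y).
  { intros f x y Hf; exact (RInt_opp (V := R_CompleteNormedModule) f x y Hf). }
  enough (H' : - RInt (fun r => reg_p b r) r1 r2 + RInt (fun t => - RInt (fun r => reg_q t r) r1 r2) 0 b
    <= - RInt (fun r => reg_p 0 r) r1 r2) by (rewrite ON in H' by trivial; lra).
  apply H; trivial.
  intros chi chi' t1 t2 a1 a2 L1 L2 L3 Dchi Cchi' _ Zchi; right.
  assert (W := reg_weak chi chi' t1 t2 a1 a2 L1 L2 L3 Dchi Cchi' Zchi).
  assert (CC : forall t, continuous chi t) by (intros t; exact (derive_continuous _ _ _ (Dchi t))).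
  rewrite (RInt_ext_le _ (fun t => - (chi t * RInt (fun r => reg_q t r) r1 r2))); [ | lra | intros; eqR; ring ].
  rewrite (RInt_ext_le (fun t => chi' t * _) (fun t => - (chi' t * RInt (fun r => reg_p t r) r1 r2)));
    [ | lra | intros; eqR; ring ].
  rewrite !ON, W; trivial; apply ex_RInt_cont; try lra; intros; apply continuous_mult_R; auto;
    [ apply CP | apply CQ ]; lra.
Qed.

End Regularized.

(** The kernel width is sent to 0 in [reg_transport]. The delicate term is [reg_flux], where [kern']
    has size [dl^-2]: the speed difference supplies a factor [|r - a|], so the absolute integral of
    [reg_flux] stays below [2 L]. Integrated against an increment of [char_s] of size [e], it
    contributes at most [2 L e]. *)
Lemma transport_along (b : R) : 0 < b < T ->
  char_s b (curve rhat b) + RInt (fun t => char_src t (curve rhat t)) 0 b = char_s 0 r0.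
Proof using All.
intros Hb.
assert (Hc1 : 0 < c1) by (generalize (Hcb 0); lra).
set (r1 := r0 / 2); set (r2 := r0 + c1 * T + r0).
assert (HcT : 0 < c1 * T) by (apply Rmult_lt_0_compat; trivial).
assert (Hcv : forall t, t < T -> r0 <= curve rhat t <= r0 + c1 * T).
{ intros t Ht; assert (H := curve_bounds c c0 c1 r0 T u rhat Hc0 Hcb Hr0 HT Hchar t Ht).
  assert (Rmax 0 t <= T) by (apply Rmax_case; lra); nra. }
assert (Hcurve0 : curve rhat 0 = r0) by (rewrite curve_pos by lra; apply (proj1 Hchar)).
assert (Hm : forall t, 0 <= t <= b -> r1 + r0 / 4 <= curve rhat t <= r2 - r0 / 4).
{ intros t Ht; specialize (Hcv t ltac:(lra)); unfold r1, r2; lra. }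
assert (Ss := strip_char_s); assert (Sg := strip_char_src).
assert (Scu := strip_clamp_cu); assert (Sc'u := strip_clamp_c'u); assert (Sur := strip_clamp_ur).
destruct (box_bounded (fun t r => Derive c (clamp u t r) * clamp ur t r) 0 b r1 r2)
  as [L [HL BL]]; try (unfold r1, r2; lra).
{ intros t r Ht Hr; unfold r1 in Hr; c2d. }
set (x := char_s b (curve rhat b) + RInt (fun t => char_src t (curve rhat t)) 0 b - char_s 0 r0).
(* One error [e] at each end of the curve, and an error [e (1 + 2 L)] in the source at every time of
   [[0, b]]. *)
set (K := 2 + b * (1 + 2 * L)).
assert (HK : 0 < K) by (unfold K; assert (0 < b * (1 + 2 * L)) by (apply Rmult_lt_0_compat; lra); lra).
enough (H : forall e, 0 < e -> Rabs x <= e * K).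
{ apply Rminus_diag_uniq; fold x; apply cond_eq; intros e He; rewrite Rminus_0_r.
  apply Rle_lt_trans with (e / (2 * K) * K); [ apply H, Rdiv_lt_0_compat; lra | ].
  replace (e / (2 * K) * K) with (e / 2) by (field; lra); lra. }
intros e He.
destruct (tube_near (-1) T 0 b r1 r2 (r0 / 4) e char_s (curve rhat) Ss) as [d1 [D1 [D1' D1'']]];
  trivial; try (unfold r1; lra).
destruct (tube_near (-1) T 0 b r1 r2 (r0 / 4) e char_src (curve rhat) Sg) as [d2 [D2 [D2' D2'']]];
  trivial; try (unfold r1; lra).
set (dl := Rmin d1 d2).
assert (Hdl : 0 < dl) by (apply Rmin_case; trivial).
assert (Hdl1 : dl <= d1) by apply Rmin_l; assert (Hdl2 : dl <= d2) by apply Rmin_r.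
set (hi := (b + T) / 2).
assert (Hreg := reg_transport dl r1 r2 hi Hdl ltac:(unfold r1; lra) ltac:(unfold r1; lra)
  ltac:(unfold hi; lra)
  ltac:(intros t Ht; unfold hi in Ht; specialize (Hcv t ltac:(lra)); unfold r2; lra) b ltac:(unfold hi; lra)).
assert (SQ := strip_reg_q dl r1 r2 hi Hdl ltac:(unfold r1; lra) ltac:(unfold r1; lra)
  ltac:(unfold hi; lra)
  ltac:(intros t Ht; unfold hi in Ht; specialize (Hcv t ltac:(lra)); unfold r2; lra)).
assert (SF := strip_reg_flux dl r1 r2 hi Hdl ltac:(unfold r1; lra) ltac:(unfold r1; lra)
  ltac:(unfold hi; lra)
  ltac:(intros t Ht; unfold hi in Ht; specialize (Hcv t ltac:(lra)); unfold r2; lra)).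
assert (Hhi : b < hi < T) by (unfold hi; lra).
assert (Hr12 : 0 < r1 < r2) by (unfold r1, r2; lra).
assert (Cs : forall t r, 0 <= t <= b -> r1 <= r <= r2 -> continuous (char_s t) r)
  by (intros; apply (continuity_2d_pt_slice char_s), Ss; lra).
assert (Cg : forall t r, 0 <= t <= b -> r1 <= r <= r2 -> continuous (char_src t) r)
  by (intros; apply (continuity_2d_pt_slice char_src), Sg; lra).
assert (Cf : forall t r, 0 <= t <= b -> r1 <= r <= r2 -> continuous (reg_flux dl t) r)
  by (intros; apply (continuity_2d_pt_slice (reg_flux dl)), SF; lra).
assert (HP : forall t, 0 <= t <= b ->
  Rabs (RInt (fun r => reg_p dl t r) r1 r2 - char_s t (curve rhat t)) <= e).
{ intros t Ht; specialize (Hm t Ht); apply (kern_average dl Hdl); try lra; auto.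
  intros r Hr; apply D1''; trivial; lra. }
assert (HQ : forall t, 0 <= t <= b ->
  Rabs (RInt (fun r => reg_q dl t r) r1 r2 - char_src t (curve rhat t)) <= e * (1 + 2 * L)).
{ intros t Ht; specialize (Hm t Ht).
  set (a := curve rhat t) in *.
  assert (EF : RInt (reg_flux dl t) r1 r2 = 0).
  { rewrite (RInt_FTC (fun r => (c (clamp u t r) - c (clamp u t a)) * kern dl (r - a))); try lra.
    - rewrite (proj1 (kern_outside dl Hdl (r1 - a) ltac:(lra))), (proj1 (kern_outside dl Hdl (r2 - a) ltac:(lra))).
      apply (eq_trans (f_equal2 Rminus (Rmult_0_r _) (Rmult_0_r _))), Rminus_0_r.
    - intros r Hr; unfold reg_flux; fold a; rewrite Rplus_comm.
      apply (is_derive_mult_R (fun r => c (clamp u t r) - c (clamp u t a)) (fun r => kern dl (r - a)));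
        [ | apply kern_shift_derive; trivial ].
      apply clamp_speed_derive; lra.
    - intros r Hr; apply Cf; trivial. }
  assert (EK : RInt (fun r => (char_s t r - char_s t a) * reg_flux dl t r) r1 r2
    = RInt (fun r => char_s t r * reg_flux dl t r) r1 r2).
  { rewrite (RInt_ext_le _ (fun r => char_s t r * reg_flux dl t r - char_s t a * reg_flux dl t r));
      [ | lra | intros; ring ].
    rewrite RInt_minus_R, RInt_scal_R, EF.
    - unfold Rminus; rewrite Rmult_0_r, Ropp_0; apply Rplus_0_r.
    - apply ex_RInt_cont; [ lra | auto ].
    - apply ex_RInt_cont; [ lra | intros; apply continuous_mult_R; auto ].
    - apply ex_RInt_cont; [ lra | intros; apply continuous_mult_R; auto; apply continuous_const ]. }
  assert (BK : Rabs (RInt (fun r => (char_s t r - char_s t a) * reg_flux dl t r) r1 r2) <= e * L * 2).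
  { rewrite <- (RInt_kern_moment dl Hdl a r1 r2) by lra.
    rewrite <- RInt_scal_R.
    2:{ apply ex_RInt_cont; [ lra | intros ]; apply continuous_minus_R; [ apply kern_shift_continuous; trivial | ].
        apply continuous_mult_R; [ | apply kern'_shift_continuous ].
        apply (derive_continuous _ _ 1); auto_derive; trivial; ring. }
    apply RInt_abs_le; [ lra | | | ].
    - apply ex_RInt_cont; [ lra | intros; apply continuous_mult_R; auto ].
      apply continuous_minus_R; auto; apply continuous_const.
    - apply ex_RInt_cont; [ lra | intros ].
      apply (continuous_scal_r (K := R_AbsRing) (e * L) (fun r => kern dl (r - a) - (r - a) * kern' dl (r - a))).
      apply continuous_minus_R; [ apply kern_shift_continuous; trivial | ].
      apply continuous_mult_R; [ | apply kern'_shift_continuous ].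
      apply (derive_continuous _ _ 1); auto_derive; trivial; ring.
    - intros r Hr; rewrite Rabs_mult.
      assert (NK := kern_nonneg dl Hdl (r - a)); assert (NK' := kern'_sign dl Hdl (r - a)).
      destruct (classic (- dl < r - a < dl)) as [Hin | Hout].
      2:{ destruct (kern_outside dl Hdl _ Hout) as [K1 K2].
          unfold reg_flux; fold a; rewrite K1, K2, !Rmult_0_r, Rplus_0_r, Rabs_R0; lra. }
      assert (B1 : Rabs (char_s t r - char_s t a) <= e)
        by (apply D1''; trivial; fold a; apply Rabs_le_between; lra).
      assert (B2 : Rabs (Derive c (clamp u t r) * clamp ur t r) <= L) by (apply BL; lra).
      assert (B3 : Rabs (c (clamp u t r) - c (clamp u t a)) <= L * Rabs (r - a)).
      { assert (Hz : forall z, Rmin a r <= z <= Rmax a r -> r1 <= z <= r2)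
          by (intros z; unfold Rmin, Rmax; destruct Rle_dec; lra).
        destruct (MVT_gen (fun r => c (clamp u t r) - c (clamp u t a)) a r
          (fun r => Derive c (clamp u t r) * clamp ur t r)) as [z [Hz1 Hz2]].
        - intros y Hy; specialize (Hz y ltac:(lra)); apply clamp_speed_derive; lra.
        - intros y Hy; specialize (Hz y Hy); apply continuity_pt_filterlim.
          apply (derive_continuous _ _ _ (clamp_speed_derive t y (c (clamp u t a)) ltac:(lra) ltac:(lra))).
        - rewrite Rminus_diag, Rminus_0_r in Hz2; rewrite Hz2, Rabs_mult.
          apply Rmult_le_compat_r; [ apply Rabs_pos | apply BL; auto ]. }
      assert (B4 : Rabs (r - a) * Rabs (kern' dl (r - a)) = - ((r - a) * kern' dl (r - a))).
      { rewrite <- Rabs_mult; apply Rabs_left1; trivial. }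
      assert (B5 : Rabs (reg_flux dl t r) <= L * (kern dl (r - a) - (r - a) * kern' dl (r - a))).
      { unfold reg_flux; fold a; eapply Rle_trans; [ apply Rabs_triang | ].
        rewrite (Rabs_mult (c _ - _)), (Rabs_mult (_ * _) (kern _ _)), (Rabs_pos_eq (kern _ _)) by trivial.
        assert (Rabs (c (clamp u t r) - c (clamp u t a)) * Rabs (kern' dl (r - a))
          <= L * Rabs (r - a) * Rabs (kern' dl (r - a)))
          by (apply Rmult_le_compat_r; [ apply Rabs_pos | trivial ]).
        assert (Rabs (Derive c (clamp u t r) * clamp ur t r) * kern dl (r - a) <= L * kern dl (r - a))
          by (apply Rmult_le_compat_r; trivial).
        rewrite Rmult_assoc, B4 in H; lra. }
      rewrite Rmult_assoc; apply Rmult_le_compat; trivial; apply Rabs_pos. }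
  unfold reg_q; rewrite RInt_minus_R, <- EK.
  - assert (BG : Rabs (RInt (fun r => char_src t r * kern dl (r - curve rhat t)) r1 r2
      - char_src t a) <= e).
    { apply (kern_average dl Hdl); fold a; try lra; auto.
      intros r Hr; apply D2''; trivial; fold a; lra. }
    apply Rabs_le_between in BG; apply Rabs_le_between in BK; apply Rabs_le_between; lra.
  - apply ex_RInt_cont; [ lra | intros; apply continuous_mult_R; auto; apply kern_shift_continuous; trivial ].
  - apply ex_RInt_cont; [ lra | intros; apply continuous_mult_R; auto ]. }
assert (EQ : ex_RInt (fun t => RInt (fun r => reg_q dl t r) r1 r2) 0 b).
{ apply ex_RInt_cont; [ lra | intros; apply (inner_continuous (-1) hi); trivial; lra ]. }
assert (EG : ex_RInt (fun t => char_src t (curve rhat t)) 0 b).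
{ apply ex_RInt_cont; [ lra | intros t Ht ].
  apply (continuous_subst char_src _ (-1) T); trivial; try lra; [ specialize (Hcv t ltac:(lra)); lra | ].
  apply (curve_continuous c r0 T u); trivial; lra. }
assert (BI : Rabs (RInt (fun t => RInt (fun r => reg_q dl t r) r1 r2 - char_src t (curve rhat t)) 0 b)
  <= (b - 0) * (e * (1 + 2 * L))).
{ apply abs_RInt_le_const; [ lra | | auto ].
  apply (ex_RInt_minus (V := R_NormedModule)); trivial. }
rewrite RInt_minus_R in BI by trivial.
assert (B1 := HP b ltac:(lra)); assert (B2 := HP 0 ltac:(lra)); rewrite Hcurve0 in B2.
apply Rabs_le_between in BI; apply Rabs_le_between in B1; apply Rabs_le_between in B2.
apply Rabs_le_between; unfold x, K; lra.
Qed.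

End Transport.

(** * Energy flux through a characteristic *)

Lemma Rpower_derive (p r : R) : 0 < r ->
  is_derive (fun r => Rpower r p) r (p * (Rpower r p / r)).
Proof. intros Hr; unfold Rpower; auto_derive; [ trivial | field; lra ]. Qed.

Lemma Rpower_continuous (p r : R) : 0 < r -> continuous (fun r => Rpower r p) r.
Proof. intros Hr; exact (derive_continuous _ _ _ (Rpower_derive p r Hr)). Qed.

Lemma C1_Rpower (p t r : R) : 0 < r ->
  C1_at (fun _ r => Rpower r p) (fun _ _ => 0) (fun _ r => p * (Rpower r p / r)) t r.
Proof.
intros Hr; apply (C1_at_snd (fun r => Rpower r p) (fun r => p * (Rpower r p / r))).
- apply Rpower_derive; trivial.
- apply (continuous_scal_r (K := R_AbsRing) p (fun r => Rpower r p / r)).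
  apply (continuous_mult_R (fun r => Rpower r p) (fun r => / r)).
  + apply Rpower_continuous; trivial.
  + apply (derive_continuous _ _ (- / r ^ 2)); auto_derive; [ lra | field; lra ].
Qed.

Lemma Rpower_pos (x y : R) : 0 < Rpower x y.
Proof. apply exp_pos. Qed.

Section Energy.
Context (d : nat) (c : R -> R) (c0 c1 r0 T : R) (u ut ur : R -> R -> R) (rhat : R -> R).
Context (Hc : Cn 1 c) (Hc0 : 0 < c0) (Hcb : forall x : R, c0 <= c x <= c1) (Hr0 : 0 < r0)
  (HT : 0 < T) (Hs : solution d c T u ut ur) (Hchar : characteristic c r0 T u rhat).

Definition weight (r : R) : R := Rpower r (2 * alpha d).

(** Equal to [(R^2 + S^2) / (2 r^(2 alpha))]; the factor 1/2 of the energy is carried by [en_p]. *)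
Definition density (t r : R) : R := clamp ut t r ^ 2 + vr c (clamp u) (clamp ur) t r ^ 2.

Definition momentum (t r : R) : R :=
  c (clamp u t r) * vr c (clamp u) (clamp ur) t r * clamp ut t r.

(** Rate of loss at a boundary that moves with the curve: the energy swept by the motion at speed
    [c(rhat)], plus the flux through a boundary at rest. On the curve the two speeds agree and the
    sum is a perfect square in [R]. *)
Definition outflow (t r : R) : R :=
  weight r * (/ 2 * (c (clamp u t (curve rhat t)) * density t r) + momentum t r).

Lemma strip_weight lo hi : strip lo hi (fun _ r => weight r).
Proof using.
intros t r _ Hr; apply (continuity_2d_pt_snd weight), Rpower_continuous; trivial.
Qed.

Lemma strip_density : strip (-1) T density.
Proof using Hc Hs HT.
assert (S1 := strip_clamp_ut d c T u ut ur HT Hs).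
assert (S2 := strip_clamp_vr d c T u ut ur Hc HT Hs).
intros t r Ht Hr; unfold density; c2d.
Qed.

Lemma strip_momentum : strip (-1) T momentum.
Proof using Hc Hs HT.
assert (S1 := strip_clamp_ut d c T u ut ur HT Hs).
assert (S2 := strip_clamp_vr d c T u ut ur Hc HT Hs).
assert (S3 := strip_clamp_cu d c T u ut ur Hc HT Hs).
intros t r Ht Hr; unfold momentum; c2d.
Qed.

Lemma strip_outflow : strip (-1) T outflow.
Proof using All.
assert (S1 := strip_density); assert (S2 := strip_momentum); assert (S3 := strip_weight (-1) T).
intros t r Ht Hr; unfold outflow.
assert (continuity_2d_pt (fun t _ => c (clamp u t (curve rhat t))) t r)
  by (apply (continuity_2d_pt_fst (fun t => c (clamp u t (curve rhat t)))), (speed_continuous d c c0 c1 r0 T u ut ur); trivial).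
c2d.
Qed.

(** From [2 x y <= x^2 + y^2]: energy travels no faster than [c1], so a front moving inwards at
    speed [c1] can only lose it. *)
Lemma momentum_le t r : momentum t r <= / 2 * (c1 * density t r).
Proof using Hc0 Hcb.
unfold momentum, density.
set (x := clamp ut t r); set (y := vr c (clamp u) (clamp ur) t r); set (k := c (clamp u t r)).
assert (H : c0 <= k <= c1) by apply Hcb.
assert (0 <= k * (x - y) ^ 2) by (apply Rmult_le_pos; [ lra | apply pow2_ge_0 ]).
assert (0 <= (c1 - k) * (x ^ 2 + y ^ 2)).
{ apply Rmult_le_pos; [ lra | ]; generalize (pow2_ge_0 x) (pow2_ge_0 y); lra. }
lra.
Qed.

Lemma density_nonneg t r : 0 <= density t r.
Proof using.
unfold density; generalize (pow2_ge_0 (clamp ut t r)) (pow2_ge_0 (vr c (clamp u) (clamp ur) t r)); lra.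
Qed.

Section Regularized.
Context (dl r1 r2 hi : R) (Hdl : 0 < dl) (Hr1 : 0 < r1) (Hr1' : r1 < r0 - dl) (Hhi : 0 < hi <= T)
  (Hr2 : r0 + c1 * hi <= r2).

Definition inner_cut (t r : R) : R := step ((r - curve rhat t) / dl).
(** Equal to 1 for [r <= r2 - c1 t - 2] and to 0 for [r >= r2 - c1 t]. Its width stays fixed while
    [dl] shrinks, since only the sign of its contribution [en_n] matters. *)
Definition outer_cut (t r : R) : R := step (r2 - c1 * t - r - 1).

(** For the weight [chi r^(2 alpha) inner_cut outer_cut] the energy identity reads:
    [chi' en_p - chi en_q - chi en_n] has integral 0. Here [en_q] is the loss at the curve and
    [en_n] the loss at the outer front; the factor [r^(2 alpha)] absorbs the geometric term
    [2 alpha w / r]. *)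
Definition en_p (t r : R) : R := / 2 * (weight r * (inner_cut t r * outer_cut t r) * density t r).
Definition en_q (t r : R) : R := outflow t r * outer_cut t r * kern dl (r - curve rhat t).
Definition en_n (t r : R) : R :=
  weight r * (inner_cut t r * bump (r2 - c1 * t - r - 1)) * (/ 2 * (c1 * density t r) - momentum t r).

Lemma C1_inner_cut t r : 0 < t < T ->
  C1_at inner_cut (fun t r => kern dl (r - curve rhat t) * - c (clamp u t (curve rhat t)))
    (fun t r => kern dl (r - curve rhat t)) t r.
Proof using Hc Hc0 Hcb Hr0 HT Hs Hchar Hdl.
intros Ht.
assert (A := C1_at_snd (fun r => r) (fun _ => 1) t r ltac:(auto_derive; trivial) (continuous_const _ _)).
assert (B := C1_at_fst (curve rhat) (fun t => c (clamp u t (curve rhat t))) t r).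
cbv beta in B; rewrite clamp_pos in B by lra.
assert (C := C1_at_sub _ _ _ _ _ _ t r A (B (curve_derive c r0 T u rhat Hchar t ltac:(lra))
  (speed_continuous d c c0 c1 r0 T u ut ur rhat Hc Hc0 Hcb Hr0 HT Hs Hchar t ltac:(lra)))).
assert (D : forall y, is_derive (fun y => step (y / dl)) y (kern dl y)).
{ intros y; unfold kern, Rdiv at 2.
  apply (is_derive_comp_R step (fun y => y / dl)); [ apply step_derive | ].
  auto_derive; trivial; field; lra. }
refine (C1_at_ext _ _ _ _ _ t r
  (C1_at_comp (fun y => step (y / dl)) (kern dl) _ _ _ t r D (kern_continuous dl Hdl) C) _ _);
  intros; ring.
Qed.

Lemma C1_outer_cut t r :
  C1_at outer_cut (fun t r => bump (r2 - c1 * t - r - 1) * - c1)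
    (fun t r => bump (r2 - c1 * t - r - 1) * - (1)) t r.
Proof using.
assert (A := C1_at_snd (fun r => r + 1) (fun _ => 1) t r ltac:(auto_derive; trivial) (continuous_const _ _)).
assert (B := C1_at_fst (fun t => r2 - c1 * t) (fun _ => - c1) t r
  ltac:(auto_derive; trivial; ring) (continuous_const _ _)).
assert (C := C1_at_sub _ _ _ _ _ _ t r B A).
assert (C' := C1_at_comp step bump _ _ _ t r step_derive bump_continuous C); cbv beta in C'.
assert (E : forall t r, r2 - c1 * t - (r + 1) = r2 - c1 * t - r - 1) by (intros; ring).
destruct C' as [[F1 [F2 F3]] [F4 F5]].
split; [ repeat split | split ].
- refine (continuity_2d_pt_ext _ _ _ _ _ F1); intros; unfold outer_cut; rewrite E; trivial.
- refine (continuity_2d_pt_ext _ _ _ _ _ F2); intros; rewrite E; ring.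
- refine (continuity_2d_pt_ext _ _ _ _ _ F3); intros; rewrite E; ring.
- rewrite E, Rminus_0_r in F4; refine (is_derive_ext _ _ _ _ _ F4).
  intros s; unfold outer_cut; eqR; rewrite E; trivial.
- rewrite E in F5; replace (bump (r2 - c1 * t - r - 1) * - (1))
    with (bump (r2 - c1 * t - r - 1) * (0 - 1)) by ring; refine (is_derive_ext _ _ _ _ _ F5).
  intros s; unfold outer_cut; eqR; rewrite E; trivial.
Qed.

Lemma strip_inner_cut : strip (-1) hi inner_cut.
Proof using HT Hchar Hhi.
intros t r Ht Hr; apply (continuity_2d_pt_comp1 step (fun t r => (r - curve rhat t) / dl)).
- exact (derive_continuous _ _ _ (step_derive _)).
- apply continuity_2d_pt_mult; [ | c2d ].
  apply continuity_2d_pt_minus; [ c2d | apply continuity_2d_pt_fst ].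
  apply (curve_continuous c r0 T u); trivial; lra.
Qed.

Lemma strip_outer_cut : strip (-1) hi outer_cut.
Proof using. intros t r _ _; apply (C1_outer_cut t r). Qed.

Lemma strip_outer_bump : strip (-1) hi (fun t r => bump (r2 - c1 * t - r - 1)).
Proof using.
intros t r _ _; apply (continuity_2d_pt_comp1 bump (fun t r => r2 - c1 * t - r - 1)).
- apply bump_continuous.
- c2d.
Qed.

Lemma strip_en_p : strip (-1) hi en_p.
Proof using All.
assert (S1 := strip_inner_cut); assert (S2 := strip_outer_cut); assert (S3 := strip_weight (-1) hi).
assert (S4 := strip_sub _ _ (-1) hi _ strip_density (Rle_refl _) (proj2 Hhi)).
intros t r Ht Hr; unfold en_p; c2d.
Qed.

Lemma strip_en_q : strip (-1) hi en_q.
Proof using All.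
assert (S2 := strip_outer_cut).
assert (S3 := strip_sub _ _ (-1) hi _ strip_outflow (Rle_refl _) (proj2 Hhi)).
assert (S4 := strip_kern c r0 T u rhat HT Hchar dl hi Hdl Hhi).
intros t r Ht Hr; unfold en_q; c2d.
Qed.

Lemma strip_en_n : strip (-1) hi en_n.
Proof using All.
assert (S1 := strip_inner_cut); assert (S2 := strip_outer_bump); assert (S3 := strip_weight (-1) hi).
assert (S4 := strip_sub _ _ (-1) hi _ strip_density (Rle_refl _) (proj2 Hhi)).
assert (S5 := strip_sub _ _ (-1) hi _ strip_momentum (Rle_refl _) (proj2 Hhi)).
intros t r Ht Hr; unfold en_n; c2d.
Qed.

Lemma en_n_nonneg t r : 0 <= en_n t r.
Proof using Hc0 Hcb.
unfold en_n, inner_cut; apply Rmult_le_pos; [ apply Rmult_le_pos | ].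
- apply Rlt_le, Rpower_pos.
- apply Rmult_le_pos; [ apply step_bounds | apply bump_nonneg ].
- generalize (momentum_le t r); lra.
Qed.

Lemma en_weak (chi chi' : R -> R) (t1 t2 a1 a2 : R) :
  0 < t1 < a1 -> a1 <= a2 < t2 -> t2 < hi ->
  (forall t, is_derive chi t (chi' t)) -> (forall t, continuous chi' t) ->
  (forall t, 0 <= chi t) ->
  (forall t, ~ (a1 <= t <= a2) -> chi t = 0 /\ chi' t = 0) ->
  RInt (fun t => chi t * RInt (fun r => en_q t r) r1 r2) t1 t2
  <= RInt (fun t => chi' t * RInt (fun r => en_p t r) r1 r2) t1 t2.
Proof using All.
intros Ht1 Ht2 Ht2h Dchi Cchi' Pchi Zchi.
assert (Hc1 : 0 < c1) by (generalize (Hcb 0); lra).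
assert (Ha1 : 0 < c1 * a1) by (apply Rmult_lt_0_compat; lra).
assert (Ha1h : c1 * a1 < c1 * hi) by (apply Rmult_lt_compat_l; lra).
assert (Sp := strip_en_p); assert (Sq := strip_en_q); assert (Sn := strip_en_n).
rewrite !(DI_factor (-1) hi); trivial; try lra.
assert (Sk : forall F, strip (-1) hi F -> strip (-1) hi (fun t r => chi t * F t r)).
{ intros F HF t r Ht Hr; apply continuity_2d_pt_mult; [ | apply HF; trivial ].
  apply continuity_2d_pt_fst, (derive_continuous _ _ _ (Dchi t)). }
assert (Sk' : forall F, strip (-1) hi F -> strip (-1) hi (fun t r => chi' t * F t r)).
{ intros F HF t r Ht Hr; apply continuity_2d_pt_mult; [ | apply HF; trivial ].
  apply continuity_2d_pt_fst; trivial. }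
(* The placeholder lets unification read the two partial derivatives of the weight off the product
   rule. *)
assert (Hw : forall t r, 0 < t < T -> 0 < r -> _) by exact (fun t r Ht Hr =>
  C1_at_mult _ _ _ _ _ _ t r (C1_at_fst chi chi' t r (Dchi t) (Cchi' t))
    (C1_at_mult _ _ _ _ _ _ t r (C1_Rpower (2 * alpha d) t r Hr)
      (C1_at_mult _ _ _ _ _ _ t r (C1_inner_cut t r Ht) (C1_outer_cut t r)))).
assert (E := energy_identity d c T u ut ur Hc Hs t1 t2 r1 r2 a1 a2 (r0 - dl) (r2 - c1 * a1) _ _ _
  Ht1 Ht2 ltac:(lra) ltac:(lra) ltac:(lra) Hw).
cbv beta in E; clear Hw.
apply Rminus_le_0; rewrite <- (DI_minus (-1) hi); auto; try lra.
match type of E with _ -> ?A = 0 => assert (E0 : A = 0) end.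
{ apply E; intros t r Hn; clear E.
  destruct (classic (a1 <= t <= a2)) as [Ha | Ha].
  2:{ destruct (Zchi t Ha) as [Z1 Z2]; rewrite Z1, Z2; repeat split; ring. }
  destruct (Rlt_or_le r (r0 - dl)) as [Hr | Hr].
  - assert (Hb := curve_bounds c c0 c1 r0 T u rhat Hc0 Hcb Hr0 HT Hchar t ltac:(lra)).
    destruct (kern_outside dl Hdl (r - curve rhat t)) as [K1 K2]; [ lra | ].
    unfold inner_cut; rewrite (step_scaled_left dl (curve rhat t) r Hdl ltac:(lra)), K1.
    repeat split; ring.
  - assert (Hr' : r2 - c1 * a1 < r) by (apply Rnot_le_lt; intros H; apply Hn; lra).
    assert (c1 * a1 <= c1 * t) by (apply Rmult_le_compat_l; lra).
    unfold outer_cut; rewrite (step_left (r2 - c1 * t - r - 1)) by lra.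
    rewrite (proj1 (bump_outside (r2 - c1 * t - r - 1) ltac:(lra))).
    repeat split; ring. }
apply Rle_trans with (DI t1 t2 r1 r2 (fun t r => chi t * en_n t r)).
{ apply (DI_nonneg (-1) hi); auto; try lra.
  intros t r _ _; apply Rmult_le_pos; [ apply Pchi | apply en_n_nonneg ]. }
right; apply Rminus_diag_uniq_sym.
rewrite <- (DI_minus (-1) hi); auto; try lra.
- eapply eq_trans; [ | exact E0 ].
  apply DI_ext; try lra; intros t r Ht Hr.
  unfold en_p, en_q, en_n, outflow, density, momentum, vr; rewrite !clamp_pos by lra.
  fold (weight r); field; lra.
- exact (fun t r Ht Hr => continuity_2d_pt_minus _ _ t r (Sk' _ Sp t r Ht Hr) (Sk _ Sq t r Ht Hr)).
Qed.

Lemma en_decrease b : 0 < b < hi ->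
  RInt (fun r => en_p b r) r1 r2 + RInt (fun t => RInt (fun r => en_q t r) r1 r2) 0 b
  <= RInt (fun r => en_p 0 r) r1 r2.
Proof using All.
intros Hb.
assert (Hc1 : 0 < c1 * hi) by (apply Rmult_lt_0_compat; [ generalize (Hcb 0) | ]; lra).
apply (weak_decrease_at_0 hi (fun t => RInt (fun r => en_p t r) r1 r2)
  (fun t => RInt (fun r => en_q t r) r1 r2)); trivial.
- intros t Ht; apply (inner_continuous (-1) hi); trivial; [ apply strip_en_p | lra ].
- intros t Ht; apply (inner_continuous (-1) hi); trivial; [ apply strip_en_q | lra ].
- exact en_weak.
Qed.

End Regularized.

Definition char_R (t : R) : R :=
  Rpower (curve rhat t) (alpha d)
  * (clamp ut t (curve rhat t) + vr c (clamp u) (clamp ur) t (curve rhat t)).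

Lemma outflow_curve t :
  outflow t (curve rhat t) = / 2 * (c (clamp u t (curve rhat t)) * char_R t ^ 2).
Proof using.
unfold outflow, density, momentum, char_R, weight.
replace (2 * alpha d) with (alpha d + alpha d) by ring; rewrite Rpower_plus; field.
Qed.

(** Up to time [b] both the curve and the front travel at most [c1 b]; the margin 3 pays for the
    front width 2 and a kernel radius of at most 1/2, so the outer cutoff is 1 wherever the kernel
    lives. The energy left at time [b] is nonnegative and is dropped, then the kernel width tends to
    0. *)
Lemma energy_along (b r1 r2 : R) : 0 < b < T -> 0 < r1 < r0 -> r0 + 2 * c1 * b + 3 <= r2 ->
  RInt (fun t => outflow t (curve rhat t)) 0 b
  <= / 2 * RInt (fun r => weight r * density 0 r) r1 r2.
Proof using All.
intros Hb Hr1 Hr2.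
assert (Hc1 : 0 < c1 * b) by (apply Rmult_lt_0_compat; [ generalize (Hcb 0) | ]; lra).
(* The weak inequality needs an open time interval reaching beyond [b]; [hi <= 2 * b] keeps the
   travel of the front within [2 c1 b], as [r2] allows. *)
set (hi := Rmin T (2 * b)).
assert (Hhi : b < hi /\ hi <= T /\ hi <= 2 * b)
  by (split; [ apply Rmin_case; lra | split; [ apply Rmin_l | apply Rmin_r ] ]).
assert (Hchi : c1 * hi <= 2 * (c1 * b)) by (generalize (Hcb 0); nra).
assert (Hcv : forall t, 0 <= t <= b -> r0 <= curve rhat t <= r0 + c1 * b).
{ intros t Ht; assert (H := curve_bounds c c0 c1 r0 T u rhat Hc0 Hcb Hr0 HT Hchar t ltac:(lra)).
  rewrite Rmax_right in H by lra; generalize (Hcb 0); nra. }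
set (m := Rmin ((r0 - r1) / 2) (/ 2)).
assert (Hm : 0 < m /\ m <= (r0 - r1) / 2 /\ m <= / 2)
  by (split; [ apply Rmin_case; lra | split; [ apply Rmin_l | apply Rmin_r ] ]).
assert (So := strip_outflow).
assert (EO : ex_RInt (fun t => outflow t (curve rhat t)) 0 b).
{ apply ex_RInt_cont; [ lra | intros t Ht ].
  apply (continuous_subst outflow _ (-1) T); trivial; try lra; [ specialize (Hcv t ltac:(lra)); lra | ].
  apply (curve_continuous c r0 T u); trivial; lra. }
apply le_epsilon; intros e' He'.
set (e := e' / b).
assert (He : 0 < e) by (apply Rdiv_lt_0_compat; lra).
destruct (tube_near (-1) T 0 b r1 r2 m e outflow (curve rhat) So) as [dl [D1 [D2 D3]]];
  trivial; try lra.
{ intros t Ht; specialize (Hcv t Ht); lra. }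
assert (K := en_decrease dl r1 r2 hi D1 ltac:(lra) ltac:(lra) ltac:(lra) ltac:(lra) b ltac:(lra)).
assert (Sp := strip_en_p dl r1 r2 hi D1 ltac:(lra) ltac:(lra) ltac:(lra) ltac:(lra)).
assert (Sq := strip_en_q dl r1 r2 hi D1 ltac:(lra) ltac:(lra) ltac:(lra) ltac:(lra)).
assert (P_pos : forall t r, 0 <= en_p dl r2 t r).
{ intros t r; unfold en_p, inner_cut, outer_cut.
  apply Rmult_le_pos; [ lra | ]; apply Rmult_le_pos; [ | apply density_nonneg ].
  apply Rmult_le_pos; [ apply Rlt_le, Rpower_pos | ].
  apply Rmult_le_pos; apply step_bounds. }
assert (Pb : 0 <= RInt (fun r => en_p dl r2 b r) r1 r2).
{ apply RInt_ge_0; [ lra | apply (ex_inner (-1) hi); trivial; lra | auto ]. }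
assert (P0 : RInt (fun r => en_p dl r2 0 r) r1 r2 <= / 2 * RInt (fun r => weight r * density 0 r) r1 r2).
{ assert (EW : ex_RInt (fun r => weight r * density 0 r) r1 r2).
  { apply ex_RInt_cont; [ lra | intros r Hr; apply continuous_mult_R ].
    - apply Rpower_continuous; lra.
    - apply (continuity_2d_pt_slice density), strip_density; lra. }
  rewrite <- RInt_scal_R by trivial.
  apply RInt_le; [ lra | apply (ex_inner (-1) hi); trivial; lra | apply (ex_RInt_scal (V := R_NormedModule)); trivial | ].
  intros r Hr; unfold en_p, inner_cut, outer_cut.
  assert (B1 := step_bounds ((r - curve rhat 0) / dl)); assert (B2 := step_bounds (r2 - c1 * 0 - r - 1)).
  set (x := step ((r - curve rhat 0) / dl)) in *; set (y := step (r2 - c1 * 0 - r - 1)) in *.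
  assert (Hxy : x * y <= 1) by nra.
  assert (HW : 0 <= weight r * density 0 r)
    by (apply Rmult_le_pos; [ apply Rlt_le, Rpower_pos | apply density_nonneg ]).
  assert (weight r * density 0 r * (x * y) <= weight r * density 0 r * 1)
    by (apply Rmult_le_compat_l; trivial).
  lra. }
assert (HQ : forall t, 0 <= t <= b ->
  Rabs (RInt (fun r => en_q dl r2 t r) r1 r2 - outflow t (curve rhat t)) <= e).
{ intros t Ht; specialize (Hcv t Ht).
  rewrite (RInt_ext_le _ (fun r => outflow t r * kern dl (r - curve rhat t))); [ | lra | ].
  2:{ intros r Hr; unfold en_q.
      destruct (classic (- dl < r - curve rhat t < dl)) as [Hin | Hout].
      - unfold outer_cut; rewrite step_right; [ ring | ].
        assert (c1 * t <= c1 * b) by (apply Rmult_le_compat_l; [ generalize (Hcb 0) | ]; lra); lra.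
      - rewrite (proj1 (kern_outside dl D1 _ Hout)); ring. }
  apply (kern_average dl D1); try lra; [ | intros r Hr; apply D3; trivial ].
  intros r Hr; apply (continuity_2d_pt_slice outflow), So; lra. }
assert (EQ : ex_RInt (fun t => RInt (fun r => en_q dl r2 t r) r1 r2) 0 b).
{ apply ex_RInt_cont; [ lra | intros; apply (inner_continuous (-1) hi); trivial; lra ]. }
assert (BI : Rabs (RInt (fun t => RInt (fun r => en_q dl r2 t r) r1 r2 - outflow t (curve rhat t)) 0 b)
  <= (b - 0) * e).
{ apply abs_RInt_le_const; [ lra | | auto ].
  apply (ex_RInt_minus (V := R_NormedModule)); trivial. }
rewrite RInt_minus_R in BI by trivial.
assert (Ee : (b - 0) * e = e') by (unfold e; field; lra).
rewrite Ee in BI; apply Rabs_le_between in BI; lra.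
Qed.

End Energy.

(** * Existence of characteristics *)

Lemma cancel_l (x a b : R) : x + a - (x + b) = a - b.
Proof. ring. Qed.

Section Picard.
Context (f : R -> R -> R) (x0 L B : R) (HL : 0 < L) (HB : 0 < B).
Context (Cf : forall t x, continuity_2d_pt f t x)
  (Lf : forall t x y, Rabs (f t x - f t y) <= L * Rabs (x - y))
  (Bf : forall t x, Rabs (f t x) <= B).

Fixpoint picard_iter (n : nat) (t : R) : R :=
  match n with
  | O => x0
  | S n => x0 + RInt (fun s => f s (picard_iter n s)) 0 (Rmax 0 t)
  end.

Lemma continuous_along (X : R -> R) t : continuous X t -> continuous (fun s => f s (X s)) t.
Proof using Cf.
intros H; apply (continuous_slice2 f (fun t => t) X); trivial; apply continuous_id.
Qed.

Lemma picard_continuous n t : continuous (picard_iter n) t.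
Proof using Cf.
revert t; induction n as [ | n IH ]; intros t; [ apply continuous_const | ].
apply (continuous_plus_R (fun _ => x0) (fun t => RInt (fun s => f s (picard_iter n s)) 0 (Rmax 0 t)));
  [ apply continuous_const | ].
apply (continuous_comp (Rmax 0) (fun t => RInt (fun s => f s (picard_iter n s)) 0 t));
  [ apply continuous_Rmax0 | ].
exact (derive_continuous _ _ _ (FTC_derive_R (fun s => f s (picard_iter n s)) 0 _
  (fun x => continuous_along _ x (IH x)))).
Qed.

Lemma ex_along (X : R -> R) (a b : R) : a <= b -> (forall s, a <= s <= b -> continuous X s) ->
  ex_RInt (fun s => f s (X s)) a b.
Proof using Cf. intros Hab H; apply ex_RInt_cont; trivial; intros; apply continuous_along; auto. Qed.

Lemma RInt_along_close (X Y : R -> R) (D : R -> R) (t : R) : 0 <= t ->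
  (forall s, continuous X s) -> (forall s, continuous Y s) -> (forall s, continuous D s) ->
  (forall s, 0 <= s <= t -> Rabs (X s - Y s) <= D s) ->
  Rabs (RInt (fun s => f s (X s)) 0 t - RInt (fun s => f s (Y s)) 0 t)
  <= RInt (fun s => L * D s) 0 t.
Proof using Cf Lf HL.
intros Ht CX CY CD H.
assert (EX := ex_along X 0 t Ht (fun s _ => CX s)); assert (EY := ex_along Y 0 t Ht (fun s _ => CY s)).
rewrite <- RInt_minus_R by trivial.
apply RInt_abs_le; trivial.
- apply (ex_RInt_minus (V := R_NormedModule)); trivial.
- apply ex_RInt_cont; trivial; intros s _; apply (continuous_scal_r (K := R_AbsRing) L D), CD.
- intros s Hs; eapply Rle_trans; [ apply Lf | ].
  apply Rmult_le_compat_l; [ lra | apply H; lra ].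
Qed.

(** Distances are measured against [exp (2 L t)]: as [L exp (2 L s)] integrates over [[0, t]] to
    less than [exp (2 L t) / 2], every iteration halves them on the whole half-line at once. The
    first step is at most [t B = B / (2 L) * (2 L t)], and [2 L t <= exp (2 L t)]. *)
Lemma picard_step n t : 0 <= t ->
  Rabs (picard_iter (S n) t - picard_iter n t) <= B / (2 * L) * (/ 2) ^ n * exp (2 * L * t).
Proof using All.
revert t; induction n as [ | n IH ]; intros t Ht.
- simpl; rewrite Rmax_right by trivial.
  rewrite Rplus_minus_l.
  apply Rle_trans with ((t - 0) * B).
  + apply abs_RInt_le_const; trivial.
    apply (ex_along (fun _ => x0)); trivial; intros; apply continuous_const.
  + assert (H := exp_ineq1_le (2 * L * t)).
    assert (HBL : 0 < B / (2 * L)) by (apply Rdiv_lt_0_compat; lra).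
    replace ((t - 0) * B) with (B / (2 * L) * (2 * L * t)) by (field; lra).
    rewrite Rmult_1_r; apply Rmult_le_compat_l; lra.
- change (Rabs (x0 + RInt (fun s => f s (picard_iter (S n) s)) 0 (Rmax 0 t)
    - (x0 + RInt (fun s => f s (picard_iter n s)) 0 (Rmax 0 t)))
    <= B / (2 * L) * (/ 2) ^ S n * exp (2 * L * t)).
  rewrite Rmax_right by trivial.
  set (k := B / (2 * L) * (/ 2) ^ n).
  assert (Hk : 0 < k).
  { apply Rmult_lt_0_compat; [ apply Rdiv_lt_0_compat; lra | apply pow_lt; lra ]. }
  assert (De : forall s, is_derive (fun s => k / 2 * exp (2 * L * s)) s (L * (k * exp (2 * L * s)))).
  { intros s; auto_derive; trivial; field. }
  assert (Ce : forall s, continuous (fun s => k * exp (2 * L * s)) s).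
  { intros s; apply (derive_continuous _ _ (k * (2 * L * exp (2 * L * s)))); auto_derive; trivial; ring. }
  rewrite cancel_l.
  eapply Rle_trans.
  { apply (RInt_along_close _ _ (fun s => k * exp (2 * L * s))); trivial;
      try (intros; apply picard_continuous).
    intros s Hs; apply IH; lra. }
  rewrite (RInt_FTC (fun s => k / 2 * exp (2 * L * s))); trivial.
  + rewrite Rmult_0_r, exp_0, <- tech_pow_Rmult.
    replace (B / (2 * L) * (/ 2 * (/ 2) ^ n)) with (k / 2) by (unfold k; field; lra).
    change (k / 2 * exp (2 * L * t) - k / 2 * 1 <= k / 2 * exp (2 * L * t)); lra.
  + intros; apply (continuous_scal_r (K := R_AbsRing) L (fun s => k * exp (2 * L * s))), Ce.
Qed.

(** The factor [2 (1 - (/ 2) ^ p)] is the exact sum of the first [p] powers of 1/2; keeping it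
    instead of 2 is what closes the induction on [p]. *)
Lemma picard_cauchy n p t : 0 <= t ->
  Rabs (picard_iter (n + p) t - picard_iter n t)
  <= 2 * (B / (2 * L) * (/ 2) ^ n * exp (2 * L * t)) * (1 - (/ 2) ^ p).
Proof using All.
intros Ht; induction p as [ | p IH ].
- rewrite Nat.add_0_r, Rminus_diag, Rabs_R0; simpl; rewrite Rminus_diag, Rmult_0_r; lra.
- rewrite Nat.add_succ_r.
  assert (H := picard_step (n + p) t Ht).
  replace (picard_iter (S (n + p)) t - picard_iter n t)
    with ((picard_iter (S (n + p)) t - picard_iter (n + p) t)
      + (picard_iter (n + p) t - picard_iter n t)) by ring.
  eapply Rle_trans; [ apply Rabs_triang | ].
  rewrite pow_add in H; rewrite <- tech_pow_Rmult.
  set (k := B / (2 * L)) in *; set (x := (/ 2) ^ n) in *; set (y := (/ 2) ^ p) in *.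
  set (e := exp (2 * L * t)) in *; lra.
Qed.

Lemma half_pow_small (k e : R) : 0 < e -> exists n, k * (/ 2) ^ n < e.
Proof using.
intros He.
assert (H := is_lim_seq_scal_l _ k _ (is_lim_seq_geom (/ 2) ltac:(rewrite Rabs_pos_eq; lra))).
simpl in H; rewrite Rmult_0_r in H; apply is_lim_seq_spec in H.
destruct (H (mkposreal e He)) as [N HN]; exists N; specialize (HN N (le_n N)); simpl in HN.
rewrite Rminus_0_r in HN; apply Rabs_def2 in HN; lra.
Qed.

Definition picard_lim (t : R) : R := real (Lim_seq (fun n => picard_iter n (Rmax 0 t))).

Lemma picard_lim_correct t : is_lim_seq (fun n => picard_iter n (Rmax 0 t)) (picard_lim t).
Proof using All.
apply Lim_seq_correct', ex_lim_seq_cauchy_corr; intros e.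
set (s := Rmax 0 t); assert (Hs : 0 <= s) by apply Rmax_l.
set (k := 2 * (B / (2 * L) * exp (2 * L * s))).
destruct (half_pow_small (2 * k) e (cond_pos e)) as [N HN]; exists N.
assert (HBL : 0 < B / (2 * L)) by (apply Rdiv_lt_0_compat; lra).
assert (H : forall n, (N <= n)%nat -> Rabs (picard_iter n s - picard_iter N s) <= k * (/ 2) ^ N).
{ intros n Hn; replace n with (N + (n - N))%nat by lia.
  eapply Rle_trans; [ apply picard_cauchy; trivial | ].
  set (p := (n - N)%nat).
  assert (P1 : 0 < (/ 2) ^ N) by (apply pow_lt; lra).
  assert (P2 : 0 < (/ 2) ^ p) by (apply pow_lt; lra).
  assert (P3 : 0 < k) by (unfold k; generalize (Rmult_lt_0_compat _ _ HBL (exp_pos (2 * L * s))); lra).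
  replace (2 * (B / (2 * L) * (/ 2) ^ N * exp (2 * L * s)) * (1 - (/ 2) ^ p))
    with (k * (/ 2) ^ N * (1 - (/ 2) ^ p)) by (unfold k; ring).
  assert (0 < k * (/ 2) ^ N) by (apply Rmult_lt_0_compat; trivial).
  nra. }
intros n m Hn Hm.
replace (picard_iter n s - picard_iter m s)
  with ((picard_iter n s - picard_iter N s) - (picard_iter m s - picard_iter N s)) by ring.
assert (H1 := H n Hn); assert (H2 := H m Hm).
apply Rabs_le_between in H1; apply Rabs_le_between in H2; apply Rabs_def1; lra.
Qed.

Lemma picard_lim_close n t : 0 <= t ->
  Rabs (picard_lim t - picard_iter n t) <= 2 * (B / (2 * L) * exp (2 * L * t)) * (/ 2) ^ n.
Proof using All.
intros Ht; assert (H := picard_lim_correct t); rewrite Rmax_right in H by trivial.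
assert (HBL : 0 < B / (2 * L)) by (apply Rdiv_lt_0_compat; lra).
apply (is_lim_seq_incr_n _ n) in H.
assert (H1 := is_lim_seq_minus' _ _ _ _ H (is_lim_seq_const (picard_iter n t))).
apply is_lim_seq_abs in H1.
refine (is_lim_seq_le _ _ _ _ _ H1 (is_lim_seq_const _)).
intros p; rewrite Nat.add_comm; eapply Rle_trans; [ apply picard_cauchy; trivial | ].
assert (P1 : 0 < (/ 2) ^ n) by (apply pow_lt; lra).
assert (P2 : 0 < (/ 2) ^ p) by (apply pow_lt; lra).
assert (P3 := Rmult_lt_0_compat _ _ HBL (exp_pos (2 * L * t))).
assert (P4 := Rmult_lt_0_compat _ _ P3 P1).
nra.
Qed.

Lemma picard_lipschitz n s t : 0 <= s <= t -> Rabs (picard_iter n t - picard_iter n s) <= B * (t - s).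
Proof using Cf Bf HB.
intros Hst; destruct n as [ | n ]; simpl.
- rewrite Rminus_diag, Rabs_R0; apply Rmult_le_pos; lra.
- rewrite !Rmax_right by lra.
  assert (E : forall a b, a <= b -> ex_RInt (fun s => f s (picard_iter n s)) a b)
    by (intros; apply ex_along; trivial; intros; apply picard_continuous).
  rewrite <- (RInt_Chasles _ 0 s t) by (apply E; lra).
  unfold plus; simpl.
  rewrite cancel_l, Rplus_minus_l.
  rewrite Rmult_comm; apply abs_RInt_le_const; [ lra | apply E; lra | intros; apply Bf ].
Qed.

Lemma picard_lim_lipschitz s t : Rabs (picard_lim t - picard_lim s) <= B * Rabs (t - s).
Proof using All.
assert (H1 := is_lim_seq_minus' _ _ _ _ (picard_lim_correct t) (picard_lim_correct s)).
apply is_lim_seq_abs in H1.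
refine (is_lim_seq_le _ _ _ _ _ H1 (is_lim_seq_const _)).
intros n; apply Rle_trans with (B * Rabs (Rmax 0 t - Rmax 0 s)).
- destruct (Rle_or_lt (Rmax 0 s) (Rmax 0 t)).
  + rewrite (Rabs_pos_eq (_ - Rmax 0 s)) by lra; apply picard_lipschitz; split; trivial; apply Rmax_l.
  + rewrite Rabs_minus_sym, (Rabs_minus_sym (Rmax 0 t)), (Rabs_pos_eq (Rmax 0 s - _)) by lra.
    apply picard_lipschitz; split; [ apply Rmax_l | lra ].
- apply Rmult_le_compat_l; [ lra | ].
  unfold Rabs, Rmax; repeat destruct Rcase_abs; repeat destruct Rle_dec; lra.
Qed.

Lemma picard_lim_continuous t : continuous picard_lim t.
Proof using All.
apply filterlim_locally; intros e.
assert (Hd : 0 < e / B) by (apply Rdiv_lt_0_compat; [ apply cond_pos | trivial ]).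
exists (mkposreal _ Hd); intros s Hs; change (Rabs (s - t) < e / B) in Hs.
change (Rabs (picard_lim s - picard_lim t) < e).
eapply Rle_lt_trans; [ apply picard_lim_lipschitz | ].
apply (Rmult_lt_compat_l B) in Hs; trivial.
replace (B * (e / B)) with (pos e) in Hs by (field; lra); trivial.
Qed.

(** Both sides are compared with the iterate [S n]. The left side differs from it by at most
    [k / 2^n], and the integrals differ by at most [t L k / 2^n] by the Lipschitz bound, so any
    [e > 0] is beaten for some [n]. *)
Lemma picard_lim_eq t : 0 <= t ->
  picard_lim t = x0 + RInt (fun s => f s (picard_lim s)) 0 t.
Proof using All.
intros Ht; apply cond_eq; intros e He.
assert (HBL : 0 < B / (2 * L)) by (apply Rdiv_lt_0_compat; lra).
set (k := 2 * (B / (2 * L) * exp (2 * L * t))).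
assert (Hk : 0 < k) by (unfold k; generalize (Rmult_lt_0_compat _ _ HBL (exp_pos (2 * L * t))); lra).
destruct (half_pow_small (k + t * L * k) e He) as [n Hn].
assert (H1 := picard_lim_close (S n) t Ht); fold k in H1.
simpl picard_iter in H1; rewrite Rmax_right in H1 by trivial.
assert (P : 0 < (/ 2) ^ n) by (apply pow_lt; lra).
assert (H2 : Rabs (RInt (fun s => f s (picard_iter n s)) 0 t - RInt (fun s => f s (picard_lim s)) 0 t)
  <= RInt (fun s => L * (k * (/ 2) ^ n)) 0 t).
{ apply (RInt_along_close _ _ (fun _ => k * (/ 2) ^ n)); trivial.
  - intros; apply picard_continuous.
  - intros; apply picard_lim_continuous.
  - intros; apply continuous_const.
  - intros s Hs; rewrite Rabs_minus_sym; eapply Rle_trans; [ apply picard_lim_close; lra | ].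
    apply Rmult_le_compat_r; [ lra | ]; unfold k.
    apply Rmult_le_compat_l; [ lra | apply Rmult_le_compat_l; [ lra | ] ].
    destruct (Rle_lt_or_eq_dec s t (proj2 Hs)) as [Hlt | ->]; [ | lra ].
    apply Rlt_le, exp_increasing, Rmult_lt_compat_l; lra. }
rewrite RInt_const_R, Rminus_0_r in H2.
rewrite <- tech_pow_Rmult in H1.
assert (0 < k * (/ 2) ^ n) by (apply Rmult_lt_0_compat; trivial).
apply Rabs_le_between in H1; apply Rabs_le_between in H2; apply Rabs_def1; lra.
Qed.

Lemma picard_exists : exists X : R -> R,
  X 0 = x0 /\ (forall t, continuous X t) /\ (forall t, 0 < t -> is_derive X t (f t (X t))).
Proof using All.
exists picard_lim; split; [ | split ].
- rewrite picard_lim_eq, RInt_point by lra; apply Rplus_0_r.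
- apply picard_lim_continuous.
- intros t Ht.
  apply (is_derive_ext_interval (fun t => x0 + RInt (fun s => f s (picard_lim s)) 0 t) _ 0 (t + 1)); try lra.
  { intros s Hs; symmetry; apply picard_lim_eq; lra. }
  assert (D := FTC_derive_R (fun s => f s (picard_lim s)) 0 t
    (fun x => continuous_along _ x (picard_lim_continuous x))).
  assert (E := is_derive_plus _ _ t _ _ (is_derive_const (K := R_AbsRing) (V := R_NormedModule) x0 t) D).
  rewrite <- (Rplus_0_l (f t (picard_lim t))); exact E.
Qed.

End Picard.

(** The speed [c(u)] is frozen outside the box [[0, b] x [r0, r0 + c1 b]]. Inside, its
    [r]-derivative [c' u_r] is continuous and hence bounded, which gives a global Lipschitz
    constant. A trajectory of the truncated equation has speed in [[c0, c1]], so it stays in the box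
    up to time [b] and solves the true equation. The condition [b < T] keeps this compact box inside
    the domain. *)
Lemma characteristic_exists (d : nat) (c : R -> R) (c0 c1 r0 T b : R) (u ut ur : R -> R -> R) :
  Cn 1 c -> 0 < c0 -> (forall x, c0 <= c x <= c1) -> 0 < r0 -> solution d c T u ut ur ->
  0 < b < T -> exists rhat, characteristic c r0 b u rhat.
Proof.
intros Hc Hc0 Hcb Hr0 Hs Hb.
assert (HT : 0 < T) by lra.
assert (Hc1 : 0 < c1) by (generalize (Hcb 0); lra).
set (rm := r0 + c1 * b).
assert (Hrm : r0 < rm) by (unfold rm; generalize (Rmult_lt_0_compat _ _ Hc1 (proj1 Hb)); lra).
assert (Scu := strip_clamp_cu d c T u ut ur Hc HT Hs).
assert (Sc'u := strip_clamp_c'u d c T u ut ur Hc HT Hs).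
assert (Sur := strip_clamp_ur d c T u ut ur HT Hs).
destruct (box_bounded (fun t r => Derive c (clamp u t r) * clamp ur t r) 0 b r0 rm)
  as [L [HL BL]]; try lra; [ intros t r Ht Hr; c2d | ].
set (tc := fun t => Rmax 0 (Rmin b t)); set (rc := fun r => Rmax r0 (Rmin rm r)).
assert (Htc : forall t, 0 <= tc t <= b)
  by (intros t; unfold tc, Rmax, Rmin; repeat destruct Rle_dec; lra).
assert (Hrc : forall r, r0 <= rc r <= rm)
  by (intros r; unfold rc, Rmax, Rmin; repeat destruct Rle_dec; lra).
assert (Lrc : forall x y, Rabs (rc x - rc y) <= Rabs (x - y)).
{ intros x y; unfold rc, Rabs, Rmax, Rmin; repeat destruct Rcase_abs; repeat destruct Rle_dec; lra. }
assert (Ltc : forall x y, Rabs (tc x - tc y) <= Rabs (x - y)).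
{ intros x y; unfold tc, Rabs, Rmax, Rmin; repeat destruct Rcase_abs; repeat destruct Rle_dec; lra. }
assert (C1L : forall (k : R -> R) x, (forall x y, Rabs (k x - k y) <= Rabs (x - y)) -> continuous k x).
{ intros k x Hk; apply filterlim_locally; intros e; exists e; intros y Hy.
  exact (Rle_lt_trans _ _ _ (Hk y x) Hy). }
destruct (picard_exists (fun t r => c (clamp u (tc t) (rc r))) r0 L c1 HL Hc1) as [X [X0 [CX DX]]].
- intros t r; apply (continuity_2d_pt_comp2 (fun t r => c (clamp u t r)) (fun t _ => tc t) (fun _ r => rc r)).
  + apply Scu; [ generalize (Htc t) | generalize (Hrc r) ]; lra.
  + apply continuity_2d_pt_fst, C1L; trivial.
  + apply continuity_2d_pt_snd, C1L; trivial.
- intros t x y; apply Rle_trans with (L * Rabs (rc x - rc y)).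
  2:{ apply Rmult_le_compat_l; [ lra | auto ]. }
  assert (Hx := Hrc x); assert (Hy := Hrc y); assert (Ht := Htc t).
  assert (Hz : forall z, Rmin (rc y) (rc x) <= z <= Rmax (rc y) (rc x) -> r0 <= z <= rm)
    by (intros z; unfold Rmin, Rmax; destruct Rle_dec; lra).
  destruct (MVT_gen (fun r => c (clamp u (tc t) r) - 0) (rc y) (rc x)
    (fun r => Derive c (clamp u (tc t) r) * clamp ur (tc t) r)) as [z [Hz1 Hz2]].
  + intros z Hz'; specialize (Hz z ltac:(lra)).
    apply (clamp_speed_derive d c T u ut ur Hc HT Hs); lra.
  + intros z Hz'; specialize (Hz z Hz'); apply continuity_pt_filterlim.
    apply (derive_continuous _ _ _ (clamp_speed_derive d c T u ut ur Hc HT Hs (tc t) z 0 ltac:(lra) ltac:(lra))).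
  + rewrite !Rminus_0_r in Hz2; rewrite Hz2, Rabs_mult.
    apply Rmult_le_compat_r; [ apply Rabs_pos | apply BL; auto ].
- intros t x; rewrite Rabs_pos_eq; [ apply Hcb | generalize (Hcb (clamp u (tc t) (rc x))); lra ].
- exists X; split; [ trivial | split ].
  + intros t Ht P HP; exact (filter_imp (F := locally t) (fun x => P (X x)) _ (fun x H _ => H) (CX t P HP)).
  + intros t Ht.
    assert (HX : r0 <= X t <= rm).
    { destruct (MVT_gen X 0 t (fun s => c (clamp u (tc s) (rc (X s))))) as [z [Hz1 Hz2]].
      - rewrite Rmin_left, Rmax_right by lra; intros; apply DX; lra.
      - intros; apply continuity_pt_filterlim, CX.
      - rewrite X0 in Hz2; generalize (Hcb (clamp u (tc z) (rc (X z)))); unfold rm; nra. }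
    assert (D := DX t (proj1 Ht)).
    replace (tc t) with t in D by (unfold tc; rewrite Rmin_right, Rmax_right; lra).
    replace (rc (X t)) with (X t) in D by (unfold rc; rewrite Rmin_right, Rmax_right; lra).
    rewrite clamp_pos in D by lra; exact D.
Qed.

(** * Initial data and the Riccati inequality *)

Lemma Cn_2_1 (c : R -> R) : Cn 2 c -> Cn 1 c.
Proof.
intros H x; split; [ intros k Hk; apply (proj1 (H x)); lia | ].
apply (ex_derive_continuous (Derive_n c 1)), (proj1 (H x) 2%nat); lia.
Qed.

Lemma solution_restrict (d : nat) (c : R -> R) (T T' : R) (u ut ur : R -> R -> R) :
  T' <= T -> solution d c T u ut ur -> solution d c T' u ut ur.
Proof.
intros HT [[K1 K2 K3 K4 K5] K].
assert (Hd : forall p, dom T' p -> dom T p) by (unfold dom; intros p; lra).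
split; [ split | ].
- exact (continuous_on_subset _ _ _ Hd K1).
- exact (continuous_on_subset _ _ _ Hd K2).
- exact (continuous_on_subset _ _ _ Hd K3).
- intros; apply K4; lra.
- intros; apply K5; lra.
- intros t1 t2 r1 r2 psi psit psir H1 H2 H3 H4.
  apply (K t1 t2 r1 r2 psi psit psir); trivial; lra.
Qed.

Lemma is_derive_along (T : R) (f ft fr : R -> R -> R) (g : R -> R) (t dg : R) :
  (forall t r, 0 < t < T -> 0 < r -> C1_at f ft fr t r) ->
  0 < t < T -> 0 < g t -> is_derive g t dg ->
  is_derive (fun t => f t (g t)) t (ft t (g t) + fr t (g t) * dg).
Proof.
intros H Ht Hg Dg.
assert (FD : differentiable_pt_lim f t (g t) (ft t (g t)) (fr t (g t))).
{ apply filterdiff_differentiable_pt_lim.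
  apply (is_derive_filterdiff f t (g t) ft (fr t (g t))).
  - apply (locally_2d_locally (fun s z => is_derive (fun y => f y z) s (ft s z))).
    apply (locally_2d_box _ 0 T 0 (g t + 1)); try lra.
    intros s z Hs Hz; apply H; lra.
  - apply H; trivial.
  - apply continuity_2d_pt_filterlim, H; trivial. }
apply is_derive_Reals.
replace (ft t (g t) + fr t (g t) * dg) with (ft t (g t) * 1 + fr t (g t) * dg) by ring.
apply (derivable_pt_lim_comp_2d f (fun t => t) g); trivial.
- apply derivable_pt_lim_id.
- apply is_derive_Reals; trivial.
Qed.

Lemma increment_ge (f f' k : R -> R) (lo hi b : R) : lo < 0 -> 0 < b < hi ->
  (forall t, lo < t < hi -> continuous f t) -> (forall t, lo < t < hi -> continuous k t) ->
  (forall t, 0 < t < b -> is_derive f t (f' t)) -> (forall t, 0 <= t <= b -> k t <= f' t) ->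
  f 0 + RInt k 0 b <= f b.
Proof.
intros Hlo Hb Cf Ck Df Hk.
set (F := fun t => f t - RInt k 0 t).
assert (DK : forall t, lo < t < hi -> is_derive (fun t => RInt k 0 t) t (k t))
  by (intros; apply (FTC_derive k lo hi); trivial; lra).
destruct (MVT_gen F 0 b (fun t => f' t - k t)) as [z [Hz1 Hz2]].
- rewrite Rmin_left, Rmax_right by lra; intros t Ht.
  exact (is_derive_minus _ _ t _ _ (Df t Ht) (DK t ltac:(lra))).
- rewrite Rmin_left, Rmax_right by lra; intros t Ht.
  apply continuity_pt_filterlim, continuous_minus_R; [ apply Cf; lra | ].
  exact (derive_continuous _ _ _ (DK t ltac:(lra))).
- rewrite Rmin_left, Rmax_right in Hz1 by lra.
  assert (F0 : F 0 = f 0) by (unfold F; rewrite RInt_point; apply Rminus_0_r).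
  assert (0 <= (f' z - k z) * (b - 0)) by (apply Rmult_le_pos; [ generalize (Hk z Hz1) | ]; lra).
  unfold F at 1 in Hz2; lra.
Qed.

(** For [Y], the left side of the integral inequality, [Y' = k S^2 >= k Y^2]; so [/ Y] starts at
    [/ y0], decreases at rate at least [k] and stays positive, which bounds [t]. In this integral
    form the total loss due to [R] can be subtracted from the initial value beforehand. *)
Lemma riccati_blowup (S : R -> R) (lo b y0 k : R) : lo < 0 ->
  (forall t, lo < t < b -> continuous S t) -> 0 < y0 -> 0 < k ->
  (forall t, 0 <= t < b -> y0 + RInt (fun s => k * S s ^ 2) 0 t <= S t) ->
  forall t, 0 < t < b -> k * y0 * t < 1.
Proof.
intros Hlo CS Hy Hk H t Ht.
set (Y := fun t => y0 + RInt (fun s => k * S s ^ 2) 0 t).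
assert (Cq : forall s, lo < s < b -> continuous (fun s => k * S s ^ 2) s).
{ intros s Hs; apply (continuous_scal_r (K := R_AbsRing) k (fun s => S s ^ 2)), continuous_pow2; auto. }
assert (Ypos : forall s, 0 <= s < b -> y0 <= Y s).
{ intros s Hs; unfold Y; rewrite <- (Rplus_0_r y0) at 1; apply Rplus_le_compat_l.
  apply RInt_ge_0; [ lra | apply ex_RInt_cont; [ lra | intros; apply Cq; lra ] | ].
  intros; apply Rmult_le_pos; [ lra | apply pow2_ge_0 ]. }
assert (DY : forall s, 0 <= s < b -> is_derive Y s (k * S s ^ 2)).
{ intros s Hs.
  assert (D := FTC_derive (fun s => k * S s ^ 2) lo b 0 s Cq ltac:(lra) ltac:(lra)).
  assert (E := is_derive_plus _ _ s _ _ (is_derive_const (K := R_AbsRing) (V := R_NormedModule) y0 s) D).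
  rewrite <- (Rplus_0_l (k * S s ^ 2)); exact E. }
assert (DI' : forall s, 0 <= s < b -> is_derive (fun s => / Y s) s (- (k * S s ^ 2) / Y s ^ 2)).
{ intros s Hs; apply is_derive_inv; [ apply DY; trivial | generalize (Ypos s Hs); lra ]. }
destruct (MVT_gen (fun s => / Y s) 0 t (fun s => - (k * S s ^ 2) / Y s ^ 2)) as [z [Hz1 Hz2]].
- rewrite Rmin_left, Rmax_right by lra; intros; apply DI'; lra.
- rewrite Rmin_left, Rmax_right by lra; intros x Hx; apply continuity_pt_filterlim.
  exact (derive_continuous _ _ _ (DI' x ltac:(lra))).
- rewrite Rmin_left, Rmax_right in Hz1 by lra.
  assert (Y0 : Y 0 = y0) by (unfold Y; rewrite RInt_point; apply Rplus_0_r).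
  assert (Yt : 0 < / Y t) by (apply Rinv_0_lt_compat; generalize (Ypos t ltac:(lra)); lra).
  assert (Hq : k <= k * S z ^ 2 / Y z ^ 2).
  { assert (P := Ypos z ltac:(lra)); assert (Q : Y z <= S z) by (apply H; lra).
    apply (Rmult_le_reg_r (Y z ^ 2)); [ apply pow_lt; lra | ].
    replace (k * S z ^ 2 / Y z ^ 2 * Y z ^ 2) with (k * S z ^ 2) by (field; lra).
    apply Rmult_le_compat_l; [ lra | apply pow_incr; lra ]. }
  rewrite Y0 in Hz2.
  assert (k * t <= k * S z ^ 2 / Y z ^ 2 * t) by (apply Rmult_le_compat_r; lra).
  replace (- (k * S z ^ 2) / Y z ^ 2 * (t - 0)) with (- (k * S z ^ 2 / Y z ^ 2 * t)) in Hz2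
    by (field; generalize (Ypos z ltac:(lra)); lra).
  assert (Hlt : k * t < / y0) by lra.
  apply (Rmult_lt_compat_r y0) in Hlt; trivial; rewrite Rinv_l in Hlt by lra; lra.
Qed.

(** The support lies in a closed interval inside [(-1, 1)], so [phi] vanishes on a whole
    neighbourhood of [z], also at [z = -1] and [z = 1]. *)
Lemma phi_derive_outside (phi : R -> R) (z : R) : C1c_unit phi -> z <= -1 \/ 1 <= z ->
  Derive phi z = 0.
Proof.
intros [_ [a [b [Ha [Hb H]]]]] Hz; apply is_derive_unique.
destruct Hz as [Hz | Hz].
- apply (is_derive_ext_interval (fun _ => 0) _ (z - 1) a); [ lra | | apply (is_derive_const (K := R_AbsRing) (V := R_NormedModule)) ].
  intros s Hs; symmetry; apply H; lra.
- apply (is_derive_ext_interval (fun _ => 0) _ b (z + 1)); [ lra | | apply (is_derive_const (K := R_AbsRing) (V := R_NormedModule)) ].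
  intros s Hs; symmetry; apply H; lra.
Qed.

(** * Initial energy of the data and the resulting bound on [R] *)

Section Data.
Context (d : nat) (c : R -> R) (c0 c1 r0 u0 : R) (phi : R -> R).
Context (Hd : (1 < d)%nat) (Hc : Cn 1 c) (Hc0 : 0 < c0) (Hcb : forall x : R, c0 <= c x <= c1)
  (Hr0 : 0 < r0) (Hphi : C1c_unit phi).

Lemma alpha_nonneg : 0 <= alpha d.
Proof using Hd.
assert (H := lt_INR _ _ Hd); simpl in H; unfold alpha; lra.
Qed.

Lemma u_init_derive eps r : 0 < eps ->
  is_derive (u_init phi u0 r0 eps) r (Derive phi ((r - r0) / eps)).
Proof using Hphi.
intros He; unfold u_init.
assert (D : is_derive phi ((r - r0) / eps) (Derive phi ((r - r0) / eps)))
  by (apply Derive_correct, (proj1 (proj1 Hphi _) 1%nat); auto).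
assert (E := is_derive_comp_R phi (fun r => (r - r0) / eps) r _ (/ eps) D
  ltac:(auto_derive; trivial; field; lra)).
assert (E1 := is_derive_plus _ _ r _ _ (is_derive_const (K := R_AbsRing) (V := R_NormedModule) u0 r)
  (is_derive_scal _ r eps _ E)).
replace (Derive phi ((r - r0) / eps)) with (0 + eps * (Derive phi ((r - r0) / eps) * / eps))
  by (field; lra).
exact E1.
Qed.

Definition energy_integrand (eps r : R) : R :=
  (eps ^ 2 + (- 2 * c (u_init phi u0 r0 eps r) + eps) ^ 2)
  * Rpower r (2 * alpha d) * (Derive phi ((r - r0) / eps)) ^ 2.

Lemma energy_integrand_continuous eps r : 0 < eps -> 0 < r ->
  continuous (energy_integrand eps) r.
Proof using Hc Hphi.
intros He Hr; unfold energy_integrand.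
assert (Cu : continuous (fun r => c (u_init phi u0 r0 eps r)) r).
{ apply (continuous_comp (u_init phi u0 r0 eps) c);
    [ exact (derive_continuous _ _ _ (u_init_derive eps r He))
    | exact (derive_continuous _ _ _ (Cn1_derive c Hc _)) ]. }
assert (Cp : continuous (fun r => Derive phi ((r - r0) / eps)) r).
{ apply (continuous_comp (fun r => (r - r0) / eps) (Derive phi)); [ | apply (proj2 (proj1 Hphi _)) ].
  apply (derive_continuous _ _ (/ eps)); auto_derive; trivial; field; lra. }
apply continuous_mult_R; [ apply continuous_mult_R | apply continuous_pow2; trivial ].
- apply (continuous_plus_R (fun _ => eps ^ 2)); [ apply continuous_const | ].
  apply continuous_pow2, (continuous_plus_R _ (fun _ => eps)); [ | apply continuous_const ].
  apply (continuous_scal_r (K := R_AbsRing) (- 2) (fun r => c (u_init phi u0 r0 eps r))); trivial.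
- apply Rpower_continuous; trivial.
Qed.

Lemma energy_const_exists : exists K, 0 < K /\ energy_bound d c phi c0 u0 r0 K.
Proof using Hd Hc Hc0 Hcb Hr0 Hphi.
assert (Hc1 : c0 <= c1) by (generalize (Hcb 0); lra).
destruct (box_bounded (fun _ z => Derive phi z) 0 1 (-1) 1) as [B [HB BB]]; try lra.
{ intros t z _ _; apply continuity_2d_pt_snd, (proj2 (proj1 Hphi z)). }
set (p := Rpower r0 (2 * alpha d)); set (p2 := Rpower (2 * r0) (2 * alpha d)).
assert (Hp : 0 < p) by apply Rpower_pos; assert (Hp2 : 0 < p2) by apply Rpower_pos.
(* A pointwise bound of the integrand. As [eps < c0 <= c <= c1], the bracket is at most
   [c1^2 + (2 c1)^2], whence the 5; [p2] bounds the power because [r <= 2 r0]. The length [2 eps] of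
   the interval then gives [K = 2 k / p]. *)
set (k := 5 * c1 ^ 2 * p2 * B ^ 2).
assert (Hk : 0 < k).
{ unfold k; repeat apply Rmult_lt_0_compat; trivial; try lra; apply pow_lt; lra. }
exists (2 * k / p); split; [ apply Rdiv_lt_0_compat; lra | ].
intros eps He He'.
assert (M1 := Rmin_l c0 (r0 / 2)); assert (M2 := Rmin_r c0 (r0 / 2)).
fold p; replace (2 * k / p * p * eps) with (((r0 + eps) - (r0 - eps)) * k) by (field; lra).
apply Rle_trans with (Rabs (RInt (energy_integrand eps) (r0 - eps) (r0 + eps))); [ apply Rle_abs | ].
apply abs_RInt_le_const; [ lra | | ].
- apply ex_RInt_cont; [ lra | intros; apply energy_integrand_continuous; lra ].
- intros r Hr; unfold energy_integrand.
  set (z := (r - r0) / eps).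
  assert (Hz : -1 <= z <= 1).
  { assert (E : z * eps = r - r0) by (unfold z; field; lra).
    split; apply (Rmult_le_reg_r eps); lra. }
  assert (BP := BB 0 z ltac:(lra) Hz); cbv beta in BP.
  set (y := c (u_init phi u0 r0 eps r)); assert (Hy : c0 <= y <= c1) by apply Hcb.
  assert (A1 : 0 <= eps ^ 2 + (- 2 * y + eps) ^ 2 <= 5 * c1 ^ 2) by nra.
  assert (A2 : 0 < Rpower r (2 * alpha d) <= p2).
  { split; [ apply Rpower_pos | apply Rle_Rpower_l; [ generalize alpha_nonneg | ]; lra ]. }
  assert (A3 : 0 <= Derive phi z ^ 2 <= B ^ 2).
  { split; [ apply pow2_ge_0 | rewrite <- pow2_abs; apply pow_incr; split; [ apply Rabs_pos | trivial ] ]. }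
  rewrite Rabs_pos_eq; [ unfold k | ].
  + apply Rmult_le_compat; [ apply Rmult_le_pos; lra | lra | | lra ].
    apply Rmult_le_compat; lra.
  + apply Rmult_le_pos; [ apply Rmult_le_pos | ]; lra.
Qed.

Section Given.
Context (T eps K : R) (u ut ur : R -> R -> R) (rhat : R -> R).
Context (HK : energy_bound d c phi c0 u0 r0 K).
Context (He : 0 < eps) (He' : eps < Rmin c0 (r0 / 2)) (HT : 0 < T)
  (Hs : solution d c T u ut ur) (Hi : initial_data c phi u0 r0 eps u ut ur)
  (Hchar : characteristic c r0 T u rhat).

Lemma eps_small : eps < c0 /\ eps < r0 / 2.
Proof using He'. generalize (Rmin_l c0 (r0 / 2)) (Rmin_r c0 (r0 / 2)); lra. Qed.

Lemma initial_ur r : 0 < r -> ur 0 r = Derive phi ((r - r0) / eps).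
Proof using Hphi He HT Hs Hi.
intros Hr.
assert (D := C1_derive_r _ _ _ _ (proj1 Hs) 0 r ltac:(lra) Hr).
apply is_derive_unique in D; rewrite <- D; apply is_derive_unique.
apply (is_derive_ext_interval (u_init phi u0 r0 eps) _ 0 (r + 1)); [ lra | | apply u_init_derive; trivial ].
intros s Hs'; symmetry; apply (Hi s); lra.
Qed.

(** The data give [u_t = (eps - c) u_r] and [v = c u_r], and [(eps - c)^2 + c^2] is half of
    [eps^2 + (eps - 2 c)^2]. *)
Lemma initial_density r : 0 < r ->
  weight d r * density c u ut ur 0 r = / 2 * energy_integrand eps r.
Proof using Hphi He HT Hs Hi.
intros Hr; unfold density, energy_integrand, weight, vr; rewrite !clamp_pos by lra.
destruct (Hi r Hr) as [I1 I2]; rewrite I2, initial_ur, I1 by trivial; field.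
Qed.

Lemma char_R_continuous t : -1 < t < T -> continuous (char_R d c u ut ur rhat) t.
Proof using Hc Hc0 Hcb Hr0 HT Hs Hchar.
intros Ht.
assert (Hb := curve_bounds c c0 c1 r0 T u rhat Hc0 Hcb Hr0 HT Hchar t ltac:(lra)).
assert (Cc := curve_continuous c r0 T u rhat HT Hchar t ltac:(lra)).
assert (S1 := strip_clamp_ut d c T u ut ur HT Hs).
assert (S2 := strip_clamp_vr d c T u ut ur Hc HT Hs).
apply continuous_mult_R.
- apply (continuous_comp (curve rhat) (fun r => Rpower r (alpha d))); trivial.
  apply Rpower_continuous; lra.
- apply (continuous_subst (fun t r => clamp ut t r + vr c (clamp u) (clamp ur) t r) _ (-1) T); trivial.
  + intros s x Hs' Hx; c2d.
  + lra.
Qed.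

(** Two factors 1/2 enter on the right, one from [energy_along] and one from [initial_density]; on
    the left the flux is at least [c0 / 2] times [R^2]. Together they give the denominator
    [2 c0]. *)
Lemma char_R_energy b : 0 < b < T ->
  RInt (fun t => char_R d c u ut ur rhat t ^ 2) 0 b
  <= K * Rpower r0 (2 * alpha d) * eps / (2 * c0).
Proof using All.
intros Hb; destruct eps_small as [E1 E2].
assert (Hc1 : 0 < c1) by (generalize (Hcb 0); lra).
(* Since [eps < r0 / 2], the choice [r0 / 4] and the additional [r0] place [[r0 - eps, r0 + eps]],
   outside of which the integrand vanishes, inside [[r1, r2]]. *)
set (r1 := r0 / 4); set (r2 := r0 + 2 * c1 * b + 3 + r0).
assert (Hcb' : 0 < c1 * b) by (apply Rmult_lt_0_compat; lra).
assert (E := energy_along d c c0 c1 r0 T u ut ur rhat Hc Hc0 Hcb Hr0 HT Hs Hchar b r1 r2 Hb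
  ltac:(unfold r1; lra) ltac:(unfold r2; lra)).
assert (CI : forall r, 0 < r -> continuous (energy_integrand eps) r)
  by (intros; apply energy_integrand_continuous; trivial).
assert (EI : forall a x, 0 < a -> a <= x -> ex_RInt (energy_integrand eps) a x)
  by (intros; apply ex_RInt_cont; trivial; intros; apply CI; lra).
assert (ZI : forall r, r <= r0 - eps \/ r0 + eps <= r -> energy_integrand eps r = 0).
{ intros r Hr; unfold energy_integrand.
  rewrite (phi_derive_outside phi ((r - r0) / eps) Hphi (scaled_outside eps r0 r He Hr)).
  ring. }
assert (E0 : RInt (fun r => weight d r * density c u ut ur 0 r) r1 r2
  <= / 2 * (K * Rpower r0 (2 * alpha d) * eps)).
{ rewrite (RInt_ext_le _ (fun r => / 2 * energy_integrand eps r)); [ | unfold r1, r2; lra | ].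
  2:{ intros r Hr; apply initial_density; unfold r1 in Hr; lra. }
  rewrite RInt_scal_R by (apply EI; unfold r1, r2; lra).
  apply Rmult_le_compat_l; [ lra | ].
  rewrite <- (RInt_Chasles (energy_integrand eps) r1 (r0 - eps) r2) by (apply EI; unfold r1, r2; lra).
  rewrite <- (RInt_Chasles (energy_integrand eps) (r0 - eps) (r0 + eps) r2) by (apply EI; unfold r1, r2; lra).
  rewrite (RInt_zero (energy_integrand eps) r1 (r0 - eps)), (RInt_zero (energy_integrand eps) (r0 + eps) r2).
  - unfold plus; simpl; rewrite Rplus_0_l, Rplus_0_r; exact (HK eps He He').
  - unfold r2; lra.
  - intros; apply ZI; lra.
  - unfold r1; lra.
  - intros; apply ZI; lra. }
assert (Ck : forall t, 0 <= t <= b -> continuous (fun t => char_R d c u ut ur rhat t ^ 2) t)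
  by (intros; apply continuous_pow2, char_R_continuous; lra).
assert (L : c0 / 2 * RInt (fun t => char_R d c u ut ur rhat t ^ 2) 0 b
  <= RInt (fun t => outflow d c u ut ur rhat t (curve rhat t)) 0 b).
{ rewrite <- RInt_scal_R by (apply ex_RInt_cont; [ lra | trivial ]).
  apply RInt_le; [ lra | | | ].
  - apply ex_RInt_cont; [ lra | intros t Ht ].
    apply (continuous_scal_r (K := R_AbsRing) (c0 / 2) (fun t => char_R d c u ut ur rhat t ^ 2)), Ck; trivial.
  - apply ex_RInt_cont; [ lra | intros t Ht ].
    apply (continuous_subst (outflow d c u ut ur rhat) _ (-1) T); try lra.
    + exact (strip_outflow d c c0 c1 r0 T u ut ur rhat Hc Hc0 Hcb Hr0 HT Hs Hchar).
    + generalize (curve_bounds c c0 c1 r0 T u rhat Hc0 Hcb Hr0 HT Hchar t ltac:(lra)); lra.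
    + apply (curve_continuous c r0 T u); trivial; lra.
  - intros t Ht; rewrite outflow_curve.
    generalize (Hcb (clamp u t (curve rhat t))) (pow2_ge_0 (char_R d c u ut ur rhat t)); nra. }
apply (Rmult_le_reg_l (c0 / 2)); [ lra | ].
replace (c0 / 2 * (K * Rpower r0 (2 * alpha d) * eps / (2 * c0)))
  with (/ 2 * (/ 2 * (K * Rpower r0 (2 * alpha d) * eps))) by (field; lra).
lra.
Qed.

End Given.
End Data.

(** * Blow-up *)

Section Deviation.
Context (d : nat) (c : R -> R) (c0 c1 r0 u0 : R) (phi : R -> R).
Context (Hd : (1 < d)%nat) (Hc : Cn 1 c) (Hc0 : 0 < c0) (Hcb : forall x : R, c0 <= c x <= c1)
  (Hr0 : 0 < r0) (Hphi : C1c_unit phi).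

(** Along the curve [u] changes at the rate [q = u_t + c u_r = R / rhat^alpha], whose square has an
    integral of order [eps]. The weighted inequality [2 sg |q| <= q^2 + sg^2] with [sg = sqrt eps]
    stands in for Cauchy-Schwarz and makes the drift of order [sqrt eps]. *)
Lemma u_deviation (T eps K : R) (u ut ur : R -> R -> R) (rhat : R -> R) (b : R) :
  energy_bound d c phi c0 u0 r0 K -> 0 < eps -> eps < Rmin c0 (r0 / 2) ->
  solution d c T u ut ur -> initial_data c phi u0 r0 eps u ut ur ->
  characteristic c r0 T u rhat -> 0 < b < T ->
  Rabs (u b (rhat b) - u 0 r0) <= sqrt eps * (/ 2 * (K / (2 * c0) + b)).
Proof using All.
intros HK He He' Hs Hi Hchar Hb.
assert (HT : 0 < T) by lra.
assert (HE := char_R_energy d c c0 c1 r0 u0 phi Hd Hc Hc0 Hcb Hr0 Hphi T eps K u ut ur rhat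
  HK He He' HT Hs Hi Hchar b Hb).
set (sg := sqrt eps); assert (Hsg : 0 < sg) by (apply sqrt_lt_R0; trivial).
assert (Hsg2 : sg * sg = eps) by (apply sqrt_sqrt; lra).
set (p := Rpower r0 (2 * alpha d)) in *; assert (Hp : 0 < p) by apply Rpower_pos.
set (Rr := char_R d c u ut ur rhat) in *.
set (q := fun t => clamp ut t (curve rhat t) + vr c (clamp u) (clamp ur) t (curve rhat t)).
set (f := fun t => clamp u t (curve rhat t)).
assert (Hcv : forall t, t < T -> r0 <= curve rhat t).
{ intros t Ht; apply (curve_bounds c c0 c1 r0 T u rhat Hc0 Hcb Hr0 HT Hchar t Ht). }
assert (CR : forall t, -1 < t < T -> continuous Rr t)
  by (intros; apply (char_R_continuous d c c0 c1 r0 Hc Hc0 Hcb Hr0 T); trivial).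
set (k := fun t => / (2 * p * sg) * Rr t ^ 2 + / 2 * sg).
assert (Ck : forall t, -1 < t < T -> continuous k t).
{ intros t Ht; apply (continuous_plus_R (fun t => / (2 * p * sg) * Rr t ^ 2) (fun _ => / 2 * sg));
    [ | apply continuous_const ].
  apply (continuous_scal_r (K := R_AbsRing) (/ (2 * p * sg)) (fun t => Rr t ^ 2)), continuous_pow2; auto. }
assert (Cf : forall t, -1 < t < T -> continuous f t).
{ intros t Ht; apply (continuous_subst (clamp u) _ (-1) T); trivial.
  - exact (strip_clamp_u d c T u ut ur HT Hs).
  - generalize (Hcv t ltac:(lra)); lra.
  - apply (curve_continuous c r0 T u); trivial; lra. }
assert (Df : forall t, 0 < t < T -> is_derive f t (q t)).
{ intros t Ht.
  assert (D := is_derive_along T u ut ur (curve rhat) t _ (C1_u d c T u ut ur Hs) Ht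
    ltac:(generalize (Hcv t ltac:(lra)); lra) (curve_derive c r0 T u rhat Hchar t Ht)).
  unfold q, vr; rewrite !clamp_pos by lra; rewrite (Rmult_comm (c _)).
  apply (is_derive_ext_interval (fun t => u t (curve rhat t)) _ 0 T); trivial.
  intros s Hs'; unfold f; rewrite clamp_pos by lra; trivial. }
assert (Hq : forall t, 0 <= t <= b -> Rabs (q t) <= k t).
{ intros t Ht.
  assert (HR : p * q t ^ 2 <= Rr t ^ 2).
  { unfold Rr, char_R; fold (q t).
    rewrite Rpow_mult_distr; apply Rmult_le_compat_r; [ apply pow2_ge_0 | ].
    replace (Rpower (curve rhat t) (alpha d) ^ 2) with (Rpower (curve rhat t) (2 * alpha d)).
    - apply Rle_Rpower_l; [ generalize (alpha_nonneg d Hd); lra | ].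
      generalize (Hcv t ltac:(lra)); lra.
    - replace (2 * alpha d) with (alpha d + alpha d) by ring; rewrite Rpower_plus; ring. }
  assert (H1 : 2 * sg * Rabs (q t) <= q t ^ 2 + sg * sg).
  { rewrite <- (pow2_abs (q t)); generalize (pow2_ge_0 (Rabs (q t) - sg)); lra. }
  apply (Rmult_le_reg_l (2 * p * sg)).
  - repeat apply Rmult_lt_0_compat; lra.
  - unfold k; replace (2 * p * sg * (/ (2 * p * sg) * Rr t ^ 2 + / 2 * sg))
      with (Rr t ^ 2 + p * (sg * sg)) by (field; lra).
    apply (Rmult_le_compat_l p) in H1; lra. }
assert (Ek : RInt k 0 b <= sg * (/ 2 * (K / (2 * c0) + b))).
{ assert (ER : ex_RInt (fun t => Rr t ^ 2) 0 b)
    by (apply ex_RInt_cont; [ lra | intros; apply continuous_pow2, CR; lra ]).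
  unfold k; rewrite RInt_plus_R, RInt_scal_R, RInt_const_R; trivial.
  - apply Rle_trans with (/ (2 * p * sg) * (K * p * eps / (2 * c0)) + (b - 0) * (/ 2 * sg)).
    + apply Rplus_le_compat_r, Rmult_le_compat_l; trivial.
      apply Rlt_le, Rinv_0_lt_compat; repeat apply Rmult_lt_0_compat; lra.
    + right; rewrite <- Hsg2; field; lra.
  - apply (ex_RInt_scal (V := R_NormedModule)); trivial.
  - apply ex_RInt_cont; [ lra | intros; apply continuous_const ]. }
assert (I1 := increment_ge (fun t => - f t) (fun t => - q t) (fun t => - k t) (-1) T b ltac:(lra) Hb
  (fun t Ht => continuous_opp (V := R_NormedModule) _ _ (Cf t Ht))
  (fun t Ht => continuous_opp (V := R_NormedModule) _ _ (Ck t Ht))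
  (fun t Ht => is_derive_opp _ t _ (Df t ltac:(lra)))
  ltac:(intros t Ht; generalize (Hq t Ht) (Rle_abs (q t)); lra)).
assert (I2 := increment_ge f q (fun t => - k t) (-1) T b ltac:(lra) Hb Cf
  (fun t Ht => continuous_opp (V := R_NormedModule) _ _ (Ck t Ht))
  (fun t Ht => Df t ltac:(lra))
  ltac:(intros t Ht; generalize (Hq t Ht) (Rle_abs (- q t)); rewrite Rabs_Ropp; lra)).
cbv beta in I1, I2.
assert (EO : RInt (fun t => - k t) 0 b = - RInt k 0 b).
{ apply (RInt_opp (V := R_CompleteNormedModule) k).
  apply ex_RInt_cont; [ lra | intros; apply Ck; lra ]. }
rewrite EO in I1, I2.
assert (F0 : f 0 = u 0 r0)
  by (unfold f; rewrite clamp_pos, curve_pos, (proj1 Hchar) by lra; trivial).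
assert (Fb : f b = u b (rhat b))
  by (unfold f; rewrite clamp_pos, curve_pos by lra; trivial).
rewrite F0, Fb in I1, I2; apply Rabs_le_between; lra.
Qed.

Lemma threshold_exists : 0 < Derive c u0 ->
  exists eps', 0 < eps' /\ small_data_threshold d c phi c0 c1 u0 r0 eps'.
Proof using All.
intros Hu0.
assert (Hc1 : 0 < c1) by (generalize (Hcb 0); lra).
destruct (energy_const_exists d c c0 c1 r0 u0 phi Hd Hc Hc0 Hcb Hr0 Hphi) as [K [HKp HK]].
destruct (continuous_near (Derive c) u0 (Derive c u0 / 4) (proj2 (Hc u0)) ltac:(lra)) as [rho [Hrho Hnear]].
(* The drift of [u] is at most [sqrt eps * D], because only times [t < (r0 - eps) / c1 <= r0 / c1]
   are considered. *)
set (D := / 2 * (K / (2 * c0) + r0 / c1)).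
assert (HD : 0 < D).
{ unfold D; assert (0 < K / (2 * c0)) by (apply Rdiv_lt_0_compat; lra).
  assert (0 < r0 / c1) by (apply Rdiv_lt_0_compat; lra); lra. }
(* [sqrt eps < m1] keeps the drift below [rho / 2] and [eps < m2] keeps the initial offset
   [eps * phi 0] below [rho / 2]; the [+ 1] covers [phi 0 = 0]. Then [c'] is at least [3/4 c'(u0)]
   on the curve and lies between [3/4] and [5/4] of [c'(u0)] at its start, and [3/4] exceeds half of
   [5/4]. *)
set (m1 := rho / (2 * D)); set (m2 := rho / (2 * (Rabs (phi 0) + 1))).
assert (Hphi0 := Rabs_pos (phi 0)).
assert (H1 : 0 < m1) by (apply Rdiv_lt_0_compat; lra).
assert (H2 : 0 < m2) by (apply Rdiv_lt_0_compat; lra).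
exists (Rmin (m1 ^ 2) m2); split; [ apply Rmin_case; trivial; apply pow_lt; trivial | ].
intros eps T u ut ur rhat He He1 He2 Hs Hi Hchar t Ht Htr.
assert (HT : 0 < T) by lra.
assert (E1 := Rlt_le_trans _ _ _ He1 (Rmin_l _ _)); assert (E2 := Rlt_le_trans _ _ _ He1 (Rmin_r _ _)).
assert (S1 : sqrt eps < m1).
{ rewrite <- (sqrt_pow2 m1) by lra; apply sqrt_lt_1_alt; lra. }
assert (U0 : u 0 r0 = u0 + eps * phi 0).
{ rewrite (proj1 (Hi r0 Hr0)); unfold u_init; rewrite Rminus_diag; unfold Rdiv; rewrite Rmult_0_l; trivial. }
assert (B0 : Rabs (u 0 r0 - u0) < rho / 2).
{ rewrite U0; replace (u0 + eps * phi 0 - u0) with (eps * phi 0) by ring.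
  rewrite Rabs_mult, (Rabs_pos_eq eps) by lra.
  apply Rle_lt_trans with (eps * (Rabs (phi 0) + 1)); [ apply Rmult_le_compat_l; lra | ].
  apply Rlt_le_trans with (m2 * (Rabs (phi 0) + 1)); [ apply Rmult_lt_compat_r; lra | ].
  right; unfold m2; field; lra. }
assert (Bt : Rabs (u t (rhat t) - u 0 r0) < rho / 2).
{ destruct (Rle_lt_or_eq_dec 0 t (proj1 Ht)) as [Hpos | Hz].
  2:{ rewrite <- Hz, (proj1 Hchar), Rminus_diag, Rabs_R0; lra. }
  eapply Rle_lt_trans; [ apply (u_deviation T eps K u ut ur rhat t); trivial; lra | ].
  assert (Htc : t <= r0 / c1).
  { apply Rlt_le, (Rlt_le_trans _ _ _ Htr), Rmult_le_compat_r; [ apply Rlt_le, Rinv_0_lt_compat | ]; lra. }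
  assert (HKc : 0 < K / (2 * c0)) by (apply Rdiv_lt_0_compat; lra).
  apply Rle_lt_trans with (sqrt eps * D).
  - apply Rmult_le_compat_l; [ apply sqrt_pos | unfold D; lra ].
  - apply Rlt_le_trans with (m1 * D); [ apply Rmult_lt_compat_r; lra | ].
    right; unfold m1; field; lra. }
assert (N0 := Hnear (u 0 r0) ltac:(lra)).
assert (Nt : Rabs (Derive c (u t (rhat t)) - Derive c u0) < Derive c u0 / 4).
{ apply Hnear; replace (u t (rhat t) - u0) with ((u t (rhat t) - u 0 r0) + (u 0 r0 - u0)) by ring.
  eapply Rle_lt_trans; [ apply Rabs_triang | lra ]. }
apply Rabs_def2 in N0; apply Rabs_def2 in Nt; split; lra.
Qed.

End Deviation.

(** * The Riccati argument on the time interval [[0, r0 / (2 c1))] *)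

Section Blowup.
Context (d : nat) (c : R -> R) (c0 c1 r0 u0 : R) (phi : R -> R).
Context (Hd : (1 < d)%nat) (Hc : Cn 1 c) (Hc0 : 0 < c0) (Hcb : forall x : R, c0 <= c x <= c1)
  (Hcd : forall x : R, Rabs (Derive c x) <= c1) (Hu0 : 0 < Derive c u0)
  (Hr0 : 0 < r0) (Hphi : C1c_unit phi).
Context (Hphi0 : Derive phi 0 <=
     - 2 * Rmax (32 * c1 ^ 2 * Rpower 2 (alpha d) / (r0 * c0 * Derive c u0))
                (1 / (c0 * Rpower r0 (alpha d)))).
Context (T eps K : R) (u ut ur : R -> R -> R) (rhat : R -> R).
Context (HKp : 0 < K) (HK : energy_bound d c phi c0 u0 r0 K)
  (He : 0 < eps) (He' : eps < Rmin c0 (r0 / 2)) (HTe : T = r0 / (2 * c1))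
  (Hs : solution d c T u ut ur) (Hi : initial_data c phi u0 r0 eps u ut ur)
  (Hchar : characteristic c r0 T u rhat)
  (Hc' : forall t, 0 <= t < T -> / 4 * Derive c u0 <= Derive c (u t (rhat t)))
  (HM : M_const d c0 c1 r0 K * sqrt eps <= / 2).

Lemma c1_pos : 0 < c1.
Proof using Hc0 Hcb. generalize (Hcb 0); lra. Qed.

Lemma T_pos : 0 < T.
Proof using HTe Hr0 Hc0 Hcb. rewrite HTe; apply Rdiv_lt_0_compat; generalize c1_pos; lra. Qed.

Definition char_S (t : R) : R := Rpower (curve rhat t) (alpha d) * char_s c u ut ur t (curve rhat t).

(** The data give [S(0) = r0^alpha (2 c - eps) (- phi'(0))], and [2 c - eps >= c0] because
    [eps < c0 <= c]. Each entry of the maximum in the hypothesis on [phi'(0)] yields one bound, with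
    [2^alpha r0^alpha = (2 r0)^alpha] in the second. *)
Lemma char_S_initial : 2 <= char_S 0 /\
  64 * c1 ^ 2 * Rpower (2 * r0) (alpha d) / (r0 * Derive c u0) <= char_S 0.
Proof using All.
assert (Hc1 := c1_pos).
assert (HT := T_pos).
destruct (eps_small c0 r0 eps He') as [E1 E2].
assert (Hrho := Rpower_pos r0 (alpha d)); set (rho := Rpower r0 (alpha d)) in *.
set (m1 := 32 * c1 ^ 2 * Rpower 2 (alpha d) / (r0 * c0 * Derive c u0)) in *.
set (m2 := 1 / (c0 * rho)) in *.
assert (Hm1 : 2 * m1 <= - Derive phi 0) by (generalize (Rmax_l m1 m2); lra).
assert (Hm2 : 2 * m2 <= - Derive phi 0) by (generalize (Rmax_r m1 m2); lra).
assert (Hp2 := Rpower_pos 2 (alpha d)).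
assert (Pm2 : 0 < m2).
{ unfold m2; apply Rdiv_lt_0_compat; [ | apply Rmult_lt_0_compat ]; lra. }
assert (EU : ur 0 r0 = Derive phi 0).
{ rewrite (initial_ur d c r0 u0 phi Hphi T eps u ut ur He HT Hs Hi r0 Hr0).
  f_equal; unfold Rdiv; rewrite Rminus_diag; ring. }
assert (ES : char_S 0 = rho * ((2 * c (u 0 r0) - eps) * - Derive phi 0)).
{ unfold char_S, char_s, vr; rewrite curve_pos, (proj1 Hchar), !clamp_pos by lra.
  rewrite (proj2 (Hi r0 Hr0)), EU; fold rho; ring. }
assert (Hk : c0 <= 2 * c (u 0 r0) - eps) by (generalize (Hcb (u 0 r0)); lra).
assert (HS : rho * (c0 * - Derive phi 0) <= char_S 0).
{ rewrite ES; apply Rmult_le_compat_l; [ lra | apply Rmult_le_compat_r; lra ]. }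
assert (G : forall m, 2 * m <= - Derive phi 0 -> rho * (c0 * (2 * m)) <= char_S 0).
{ intros m Hm; apply Rle_trans with (2 := HS).
  apply Rmult_le_compat_l; [ lra | apply Rmult_le_compat_l; lra ]. }
split.
- apply Rle_trans with (2 := G m2 Hm2); right; unfold m2; field; lra.
- apply Rle_trans with (2 := G m1 Hm1); right; unfold m1.
  rewrite <- Rpower_mult_distr by lra; fold rho; field; lra.
Qed.

Lemma char_S_continuous t : -1 < t < T -> continuous char_S t.
Proof using Hc Hc0 Hcb Hr0 HTe Hs Hchar.
intros Ht; assert (HT := T_pos).
assert (Hb := curve_bounds c c0 c1 r0 T u rhat Hc0 Hcb Hr0 HT Hchar t ltac:(lra)).
assert (Cc := curve_continuous c r0 T u rhat HT Hchar t ltac:(lra)).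
assert (Ss := strip_char_s d c T u ut ur Hc HT Hs).
apply continuous_mult_R.
- apply (continuous_comp (curve rhat) (fun r => Rpower r (alpha d))); trivial.
  apply Rpower_continuous; lra.
- apply (continuous_subst (char_s c u ut ur) _ (-1) T); trivial; lra.
Qed.

Definition char_S' (t : R) : R :=
  let g := curve rhat t in
  alpha d * (Rpower g (alpha d) / g) * c (u t g) * char_s c u ut ur t g
  - Rpower g (alpha d) * char_src d c u ut ur t g.

(** [S] is differentiable along the curve although [u_t] and [u_r] are only continuous:
    [transport_along] exhibits [u_t - v] there as the primitive of a continuous function. *)
Lemma char_S_derive t : 0 < t < T -> is_derive char_S t (char_S' t).
Proof using Hc Hc0 Hcb Hr0 HTe Hs Hchar.
intros Ht; assert (HT := T_pos).
set (src := fun t => char_src d c u ut ur t (curve rhat t)).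
assert (Hcv : forall t, t < T -> 0 < curve rhat t).
{ intros s Hs'; generalize (curve_bounds c c0 c1 r0 T u rhat Hc0 Hcb Hr0 HT Hchar s Hs'); lra. }
assert (Csrc : forall t, -1 < t < T -> continuous src t).
{ intros s Hs'; apply (continuous_subst (char_src d c u ut ur) _ (-1) T); trivial.
  - exact (strip_char_src d c T u ut ur Hc HT Hs).
  - apply Hcv; lra.
  - apply (curve_continuous c r0 T u); trivial; lra. }
assert (D1 : is_derive (fun t => char_s c u ut ur t (curve rhat t)) t (- src t)).
{ apply (is_derive_ext_interval (fun t => char_s c u ut ur 0 r0 - RInt src 0 t) _ 0 T); trivial.
  - intros s Hs'; rewrite <- (transport_along d c c0 c1 r0 T u ut ur rhat Hc Hc0 Hcb Hr0 HT Hs Hchar s Hs').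
    unfold src; eqR; apply Rplus_minus_r.
  - assert (D := FTC_derive src (-1) T 0 t Csrc ltac:(lra) ltac:(lra)).
    assert (E := is_derive_minus _ _ t _ _ (is_derive_const (K := R_AbsRing) (V := R_NormedModule) (char_s c u ut ur 0 r0) t) D).
    rewrite <- (Rminus_0_l (src t)); exact E. }
assert (D2 := is_derive_comp_R (fun r => Rpower r (alpha d)) (curve rhat) t _ _
  (Rpower_derive (alpha d) _ (Hcv t (proj2 Ht))) (curve_derive c r0 T u rhat Hchar t Ht)).
assert (D3 := is_derive_mult_R _ _ t _ _ D2 D1).
unfold char_S', char_S.
replace (alpha d * (Rpower (curve rhat t) (alpha d) / curve rhat t) * c (u t (curve rhat t))
  * char_s c u ut ur t (curve rhat t) - Rpower (curve rhat t) (alpha d) * char_src d c u ut ur t (curve rhat t))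
  with (alpha d * (Rpower (curve rhat t) (alpha d) / curve rhat t) * c (u t (curve rhat t))
  * char_s c u ut ur t (curve rhat t) + Rpower (curve rhat t) (alpha d) * - src t) by (unfold src; ring).
exact D3.
Qed.

(** Here [u_t u_r = (R^2 - S^2) / (4 c r^(2 alpha))] and [v = (R - S) / (2 r^alpha)]. The weight
    [r^alpha] is tuned so that the term [alpha c S / r] from its derivative cancels the [S] part of
    the geometric source [alpha c (R - S) / r], leaving a linear term in [R] only. *)
Lemma char_S'_eq t : 0 <= t < T ->
  let g := curve rhat t in
  char_S' t = Derive c (u t g) / (4 * c (u t g) * Rpower g (alpha d))
      * (char_S t ^ 2 - char_R d c u ut ur rhat t ^ 2)
    + alpha d * (c (u t g) / g) * char_R d c u ut ur rhat t.
Proof using Hc0 Hcb Hr0 HTe Hchar.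
intros Ht g; assert (HT := T_pos).
assert (Hg := curve_bounds c c0 c1 r0 T u rhat Hc0 Hcb Hr0 HT Hchar t ltac:(lra)); fold g in Hg.
assert (Hp := Rpower_pos g (alpha d)).
unfold char_S', char_S, char_R, char_s, char_src, vr; fold g; rewrite !clamp_pos by lra.
assert (Hcu := Hcb (u t g)).
field; lra.
Qed.

(* By AM-GM, [|R| <= (l R^2 + 1 / l) / 2]; the weight [l = 1 / (q rho)] equalises the two parts
   of the resulting bound. *)
Lemma char_S_riccati (t : R) : 0 <= t < T ->
  (char_S 0 - / 2)
  + RInt (fun s => Derive c u0 / (16 * c1 * Rpower (2 * r0) (alpha d)) * char_S s ^ 2) 0 t
  <= char_S t.
Proof using All.
intros Ht.
assert (Hc1 := c1_pos); assert (HT := T_pos).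
destruct (eps_small c0 r0 eps He') as [E1 E2].
assert (Hal := alpha_nonneg d Hd); set (al := alpha d) in *.
destruct (Rle_lt_or_eq_dec 0 t (proj1 Ht)) as [Hpos | <-].
2:{ rewrite RInt_point; unfold zero; simpl; lra. }
assert (Hrm := Rpower_pos (2 * r0) al); set (rm := Rpower (2 * r0) al) in *.
assert (Hrho := Rpower_pos r0 al); set (rho := Rpower r0 al) in *.
(* A lower bound for [c' / (4 c r^alpha)]: on the curve [c' >= c'(u0) / 4] and [c <= c1], and up to
   time [T = r0 / (2 c1)] the curve stays below [2 r0]. *)
set (k := Derive c u0 / (16 * c1 * rm)).
assert (Hk : 0 < k) by (apply Rdiv_lt_0_compat; trivial; repeat apply Rmult_lt_0_compat; lra).
set (Rr := char_R d c u ut ur rhat).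
set (sg := sqrt eps) in *; assert (Hsg : 0 < sg) by (apply sqrt_lt_R0; trivial).
assert (Hsg2 : sg * sg = eps) by (apply sqrt_sqrt; lra).
set (x := sqrt (K * c1)) in *; assert (Hx : 0 < x) by (apply sqrt_lt_R0, Rmult_lt_0_compat; trivial).
assert (Hx2 : x * x = K * c1) by (apply sqrt_sqrt, Rlt_le, Rmult_lt_0_compat; trivial).
set (y := sqrt (r0 * c0)) in *; assert (Hy : 0 < y) by (apply sqrt_lt_R0, Rmult_lt_0_compat; trivial).
assert (Hy2 : y * y = r0 * c0) by (apply sqrt_sqrt, Rlt_le, Rmult_lt_0_compat; trivial).
set (q := x * sg / y).
assert (Hq : 0 < q) by (apply Rdiv_lt_0_compat; trivial; apply Rmult_lt_0_compat; trivial).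
assert (Hq2 : q * q = K * c1 * eps / (r0 * c0)).
{ unfold q; rewrite <- Hx2, <- Hy2, <- Hsg2; field; lra. }
set (l := / (q * rho)).
assert (Hqr : 0 < q * rho) by (apply Rmult_lt_0_compat; trivial).
assert (Hl : 0 < l) by (apply Rinv_0_lt_compat; trivial).
set (a1 := c1 / (4 * c0 * rho)).
assert (Ha1 : 0 < a1) by (apply Rdiv_lt_0_compat; trivial; repeat apply Rmult_lt_0_compat; lra).
set (m := al * c1 / (2 * r0)).
assert (Hm : 0 <= m) by (apply Rdiv_le_0_compat; [ apply Rmult_le_pos | ]; lra).
set (a := a1 + m * l); set (bt := m * / l).
set (kk := fun s => k * char_S s ^ 2 - (a * Rr s ^ 2 + bt)).
assert (CS : forall s, -1 < s < T -> continuous (fun s => k * char_S s ^ 2) s).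
{ intros s Hs'; apply (continuous_scal_r (K := R_AbsRing) k (fun s => char_S s ^ 2)),
    continuous_pow2, char_S_continuous; trivial. }
assert (CR2 : forall s, -1 < s < T -> continuous (fun s => Rr s ^ 2) s).
{ intros s Hs'; apply continuous_pow2, (char_R_continuous d c c0 c1 r0 Hc Hc0 Hcb Hr0 T); trivial. }
assert (CR : forall s, -1 < s < T -> continuous (fun s => a * Rr s ^ 2 + bt) s).
{ intros s Hs'; apply (continuous_plus_R (fun s => a * Rr s ^ 2) (fun _ => bt)); [ | apply continuous_const ].
  apply (continuous_scal_r (K := R_AbsRing) a (fun s => Rr s ^ 2)); auto. }
assert (Hge : forall s, 0 <= s <= t -> kk s <= char_S' s).
{ intros s Hs'.
  assert (Hcs := Hc' s ltac:(lra)); rewrite <- (curve_pos rhat s) in Hcs by lra.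
  assert (Hg := curve_bounds c c0 c1 r0 T u rhat Hc0 Hcb Hr0 HT Hchar s ltac:(lra)).
  rewrite Rmax_right in Hg by lra.
  rewrite char_S'_eq by lra; fold Rr al.
  set (g := curve rhat s) in *.
  assert (Hcg : c1 * s <= r0).
  { assert (c1 * s <= c1 * T) by (apply Rmult_le_compat_l; lra).
    rewrite HTe in H; replace (c1 * (r0 / (2 * c1))) with (r0 / 2) in H by (field; lra); lra. }
  assert (Hcu := Hcb (u s g)); set (cc := c (u s g)) in *.
  assert (Hdc := Hcd (u s g)); apply Rabs_le_between in Hdc.
  set (dc := Derive c (u s g)) in *.
  assert (Hp1 : rho <= Rpower g al) by (apply Rle_Rpower_l; lra).
  assert (Hp2 : Rpower g al <= rm) by (apply Rle_Rpower_l; lra).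
  set (p := Rpower g al) in *.
  set (A := dc / (4 * cc * p)).
  assert (Hcp : 0 < 4 * cc * p) by (repeat apply Rmult_lt_0_compat; lra).
  assert (A1 : k <= A).
  { apply (Rmult_le_reg_r (4 * cc * p)); trivial.
    replace (A * (4 * cc * p)) with dc by (unfold A; field; lra).
    apply Rle_trans with (k * (4 * c1 * rm)).
    - apply Rmult_le_compat_l; [ lra | apply Rmult_le_compat; lra ].
    - replace (k * (4 * c1 * rm)) with (/ 4 * Derive c u0) by (unfold k; field; lra); lra. }
  assert (A2 : A <= a1).
  { apply (Rmult_le_reg_r (4 * cc * p)); trivial.
    replace (A * (4 * cc * p)) with dc by (unfold A; field; lra).
    apply Rle_trans with (a1 * (4 * c0 * rho)).
    - replace (a1 * (4 * c0 * rho)) with c1 by (unfold a1; field; lra); lra.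
    - apply Rmult_le_compat_l; [ lra | apply Rmult_le_compat; lra ]. }
  assert (HAS : k * char_S s ^ 2 <= A * char_S s ^ 2)
    by (apply Rmult_le_compat_r; [ apply pow2_ge_0 | trivial ]).
  assert (HAR : A * Rr s ^ 2 <= a1 * Rr s ^ 2)
    by (apply Rmult_le_compat_r; [ apply pow2_ge_0 | trivial ]).
  assert (HR : 2 * Rabs (Rr s) <= l * Rr s ^ 2 + / l).
  { apply (Rmult_le_reg_l l); trivial.
    replace (l * (l * Rr s ^ 2 + / l)) with (l ^ 2 * Rabs (Rr s) ^ 2 + 1)
      by (rewrite pow2_abs; field; lra).
    generalize (pow2_ge_0 (l * Rabs (Rr s) - 1)); lra. }
  assert (HB : - (al * (cc / g) * Rr s) <= m * (l * Rr s ^ 2 + / l)).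
  { apply Rle_trans with (m * (2 * Rabs (Rr s))); [ | apply Rmult_le_compat_l; trivial ].
    apply Rle_trans with (al * (cc / g) * Rabs (Rr s)).
    - rewrite Ropp_mult_distr_r; apply Rmult_le_compat_l.
      + apply Rmult_le_pos; [ trivial | apply Rdiv_le_0_compat; lra ].
      + generalize (Rle_abs (- Rr s)); rewrite Rabs_Ropp; trivial.
    - replace (m * (2 * Rabs (Rr s))) with (al * (c1 / r0) * Rabs (Rr s)) by (unfold m; field; lra).
      apply Rmult_le_compat_r; [ apply Rabs_pos | apply Rmult_le_compat_l; trivial ].
      apply Rmult_le_compat; [ lra | apply Rlt_le, Rinv_0_lt_compat; lra | lra | apply Rinv_le_contravar; lra ]. }
  unfold kk, a, bt; lra. }
assert (HI := increment_ge char_S char_S' kk (-1) T t ltac:(lra) (conj Hpos (proj2 Ht))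
  char_S_continuous (fun s Hs' => continuous_minus_R _ _ s (CS s Hs') (CR s Hs'))
  (fun s Hs' => char_S_derive s ltac:(lra)) Hge).
assert (EX : forall f, (forall s, -1 < s < T -> continuous f s) -> ex_RInt f 0 t)
  by (intros; apply ex_RInt_cont; [ lra | intros; apply H; lra ]).
unfold kk in HI; rewrite RInt_minus_R in HI by auto.
assert (HE := char_R_energy d c c0 c1 r0 u0 phi Hd Hc Hc0 Hcb Hr0 Hphi T eps K u ut ur rhat
  HK He He' HT Hs Hi Hchar t ltac:(lra)); fold Rr al in HE.
replace (Rpower r0 (2 * al)) with (rho * rho) in HE
  by (unfold rho; rewrite <- Rpower_plus; f_equal; ring).
assert (HL : RInt (fun s => a * Rr s ^ 2 + bt) 0 t <= / 2); [ | lra ].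
rewrite (RInt_plus_R (fun s => a * Rr s ^ 2) (fun _ => bt)), RInt_scal_R, RInt_const_R.
- set (I := RInt (fun s => Rr s ^ 2) 0 t) in *.
  assert (Ha : 0 < a) by (unfold a; generalize (Rmult_le_pos _ _ Hm (Rlt_le _ _ Hl)); lra).
  assert (Hbt : 0 <= bt) by (apply Rmult_le_pos; [ | apply Rlt_le, Rinv_0_lt_compat ]; trivial).
  assert (B1 : a * I <= a * (K * (rho * rho) * eps / (2 * c0))) by (apply Rmult_le_compat_l; lra).
  assert (B2 : (t - 0) * bt <= r0 / (2 * c1) * bt) by (apply Rmult_le_compat_r; lra).
  assert (EK : K * eps = q * q * (r0 * c0) / c1) by (rewrite Hq2; field; lra).
  (* Each summand equals [al * q * rho / 4]. Their sum is half of the second term of [M] times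
     [sqrt eps]. *)
  assert (B3 : m * l * (K * (rho * rho) * eps / (2 * c0)) + r0 / (2 * c1) * bt = / 2 * (al * q * rho)).
  { replace (K * (rho * rho) * eps / (2 * c0)) with ((K * eps) * (rho * rho) / (2 * c0)) by (field; lra).
    rewrite EK; unfold bt, m, l; field; lra. }
  assert (B4 : a1 * (K * (rho * rho) * eps / (2 * c0)) = / 2 * (K * c1 * rho * eps / (4 * c0 ^ 2)))
    by (unfold a1; field; lra).
  unfold M_const in HM; fold al rho x y in HM.
  set (z := sqrt r0) in *; assert (Hz : 0 < z) by (apply sqrt_lt_R0; trivial).
  assert (Hsz : sg <= z) by (apply sqrt_le_1_alt; lra).
  (* One factor [sqrt eps] of [eps] is traded for [sqrt r0]; this is the source of the [sqrt r0] in
     the first term of [M]. *)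
  assert (B5 : K * c1 * rho * eps / (4 * c0 ^ 2) <= K * c1 * rho * z / (4 * c0 ^ 2) * sg).
  { rewrite <- Hsg2.
    replace (K * c1 * rho * (sg * sg) / (4 * c0 ^ 2)) with (K * c1 * rho * sg / (4 * c0 ^ 2) * sg) by (field; lra).
    apply Rmult_le_compat_r; [ lra | ]; apply Rmult_le_compat_r.
    - apply Rlt_le, Rinv_0_lt_compat, Rmult_lt_0_compat; [ lra | apply pow_lt; trivial ].
    - apply Rmult_le_compat_l; trivial; apply Rlt_le; repeat apply Rmult_lt_0_compat; trivial. }
  assert (B6 : al * q * rho = al * x * rho / y * sg) by (unfold q; field; lra).
  assert (B7 : a * (K * (rho * rho) * eps / (2 * c0)) = a1 * (K * (rho * rho) * eps / (2 * c0))
    + m * l * (K * (rho * rho) * eps / (2 * c0))) by (unfold a; ring).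
  change (a * I + (t - 0) * bt <= / 2); lra.
- auto.
- apply EX; intros s Hs'; apply (continuous_scal_r (K := R_AbsRing) a (fun s => Rr s ^ 2)); auto.
- apply ex_RInt_cont; [ lra | intros; apply continuous_const ].
Qed.

(** As [S(0) >= 2], the loss 1/2 is at most a quarter of [S(0)], which turns the constant 64 into
    48. Then [k * y0 * t >= 1] already at [t = r0 / (3 c1)], which precedes [T = r0 / (2 c1)],
    against [riccati_blowup]. *)
Lemma blowup : False.
Proof using All.
assert (Hc1 := c1_pos); assert (HT := T_pos).
destruct char_S_initial as [S1 S2].
assert (Hrm := Rpower_pos (2 * r0) (alpha d)); set (rm := Rpower (2 * r0) (alpha d)) in *.
set (k := Derive c u0 / (16 * c1 * rm)).
assert (Hk : 0 < k).
{ apply Rdiv_lt_0_compat; trivial; repeat apply Rmult_lt_0_compat; lra. }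
assert (Hb : 0 < r0 / (3 * c1) < T).
{ rewrite HTe; split; [ apply Rdiv_lt_0_compat; lra | ].
  apply Rmult_lt_compat_l; [ trivial | apply Rinv_lt_contravar; [ apply Rmult_lt_0_compat | ]; lra ]. }
assert (H := riccati_blowup char_S (-1) T (char_S 0 - / 2) k ltac:(lra) char_S_continuous
  ltac:(lra) Hk
  char_S_riccati (r0 / (3 * c1)) Hb).
assert (Hy : 48 * c1 ^ 2 * rm / (r0 * Derive c u0) <= char_S 0 - / 2).
{ replace (48 * c1 ^ 2 * rm / (r0 * Derive c u0))
    with (3 / 4 * (64 * c1 ^ 2 * rm / (r0 * Derive c u0))) by (field; lra); lra. }
apply (Rlt_not_le _ _ H).
replace 1 with (k * (48 * c1 ^ 2 * rm / (r0 * Derive c u0)) * (r0 / (3 * c1)))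
  by (unfold k; field; lra).
apply Rmult_le_compat_r; [ lra | apply Rmult_le_compat_l; lra ].
Qed.

End Blowup.

(** The existence of [K] and of [eps'] belongs to the conclusion so that the quantification over
    them in the last part is not void. *)
Theorem theorem1
  (d : nat) (Hd : (1 < d)%nat)
  (c : R -> R) (c0 c1 : R)
  (Hc : Cn 2 c) (Hc0 : 0 < c0) (Hc1 : 0 < c1)
  (Hcb : forall x : R, c0 <= c x <= c1)
  (Hcd : forall x : R, Rabs (Derive c x) <= c1)
  (u0 : R) (Hu0 : 0 < Derive c u0)
  (r0 : R) (Hr0 : 0 < r0)
  (phi : R -> R) (Hphi : C1c_unit phi)
  (Hphi0 : Derive phi 0 <=
     - 2 * Rmax (32 * c1 ^ 2 * Rpower 2 (alpha d) / (r0 * c0 * Derive c u0))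
                (1 / (c0 * Rpower r0 (alpha d)))) :
  (exists K : R, 0 < K /\ energy_bound d c phi c0 u0 r0 K) /\
  (exists eps' : R, 0 < eps' /\ small_data_threshold d c phi c0 c1 u0 r0 eps') /\
  forall K eps' : R,
    0 < K -> energy_bound d c phi c0 u0 r0 K ->
    0 < eps' -> small_data_threshold d c phi c0 c1 u0 r0 eps' ->
    exists eps0 : R,
      0 < eps0 /\
      sqrt eps0 = sqrt_eps0 d c c0 c1 u0 r0 K eps' /\
      forall (eps T : R) (u ut ur : R -> R -> R),
        0 < eps -> eps < eps0 ->
        solution d c T u ut ur ->
        initial_data c phi u0 r0 eps u ut ur ->
        T < (r0 - eps) / c1.
Proof.
assert (Hc' := Cn_2_1 c Hc).
split; [ apply (energy_const_exists d c c0 c1); trivial | ].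
split; [ apply (threshold_exists d c c0 c1); trivial | ].
intros K eps' HKp HK Heps' Hth.
assert (Hal := alpha_nonneg d Hd).
set (M := M_const d c0 c1 r0 K).
assert (HM : 0 < M).
{ assert (P1 := Rpower_pos r0 (alpha d)).
  assert (P2 : 0 < sqrt r0) by (apply sqrt_lt_R0; trivial).
  assert (P3 : 0 < sqrt (r0 * c0)) by (apply sqrt_lt_R0, Rmult_lt_0_compat; trivial).
  unfold M, M_const; apply Rplus_lt_le_0_compat.
  - apply Rdiv_lt_0_compat; [ repeat apply Rmult_lt_0_compat; trivial | ].
    apply Rmult_lt_0_compat; [ lra | apply pow_lt; trivial ].
  - apply Rdiv_le_0_compat; trivial.
    apply Rmult_le_pos; [ apply Rmult_le_pos; [ trivial | apply sqrt_pos ] | lra ]. }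
set (s0 := sqrt_eps0 d c c0 c1 u0 r0 K eps').
assert (Hs0 : 0 < s0 /\ s0 <= 1 / (2 * M) /\ s0 <= sqrt eps' /\ s0 <= sqrt (r0 / 2) /\ s0 <= sqrt c0).
{ unfold s0, sqrt_eps0; fold M.
  set (b1 := r0 * Derive c u0 / _); set (b2 := 1 / (2 * M)); set (b3 := sqrt eps');
    set (b4 := sqrt (r0 / 2)); set (b5 := sqrt c0).
  generalize (Rmin_r b1 (Rmin b2 (Rmin b3 (Rmin b4 b5)))) (Rmin_l b2 (Rmin b3 (Rmin b4 b5)))
    (Rmin_r b2 (Rmin b3 (Rmin b4 b5))) (Rmin_l b3 (Rmin b4 b5)) (Rmin_r b3 (Rmin b4 b5))
    (Rmin_l b4 b5) (Rmin_r b4 b5); intros.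
  split; [ | lra ].
  repeat apply Rmin_case; try (apply sqrt_lt_R0; lra).
  - apply Rdiv_lt_0_compat; [ apply Rmult_lt_0_compat; trivial | ].
    repeat apply Rmult_lt_0_compat; try lra; try apply Rpower_pos.
  - apply Rdiv_lt_0_compat; lra. }
exists (s0 ^ 2); split; [ apply pow_lt; lra | split; [ apply sqrt_pow2; lra | ] ].
intros eps T u ut ur He Hlt Hs Hi.
assert (Hsq : sqrt eps < s0).
{ rewrite <- (sqrt_pow2 s0) by lra; apply sqrt_lt_1_alt; lra. }
assert (Hsm : forall z, 0 < z -> s0 <= sqrt z -> eps < z).
{ intros z Hz Hsz; apply sqrt_lt_0_alt; lra. }
assert (H1 : eps < eps') by (apply Hsm; lra).
assert (H2 : eps < Rmin c0 (r0 / 2)) by (apply Rmin_case; apply Hsm; lra).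
(* The entry [1 / (2 * M)] of the minimum is what caps the loss of [S] due to [R]. *)
assert (H3 : M * sqrt eps <= / 2).
{ replace (/ 2) with (M * (1 / (2 * M))) by (field; lra).
  apply Rmult_le_compat_l; lra. }
destruct (eps_small c0 r0 eps H2) as [E1 E2].
apply Rnot_le_lt; intros HT.
(* As [eps < r0 / 2], this horizon is below [(r0 - eps) / c1], hence below [T] under the contrary
   assumption. A characteristic is constructed on [[0, b)] only, so the solution is restricted to
   that interval before the threshold property is applied. *)
set (b := r0 / (2 * c1)).
assert (Hb : 0 < b) by (apply Rdiv_lt_0_compat; lra).
assert (Hbe : b < (r0 - eps) / c1).
{ replace b with (r0 / 2 * / c1) by (unfold b; field; lra).
  apply Rmult_lt_compat_r; [ apply Rinv_0_lt_compat | ]; lra. }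
destruct (characteristic_exists d c c0 c1 r0 T b u ut ur Hc' Hc0 Hcb Hr0 Hs ltac:(lra)) as [rhat Hchar].
assert (Hsb := solution_restrict d c T b u ut ur ltac:(lra) Hs).
apply (blowup d c c0 c1 r0 u0 phi Hd Hc' Hc0 Hcb Hcd Hu0 Hr0 Hphi Hphi0 b eps K u ut ur rhat); trivial.
intros t Ht.
assert (G := Hth eps b u ut ur rhat He H1 H2 Hsb Hi Hchar t Ht ltac:(lra)); lra.
Qed.
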